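(* Fix $\varepsilon>0$. There exist constants $c>0$ and $C>0$, depending only on $\varepsilon$, such that the following holds. Let $G$ be a random $n$-vertex graph obtained using any of the following models: (1) $G$ is a uniformly random $k$-regular graph on $n$ vertices, where $k=k(n)$ is an integer with $2<k<\frac15\log n$ (and $kn$ even); (2) $G$ is a uniformly random graph on $n$ vertices with $m$ edges, where $m=m(n)$ is an integer with $(1+\varepsilon)n\le m\le\frac1{11}n\log n$; (3) $G$ is a random graph $G(n,p)$, where $p=p(n)$ satisfies $\frac{1+\varepsilon}{n}\le p\le\frac1{12}\frac{\log n}{n}$. Then with high probability (i.e. with probability tending to $1$ as $n\to\infty$) we have, for $d=\operatorname{mad}(G)$, $$c\,\frac{d}{\sqrt{\log n}}\; n^{\frac{d-2}{2d-2}}\;\le\;\operatorname{tww}(G)\;\le\; n^{\frac{d-2}{2d-2}}\cdot\exp\left(C\left(d^{-1}\sqrt{\log n}\cdot\log\log n+\log d\right)\right).$$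
   Context: All graphs are finite and simple; random graphs have vertex set $\{1,\dots,n\}$; $\log$ is the natural logarithm. $G(n,p)$ is the random graph in which each possible edge is present independently with probability $p$. The maximum average degree of a graph $G$ is $\operatorname{mad}(G)=\max_{H}\frac{2e(H)}{v(H)}$, over all subgraphs $H$ of $G$ with at least one vertex, where $v(H)$ and $e(H)$ are the numbers of vertices and edges of $H$ (so $\operatorname{mad}(G)=k$ for a $k$-regular graph). Twin-width: a trigraph is a finite vertex set together with two disjoint sets of edges (unordered pairs of distinct vertices), called black and red; a graph is regarded as a trigraph with all edges black. Contracting two distinct (not necessarily adjacent) vertices $u,v$ of a trigraph means replacing them by a new vertex $w$ where, for each other vertex $x$: $wx$ is a black edge if both $ux$ and $vx$ are black edges; $wx$ is a non-edge if neither $ux$ nor $vx$ is an edge (of either colour); and $wx$ is a red edge otherwise; all other edges are unchanged. The twin-width $\operatorname{tww}(G)$ is the minimum integer $w\ge 0$ such that there is a sequence of contractions from $G$ to a one-vertex trigraph in which, in every trigraph of the sequence, every vertex is incident with at most $w$ red edges. *)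

(* Defs.v *)
From HB Require Import structures.
From mathcomp Require Import all_boot all_order all_algebra.
From mathcomp Require Import all_classical all_reals all_analysis.
From mathcomp Require Import fintype finset.

Set Implicit Arguments.
Unset Strict Implicit.
Unset Printing Implicit Defensive.

Import Order.TTheory GRing.Theory Num.Theory.
Import numFieldNormedType.Exports.

Local Open Scope ring_scope.

Section Graphs.
Variable T : finType.
Implicit Types (A S : {set T}) (F : {set {set T}}).

Definition pairs A : {set {set T}} :=
  [set e : {set T} | (e \subset A) && (#|e| == 2)].

Record sgraph := SGraph {
  edges : {set {set T}};
  edgesP : edges \subset pairs [set: T] }.

HB.instance Definition _ := [isSub for edges].
HB.instance Definition _ := [Finite of sgraph by <:].

Definition degree (G : sgraph) (x : T) : nat := #|[set e in edges G | x \in e]|.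

Definition regular (k : nat) (G : sgraph) : bool :=
  [forall x, degree G x == k].

(* [(S, F)] is a subgraph of [G] with vertex set [S] and edge set [F]. *)
Definition subgraph (G : sgraph) S F : bool :=
  (F \subset edges G) && (F \subset pairs S).

Definition mad (R : realType) (G : sgraph) : R :=
  \big[Num.max/0]_(H : {set T} * {set {set T}} |
                     subgraph G H.1 H.2 && (0 < #|H.1|)%N)
    (2 * #|H.2|%:R / #|H.1|%:R).

(* The vertex set is a subset of the fixed type [T], so that a contraction    *)
(* does not change the type of the trigraph.                                  *)
Record trigraph := Trigraph {
  tvert : {set T};
  tblack : {set {set T}};
  tred : {set {set T}};
  tblackP : tblack \subset pairs tvert;
  tredP : tred \subset pairs tvert;
  tdisjP : [disjoint tblack & tred] }.

Lemma trigraph_of_disjP (G : sgraph) :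
  [disjoint edges G & (set0 : {set {set T}})].
Proof. by rewrite -setI_eq0 setI0. Qed.

Definition trigraph_of (G : sgraph) : trigraph :=
  Trigraph (edgesP G) (sub0set _) (trigraph_of_disjP G).

Definition tedge (G : trigraph) : {set {set T}} := tblack G :|: tred G.

Definition red_degree (G : trigraph) (x : T) : nat :=
  #|[set e in tred G | x \in e]|.

(* [G'] is obtained from [G] by contracting [u] and [v] into [w]. The name    *)
(* [w] is any element of [T] that is not one of the remaining vertices; it    *)
(* may be [u] or [v], which have just been deleted.                           *)
Definition contracts_to (G G' : trigraph) (u v w : T) : Prop :=
  let rest := tvert G :\: [set u; v] in
  [/\ [/\ u \in tvert G, v \in tvert G & u != v],
      w \notin rest /\ tvert G' = w |: rest,
      {in rest, forall x, [set w; x] \in tblack G' =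
         ([set u; x] \in tblack G) && ([set v; x] \in tblack G)},
      {in rest, forall x, [set w; x] \in tred G' =
         (([set u; x] \in tedge G) || ([set v; x] \in tedge G)) &&
         ~~ (([set u; x] \in tblack G) && ([set v; x] \in tblack G))} &
      {in rest &, forall x y,
         ([set x; y] \in tblack G') = ([set x; y] \in tblack G) /\
         ([set x; y] \in tred G') = ([set x; y] \in tred G)}].

Definition has_contraction_sequence (w : nat) (G : trigraph) : Prop :=
  exists (l : nat) (H : nat -> trigraph),
    [/\ H 0%N = G,
        forall i, (i < l)%N -> exists a b c, contracts_to (H i) (H i.+1) a b c,
        #|tvert (H l)| = 1%N &
        forall i x, (i <= l)%N -> x \in tvert (H i) ->
          (red_degree (H i) x <= w)%N].

Definition is_tww (G : sgraph) (w : nat) : Prop :=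
  has_contraction_sequence w (trigraph_of G) /\
  forall w', has_contraction_sequence w' (trigraph_of G) -> (w <= w')%N.

(* The default value [0] is only used for the graph without vertices, see     *)
(* [tww_spec] below.                                                          *)
Definition tww (G : sgraph) : nat := xget 0%N [set w | is_tww G w]%classic.

Lemma contraction_exists (G : trigraph) : (1 < #|tvert G|)%N ->
  exists G' u v w, contracts_to G G' u v w.
Proof.
move=> /card_gt1P[u [v [uG vG uv]]].
pose rest := tvert G :\: [set u; v].
have restP x : x \in rest -> [/\ x \in tvert G, x != u & x != v].
  by rewrite !inE negb_or => /andP[/andP[-> ->] ->].
pose bw x := ([set u; x] \in tblack G) && ([set v; x] \in tblack G).
pose rw x := (([set u; x] \in tedge G) || ([set v; x] \in tedge G)) && ~~ bw x.
pose lift (F : {set {set T}}) (P : pred T) :=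
  [set e in F | e \subset rest] :|: [set [set u; x] | x in rest & P x].
have urest : u \notin rest by rewrite !inE eqxx.
have liftP F P : F \subset pairs (tvert G) -> lift F P \subset pairs (u |: rest).
  move=> /subsetP FG; apply/subsetP => e; rewrite !inE => /orP[/andP[eF er]|].
    have := FG _ eF; rewrite inE => /andP[_ ->]; rewrite andbT.
    exact: subset_trans er (subsetUr _ _).
  case/imsetP => x; rewrite inE => /andP[xr _] ->.
  rewrite cards2; have [_ xu _] := restP _ xr; rewrite (eq_sym u) xu andbT.
  by rewrite setUS // sub1set.
have liftw F (P : pred T) x : x \in rest -> ([set u; x] \in lift F P) = P x.
  move=> xr; rewrite !inE; have -> : [set u; x] \subset rest = false.
    by apply/negbTE; rewrite subUset sub1set (negbTE urest).
  rewrite andbF /=; apply/imsetP/idP => [[y]|Px]; last first.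
    by exists x => //; rewrite inE xr.
  rewrite inE => /andP[yr Py] /setP/(_ x); rewrite !inE eqxx orbT.
  by have [_ /negbTE -> _] := restP _ xr => /esym/eqP ->.
have lifte F P x y : x \in rest -> y \in rest ->
    ([set x; y] \in lift F P) = ([set x; y] \in F).
  move=> xr yr; rewrite !inE subUset !sub1set xr yr orbC.
  case: imsetP => [[z _ /setP/(_ u)]|_]; last by rewrite !andbT.
  rewrite !inE eqxx /=.
  have [_ /negbTE xu _] := restP _ xr; have [_ /negbTE yu _] := restP _ yr.
  by rewrite ![u == _]eq_sym xu yu.
have dj : [disjoint lift (tblack G) bw & lift (tred G) rw].
  rewrite -setI_eq0; apply/eqP/setP => e; rewrite !inE; apply/negbTE/negP.
  have eu x (A : {set T}) : A = [set u; x] -> ~~ (A \subset rest).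
    by move->; rewrite subUset sub1set (negbTE urest).
  case/andP => /orP eB /orP eR.
  case: eB => [/andP[eb er]|/imsetP[x xP ex]]; last first.
    case: eR => [/andP[_ er]|/imsetP[y yP]]; first by move: (eu _ _ ex); rewrite er.
    move: xP yP; rewrite inE => /andP[xr bx]; rewrite inE => /andP[yr /andP[_ ry]].
    rewrite ex => /setP/(_ y); rewrite !inE eqxx orbT.
    have [_ /negbTE -> _] := restP _ yr => /= /eqP yx.
    by move: ry; rewrite yx bx.
  case: eR => [/andP[ed _]|/imsetP[y _ /eu]]; last by rewrite er.
  by have := disjointFr (tdisjP G) eb; rewrite ed.
exists (Trigraph (liftP _ bw (tblackP G)) (liftP _ rw (tredP G)) dj), u, v, u.
split => //= [x xr|x xr|x y xr yr].
- by rewrite liftw.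
- by rewrite liftw.
- by rewrite !lifte.
Qed.

Lemma contraction_sequence_exists (G : trigraph) : (0 < #|tvert G|)%N ->
  has_contraction_sequence #|{set T}| G.
Proof.
have [k] := ubnP #|tvert G|; elim: k G => // k IH G Gk G0.
case: (ltnP 1 #|tvert G|) => G1; last first.
  exists 0%N, (fun=> G); split => // [|i x _ _]; first by apply/eqP; rewrite eqn_leq G1.
  exact: max_card.
have [G' [u [v [w cG]]]] := contraction_exists G1.
have [[uG vG uv] [wr G'E] _ _ _] := cG.
have cardr : (#|tvert G :\: [set u; v]| = #|tvert G| - 2)%N.
  rewrite cardsD (setIidPr _) ?cards2 ?uv//.
  by apply/subsetP => x /set2P[] ->.
have cardG' : (#|tvert G'| = #|tvert G|.-1)%N.
  by rewrite G'E cardsU1 wr cardr; case: #|tvert G| G1 => [|[]]//= j _; rewrite subn2.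
have [||l [H [H0 Hs Hl Hr]]] := IH G'.
- by rewrite cardG'; case: #|tvert G| G0 Gk.
- by rewrite cardG'; case: #|tvert G| G1 => [|[]].
exists l.+1, (fun i => if i is j.+1 then H j else G); split => //.
- case=> [_|i il]; first by exists u, v, w; rewrite H0.
  exact: Hs.
- case=> [x _ _|i x il xH]; first exact: max_card.
  exact: Hr.
Qed.

Lemma tww_spec (G : sgraph) : (0 < #|T|)%N -> is_tww G (tww G).
Proof.
move=> T0; have [|w] := @ex_minnP (fun w => `[< has_contraction_sequence w (trigraph_of G) >]).
  exists #|{set T}|; apply/asboolP; apply: contraction_sequence_exists.
  by rewrite /= cardsT.
move=> /asboolP wG wmin; apply: (@xgetPex _ 0%N [set w | is_tww G w]%classic).
by exists w; split => // w' /asboolP; exact: wmin.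
Qed.

End Graphs.

Section RandomGraphs.
Variable R : realType.

(* Probability mass functions on the graphs with vertex set ['I_n].           *)
Definition uniform_graph n (A : pred (sgraph 'I_n)) (G : sgraph 'I_n) : R :=
  if A G then #|A|%:R^-1 else 0.

Definition random_regular (k n : nat) : sgraph 'I_n -> R :=
  uniform_graph (regular k).

Definition random_gnm (m n : nat) : sgraph 'I_n -> R :=
  uniform_graph (fun G : sgraph 'I_n => #|edges G| == m).

Definition random_gnp (p : R) (n : nat) (G : sgraph 'I_n) : R :=
  \prod_(e in pairs [set: 'I_n]) (if e \in edges G then p else 1 - p).

Definition graph_prob n (mu : sgraph 'I_n -> R) (A : pred (sgraph 'I_n)) : R :=
  \sum_(G | A G) mu G.

(* The limit is taken as [n] tends to infinity inside [D], the set of the     *)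
(* orders [n] for which the model is considered. The hypotheses on the        *)
(* parameters fail for all small [n], and in the regular case a parity        *)
(* condition can exclude infinitely many [n].                                 *)
Definition with_high_probability (D : set nat)
    (mu : forall n, sgraph 'I_n -> R) (A : forall n, pred (sgraph 'I_n)) : Prop :=
  (graph_prob (mu n) (A n) @[n --> within D \oo] --> (1 : R))%classic.

Definition tww_bounds (c C : R) n (G : sgraph 'I_n) : bool :=
  let d := mad R G in
  let N := n%:R : R in
  let main := N `^ ((d - 2) / (2 * d - 2)) in
  (c * (d / Num.sqrt (ln N)) * main <= (tww G)%:R) &&
  ((tww G)%:R <= main *
     expR (C * (d^-1 * Num.sqrt (ln N) * ln (ln N) + ln d))).

End RandomGraphs.

(* Main.v *)
(* In all three models [P (F \subset edges G) <= (B / n) ^ #|F|] for every set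
   of pairs [F], where [B] is at most a constant times both [mad G] and [log n]
   (for regular graphs this is a switching argument). Apart from this only
   [mad G >= 2 + const] is used; in G(n,p) it comes from a graph search that
   leaves all pairs inside a set of linear size unqueried, so that the explored
   tree receives linearly many further edges.

   Upper bound. Let [d = mad G] and [t] about [sqrt (log n) / d]. By Hakimi's
   theorem the multigraph with [t] copies of every edge has an orientation with
   out-degrees at most [h], where [h] is about [t d / 2]. Every vertex receives a
   label of [m] bits, with [2 ^ m] about [n ^ (d / (2 d - 2))]: bit [i] is copied
   from the out-neighbour in slot [i %% h]. The labels of two adjacent vertices
   then share about [2 m / d] bits, so that a label prefix is adjacent to about
   [2 ^ (m (1 - 2 / d))], that is [n ^ ((d - 2) / (2 d - 2))], others, and this is
   also the size [n / 2 ^ m] of a label class when the bits that are not copied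
   are random. Contract the label classes, then forget the bits one by one. The
   bits are copied along non-backtracking walks; the few vertices near a short
   cycle, where such walks can meet again, are left alone until the end.

   Lower bound. Let [S] be a densest set of vertices. In a contraction sequence
   of width [w] freeze a part of [S] as soon as it has [sz] elements. This splits
   [S] into [N] blocks of size at most [2 sz] such that all edges of [G] in [S]
   join one of [N * O(w)] pairs of blocks, and a union bound over the partitions
   and the sets of pairs shows that this is unlikely for every [S]. *)

From HB Require Import structures.
Require Import Defs.
From mathcomp Require Import all_boot all_order all_algebra.
From mathcomp Require Import all_classical all_reals all_analysis.
From mathcomp Require Import fintype finset.
From mathcomp Require Import zify ring lra.

Set Implicit Arguments.
Unset Strict Implicit.
Unset Printing Implicit Defensive.

Import Order.TTheory GRing.Theory Num.Theory.
Import numFieldNormedType.Exports.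

(** * Contraction sequences from partitions *)

Section Quotients.
Variable (T : finType).
Implicit Types (G : sgraph T) (x y u v : T) (r : T -> T).

(** Write $l = \log n$. Both error factors come from a balance. Upper bound: $h$ is an integer, and
    rounding $td/2$ up costs a factor $\exp(O(l/(td^2)))$, while there are up to $(2h)^t$ patterns
    of slots for an edge; $t \approx \sqrt l/d$ balances the two up to $\log\log n$, and $t \ge 1$
    leaves $\log d$. A copy divides the index of a bit by about $h/t \approx d/2$; as $d/2$ exceeds
    1 by a constant, chains of copies have length $O(\log\log n)$, and the balls in which they live
    are small. Lower bound: for blocks of size about $n^{(d-2)/(2d-2)}\sqrt l/d$ the choice of $S$
    and of its partition costs about $n^{d/(2d-2)}$ per vertex of $S$, and each of the $d/2$ edges
    per vertex gains about $n^{-1/(d-1)}$. These powers of $n$ cancel exactly, so a small constant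
    $c$ decides. The number of recorded pairs is a small multiple of $|S|d^2/l$; each costs a factor
    of about $n^{1/(d-1)}$ to choose, in total $\exp(O(d|S|))$, and that is where the factor
    $d/\sqrt l$ comes from. *)

Definition adj G : rel T := fun x y => [set x; y] \in edges G.

Lemma adjC G x y : adj G x y = adj G y x.
Proof. by rewrite /adj setUC. Qed.

Lemma adj_neq G x y : adj G x y -> x != y.
Proof.
move=> xy; have /subsetP/(_ _ xy) := edgesP G; rewrite inE cards2 => /andP[_].
by case: (x == y).
Qed.

Lemma edgeP G e : e \in edges G -> exists x y, e = [set x; y] /\ adj G x y.
Proof.
move=> eG; have /subsetP/(_ _ eG) := edgesP G; rewrite inE => /andP[_ /cards2P[x [y [xy eE]]]].
by exists x, y; split => //; rewrite /adj -eE.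
Qed.

Definition nbh G x : {set T} := [set y | adj G x y].

Lemma card_nbh G x : #|nbh G x| = degree G x.
Proof.
rewrite /degree -(card_in_imset (f := fun y => [set x; y]) (D := mem (nbh G x))).
  apply: eq_card => e; apply/imsetP/idP.
    by case=> y; rewrite inE => xy ->; rewrite inE !inE eqxx andbT; exact: xy.
  rewrite inE => /andP[/[dup] eG /edgeP[a [b [-> ab]]]].
  rewrite !inE => /orP[]/eqP ->; first by exists b => //; rewrite inE.
  by exists a; rewrite ?inE 1?adjC // setUC.
move=> y z; rewrite !inE => /adj_neq yx /adj_neq zx /setP/(_ y).
by rewrite !inE eqxx orbT [y == x]eq_sym (negbTE yx) => /esym/eqP.
Qed.

(* The class of [x] is named [r x]: [r] need not be idempotent. *)
Definition qadj G r u v := [exists x, exists y, [&& r x == u, r y == v & adj G x y]].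

Definition qfull G r u v :=
  [forall x, forall y, (r x == u) && (r y == v) ==> adj G x y].

Definition qvert r : {set T} := [set r x | x in T].

Definition qblack G r : {set {set T}} :=
  [set e in pairs (qvert r) | [forall x, forall y, ([set r x; r y] == e) ==> adj G x y]].

Definition qred G r : {set {set T}} :=
  [set e in pairs (qvert r) |
    [exists x, exists y, ([set r x; r y] == e) && adj G x y]] :\: qblack G r.

Lemma qblackP G r : qblack G r \subset pairs (qvert r).
Proof. by apply/subsetP => e; rewrite inE => /andP[]. Qed.

Lemma qredP G r : qred G r \subset pairs (qvert r).
Proof. by apply/subsetP => e; rewrite in_setD inE => /and3P[]. Qed.

Lemma qdisjP G r : [disjoint qblack G r & qred G r].
Proof. by rewrite disjoint_sym disjoints_subset subsetDr. Qed.

Definition quotient_trigraph G r : trigraph T :=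
  Trigraph (qblackP G r) (qredP G r) (qdisjP G r).

Lemma qvertP r u : reflect (exists x, r x = u) (u \in qvert r).
Proof. by apply: (iffP imsetP) => [[x _ ->]|[x <-]]; exists x. Qed.

Lemma set2_eq u v x y : [set x; y] = [set u; v] -> (x = u /\ y = v) \/ (x = v /\ y = u).
Proof.
move=> E; have: x \in [set u; v] by rewrite -E !inE eqxx.
have: y \in [set u; v] by rewrite -E !inE eqxx orbT.
have: u \in [set x; y] by rewrite E !inE eqxx.
have: v \in [set x; y] by rewrite E !inE eqxx orbT.
rewrite !inE => /orP[]/eqP -> /orP[]/eqP -> /orP[]/eqP ? /orP[]/eqP ?; subst; auto.
Qed.

Lemma qblackE G r u v : u \in qvert r -> v \in qvert r -> u != v ->
  ([set u; v] \in qblack G r) = qfull G r u v.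
Proof.
move=> uV vV uv; rewrite !inE subUset !sub1set uV vV cards2 uv /=.
apply/forallP/forallP => H x; apply/forallP => y; apply/implyP.
  by case/andP => /eqP rx /eqP ry; have /forallP/(_ y) := H x; rewrite rx ry eqxx.
move/eqP/set2_eq => [] [rx ry].
  by have /forallP/(_ y) := H x; rewrite rx ry !eqxx.
by have /forallP/(_ x) := H y; rewrite rx ry !eqxx adjC.
Qed.

Lemma qedgeE G r u v : u \in qvert r -> v \in qvert r -> u != v ->
  ([set u; v] \in tedge (quotient_trigraph G r)) = qadj G r u v.
Proof.
move=> uV vV uv; rewrite /tedge /= in_setU qblackE // in_setD qblackE //.
rewrite inE inE subUset !sub1set uV vV cards2 uv /=.
have -> : [exists x, exists y, ([set r x; r y] == [set u; v]) && adj G x y] = qadj G r u v.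
  apply/existsP/existsP => -[x /existsP[y]].
    case/andP => /eqP/set2_eq[] [rx ry] xy.
      by exists x; apply/existsP; exists y; rewrite rx ry !eqxx.
    by exists y; apply/existsP; exists x; rewrite rx ry !eqxx adjC.
  by case/and3P => /eqP <- /eqP <- xy; exists x; apply/existsP; exists y; rewrite eqxx.
case: (boolP (qfull G r u v)) => //= /forallP H; apply/esym/existsP.
have [x rx] := qvertP _ _ uV; have [y ry] := qvertP _ _ vV.
exists x; apply/existsP; exists y; rewrite rx ry !eqxx /=.
by have /forallP/(_ y) := H x; rewrite rx ry !eqxx.
Qed.

Lemma qredE G r u v : u \in qvert r -> v \in qvert r -> u != v ->
  ([set u; v] \in qred G r) = qadj G r u v && ~~ qfull G r u v.
Proof.
move=> uV vV uv; rewrite -qedgeE // /tedge in_setU -qblackE // -/(tred _).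
rewrite /= in_setD; by case: (_ \in qblack _ _); rewrite /= ?orbF ?andbT.
Qed.

(** Black neighbours are counted as well: an upper bound for the red degree is enough, and this one
    is monotone in the edges. *)
Definition qnbh G r u : {set T} := [set v | (v != u) && qadj G r u v].

Lemma red_degree_quotient G r u :
  (red_degree (quotient_trigraph G r) u <= #|qnbh G r u|)%N.
Proof.
rewrite -(card_in_imset (f := fun y => [set u; y]) (D := mem (qnbh G r u))).
  apply/subset_leq_card/subsetP => e; rewrite inE => /andP[eR ue].
  have := subsetP (qredP G r) _ eR; rewrite inE => /andP[/subsetP eV /cards2P[a [b [ab eE]]]].
  rewrite eE in eR ue eV; have aV := eV _ (set21 _ _); have bV := eV _ (set22 _ _).
  move: (eR); rewrite /= qredE // => /andP[qab _].
  have qba : qadj G r b a.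
    have/existsP[x /existsP[y /and3P[xa yb xy]]] := qab.
    by apply/existsP; exists y; apply/existsP; exists x; rewrite adjC xa yb xy.
  case/set2P: ue => ->; apply/imsetP.
    by exists b => //; rewrite inE eq_sym ab.
  by exists a; rewrite ?inE ?ab // eE setUC.
move=> y z; rewrite !inE => /andP[yx _] /andP[zx _] /setP/(_ y).
by rewrite !inE eqxx orbT (negbTE yx) => /esym/eqP.
Qed.

Definition qmerge r u v : T -> T := fun x => if r x == v then u else r x.

Lemma qvert_merge r u v : u \in qvert r -> u != v ->
  qvert (qmerge r u v) = u |: (qvert r :\: [set u; v]).
Proof.
move=> uV uv; apply/setP => a; rewrite !inE; apply/qvertP/idP.
  case=> x <-; rewrite /qmerge; case: (r x =P v) => [|/eqP rv]; first by rewrite eqxx.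
  by rewrite (negbTE rv) orbF; case: eqP => //= _; apply/qvertP; exists x.
case/orP => [/eqP ->|/andP[]].
  have [x rx] := qvertP _ _ uV; exists x; by rewrite /qmerge rx (negbTE uv).
rewrite negb_or => /andP[au av] /qvertP[x rx]; exists x.
by rewrite /qmerge rx (negbTE av).
Qed.

(** For the merged class, fullness is the conjunction and adjacency the disjunction of those of the
    two old classes, which is the colour rule of a contraction. *)
Lemma qmerge_contracts G r u v : u \in qvert r -> v \in qvert r -> u != v ->
  contracts_to (quotient_trigraph G r) (quotient_trigraph G (qmerge r u v)) u v u.
Proof.
move=> uV vV uv; set r' := qmerge r u v.
have V'E := qvert_merge uV uv.
have restP x : x \in qvert r :\: [set u; v] ->
    [/\ x \in qvert r, x != u & x != v] /\ x \in qvert r'.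
  move=> xR; rewrite V'E in_setU1 xR orbT; split => //.
  by move: xR; rewrite !inE negb_or => /andP[/andP[-> ->] ->].
have uV' : u \in qvert r' by rewrite V'E setU11.
have mu x : (r' x == u) = (r x == u) || (r x == v).
  by rewrite /r' /qmerge orbC; case: (r x =P v); rewrite ?eqxx.
have mo x a : a != u -> a != v -> (r' x == a) = (r x == a).
  move=> au av; rewrite /r' /qmerge; case: (r x =P v) => [->|//].
  by rewrite !(eq_sym _ a) (negbTE au) (negbTE av).
have fu x : x != u -> x != v -> qfull G r' u x = qfull G r u x && qfull G r v x.
  move=> xu xv; apply/forallP/andP => [H|[/forallP H1 /forallP H2]].
    split; apply/forallP => a; apply/forallP => b; apply/implyP => /andP[ra rb];
      have /forallP/(_ b) := H a; by rewrite mu mo // ra rb ?orbT.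
  move=> a; apply/forallP => b; rewrite mu mo //; apply/implyP => /andP[/orP[]ra rb].
    by have /forallP/(_ b) := H1 a; rewrite ra rb.
  by have /forallP/(_ b) := H2 a; rewrite ra rb.
have au x : x != u -> x != v -> qadj G r' u x = qadj G r u x || qadj G r v x.
  move=> xu xv; apply/existsP/orP.
    case=> a /existsP[b]; rewrite mu mo // => /and3P[/orP[]ra rb ab]; [left|right];
      by apply/existsP; exists a; apply/existsP; exists b; rewrite ra rb.
  by case=> /existsP[a /existsP[b /and3P[ra rb ab]]]; exists a; apply/existsP; exists b;
    rewrite mu mo // ra rb ab ?orbT.
have fo x y : x != u -> x != v -> y != u -> y != v -> qfull G r' x y = qfull G r x y.
  by move=> xu xv yu yv; apply: eq_forallb => a; apply: eq_forallb => b; rewrite !mo.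
have ao x y : x != u -> x != v -> y != u -> y != v -> qadj G r' x y = qadj G r x y.
  by move=> xu xv yu yv; apply: eq_existsb => a; apply: eq_existsb => b; rewrite !mo.
split => //=.
- split; [by rewrite !inE eqxx | exact: V'E].
- move=> x /restP[[xV xu xv] xV']; rewrite !qblackE // 1?eq_sym //.
  exact: fu.
- move=> x /restP[[xV xu xv] xV'].
  rewrite -!/(tedge (quotient_trigraph G r)) !qedgeE // 1?eq_sym // ?[v == x]eq_sym //.
  rewrite !qblackE // 1?eq_sym // ?[v == x]eq_sym // qredE // 1?eq_sym //.
  by rewrite au // fu.
- move=> x y /restP[[xV xu xv] xV'] /restP[[yV yu yv] yV'].
  (* The last clause of [contracts_to] also covers $x = y$, where [[set x; y]] is a singleton and
     hence no edge of either trigraph. *)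
  have [->|xy] := eqVneq x y.
    have no (F : {set {set T}}) A : F \subset pairs A -> ([set y; y] \in F) = false.
      by move=> /subsetP FA; apply/negP => /FA; rewrite inE cards2 eqxx andbF.
    by rewrite !(no _ _ (qblackP _ _)) !(no _ _ (qredP _ _)).
  by rewrite !qblackE // !qredE // fo // ao.
Qed.

Lemma trigraph_eq (H K : trigraph T) : tvert H = tvert K ->
  tblack H = tblack K -> tred H = tred K -> H = K.
Proof.
case: H => V B D P1 P2 P3; case: K => V' B' D' Q1 Q2 Q3 /= eV eB eD; subst.
by rewrite (bool_irrelevance P1 Q1) (bool_irrelevance P2 Q2) (bool_irrelevance P3 Q3).
Qed.

Lemma quotient_trigraph_id G : quotient_trigraph G id = trigraph_of G.
Proof.
have V : qvert id = [set: T] by apply/setP => x; rewrite inE; apply/qvertP; exists x.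
have E e : e \in pairs [set: T] -> (e \in qblack G id) = (e \in edges G).
  rewrite inE => /andP[_ /cards2P[x [y [xy ->]]]]; rewrite qblackE ?V ?inE //.
  apply/forallP/idP => [/(_ x)/forallP/(_ y)|xyG a]; first by rewrite !eqxx.
  by apply/forallP => b; apply/implyP => /andP[/eqP -> /eqP ->].
have B : qblack G id = edges G.
  apply/setP => e; apply/idP/idP => eB; have := eB; rewrite E //.
    by have := subsetP (qblackP G id) _ eB; rewrite V.
  exact: (subsetP (edgesP G)).
apply: trigraph_eq => //=; apply/eqP; rewrite setD_eq0 B.
apply/subsetP => e; rewrite inE => /andP[_ /existsP[x /existsP[y /andP[/eqP <-]]]].
by rewrite /adj => ->.
Qed.

(* [r] is between the partitions into the level sets of [f] and of [g]. *)
Definition between (A B : eqType) (f : T -> A) (g : T -> B) r :=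
  (forall x y, f x = f y -> r x = r y) /\ (forall x y, r x = r y -> g x = g y).

(** Two classes on which [f i.+1] agrees may be merged in any order, since the map stays between
    [f i] and [f i.+1]. So red degrees need a bound only for maps between two consecutive levels.
    The induction is on the number of classes. *)
Lemma contraction_of_phases (A : eqType) G w q (f : nat -> T -> A) :
  (0 < #|T|)%N -> (0 < q)%N ->
  injective (f 0%N) ->
  (forall i x y, f i x = f i y -> f i.+1 x = f i.+1 y) ->
  (forall x y, f q x = f q y) ->
  (forall i r, (i < q)%N -> between (f i) (f i.+1) r -> forall u, (#|qnbh G r u| <= w)%N) ->
  has_contraction_sequence w (trigraph_of G).
Proof.
move=> T0 q0 f0 fS fq fw; rewrite -quotient_trigraph_id.
have: exists2 i, (i < q)%N & between (f i) (f i.+1) id.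
  by exists 0%N => //; split=> [|x y -> //]; exact: f0.
move: id => r; have [k] := ubnP #|qvert r|; elim: k r => // k IH r rk [i0 i0q i0r].
(* The largest level is taken: if no merge is possible inside it, [r] already lies between the next
   two levels, so maximality forces $i + 1 = q$, and a single class is left. *)
pose P i := (i < q)%N && `[< between (f i) (f i.+1) r >].
have exP : exists i, P i by exists i0; rewrite /P i0q; apply/asboolP.
have ubP i : P i -> (i <= q)%N by case/andP => /ltnW.
have {i0 i0q i0r exP ubP} [i /andP[iq /asboolP ir] imax] := ex_maxnP exP ubP.
have rw u : (red_degree (quotient_trigraph G r) u <= w)%N.
  exact: leq_trans (red_degree_quotient _ _ _) (fw _ _ iq ir u).
have [/existsP[x /existsP[y /andP[rxy /eqP fxy]]]|/existsPn H] :=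
    boolP [exists x, exists y, (r x != r y) && (f i.+1 x == f i.+1 y)].
  have xV : r x \in qvert r by apply/qvertP; exists x.
  have yV : r y \in qvert r by apply/qvertP; exists y.
  have [||l [K [K0 KS Kl Kw]]] := IH (qmerge r (r x) (r y)).
  - have V1 : (1 < #|qvert r|)%N by apply/card_gt1P; exists (r x), (r y).
    have xyV : [set r x; r y] \subset qvert r by apply/subsetP => z /set2P[] ->.
    rewrite qvert_merge // cardsU1 !inE eqxx /= cardsD (setIidPr xyV) cards2 rxy /=.
    by move: rk V1; lia.
  - exists i => //; split=> a b.
      by move=> /ir.1; rewrite /qmerge => ->.
    rewrite /qmerge; case: eqP => [/ir.2 fa|_]; case: eqP => [/ir.2 fb|_].
    + by rewrite fa fb.
    + by move/ir.2 => <-; rewrite fa.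
    + by move/ir.2 => ->; rewrite fb.
    + exact: ir.2.
  exists l.+1, (fun j => if j is j'.+1 then K j' else quotient_trigraph G r); split => //.
    case=> [_|j]; last exact: KS.
    by exists (r x), (r y), (r x); rewrite K0; exact: qmerge_contracts.
  by case=> [z|j z]; [move=> _ _; exact: rw|exact: Kw].
have rf x y : f i.+1 x = f i.+1 y -> r x = r y.
  move=> fxy; apply/eqP; have := H x; apply: contraNT => rxy.
  by apply/existsP; exists y; rewrite rxy fxy eqxx.
have [iq'|qi] := ltnP i.+1 q.
  have iP : P i.+1.
    by rewrite /P iq' /=; apply/asboolP; split => // x y /ir.2; exact: fS.
  by have := imax _ iP; rewrite ltnn.
have {qi} qi : q = i.+1 by apply/eqP; rewrite eqn_leq qi.
exists 0%N, (fun=> quotient_trigraph G r); split => //= .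
apply/eqP; have [x _] := card_gt0P T0; apply/cards1P; exists (r x).
apply/setP => u; rewrite inE; apply/qvertP/eqP => [[y <-]|->]; last by exists x.
by apply: rf; rewrite -qi.
Qed.

End Quotients.

(** * Orientations *)

Section Orientation.
Variables (T : finType) (G : sgraph T) (t : nat).
Implicit Types (x y u v a b : T) (own : {set T} * 'I_t -> T).

Definition edges_in (S : {set T}) : {set {set T}} := [set e in edges G | e \subset S].

Definition copies : {set {set T} * 'I_t} := [set k | k.1 \in edges G].

Definition valid_owner own := {in copies, forall k, own k \in k.1}.

Definition load own v := #|[set k in copies | own k == v]|.

(** An arc from [a] to [b] means that one unit of load can be passed from [a] to [b]. *)
Definition transfer own : rel T :=
  fun a b => [exists k in copies, [&& own k == a, b \in k.1 & b != a]].

(** One copy is passed on along every arc of the path, so inner vertices keep their load and only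
    the ends change. *)
Lemma augment own a p : valid_owner own -> uniq (a :: p) -> path (transfer own) a p ->
  exists own', valid_owner own' /\
    forall v, (load own' v + (v == a) = load own v + (v == last a p))%N.
Proof.
elim: p a own => [|b p IH] a own vown.
  by move=> _ _; exists own.
rewrite cons_uniq => /andP[ap up] /= /andP[/existsP[k /and4P[kC /eqP ka bk ba]] pp].
pose own1 k' := if k' == k then b else own k'.
have vown1 : valid_owner own1.
  by move=> k' k'C; rewrite /own1; case: eqP => [->|_] //; exact: vown.
have l1 v : (load own1 v + (v == a) = load own v + (v == b))%N.
  have ks : k \in [set k in copies | own k == a] by rewrite inE kC ka eqxx.
  have [->|va] := eqVneq v a.
    rewrite eq_sym (negbTE ba) addn0 /load (cardsD1 k [set k in copies | own k == a]) ks add1n addn1.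
    congr (_.+1); apply: eq_card => k'; rewrite !inE /own1.
    by case: (eqVneq k' k) => [->|_] /=; rewrite ?(negbTE ba) ?andbF.
  rewrite addn0; have [->|vb] := eqVneq v b; rewrite ?addn0 ?addn1 /load.
    have k1s : k \in [set k in copies | own1 k == b] by rewrite inE kC /own1 !eqxx.
    rewrite (cardsD1 k) k1s add1n; congr (_.+1).
    apply: eq_card => k'; rewrite !inE /own1.
    by case: (eqVneq k' k) => [->|_] //=; rewrite ka eq_sym (negbTE ba) andbF.
  apply: eq_card => k'; rewrite !inE /own1; case: (eqVneq k' k) => [->|_] //.
  by rewrite ka ![_ == v]eq_sym (negbTE va) (negbTE vb).
(* The first transfer takes a copy away from [a] only, and the rest of the path avoids [a], so its
   arcs survive. *)
have gen q c : c != a -> a \notin q -> path (transfer own) c q -> path (transfer own1) c q.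
  elim: q c => //= d q IHq c ca; rewrite inE negb_or => /andP[ad aq] /andP[tcd pq].
  apply/andP; split; last by apply: IHq => //; rewrite eq_sym.
  have /existsP[k' /and4P[k'C /eqP k'c dk' dc]] := tcd.
  apply/existsP; exists k'; rewrite k'C dk' dc /own1 !andbT.
  case: (eqVneq k' k) => [kk'|_]; last by rewrite k'c eqxx.
  by move: ca; rewrite -k'c kk' ka eqxx.
have pp1 : path (transfer own1) b p.
  by apply: gen => //; move: ap; rewrite inE negb_or => /andP[].
have [own' [vown' l']] := IH _ _ vown1 up pp1.
exists own'; split => // v; have := l' v; have := l1 v; lia.
Qed.

(** Induction on the total overload. If an overloaded vertex reaches an underloaded one, augment
    along a path. Otherwise all copies owned in the reachable set [R] are edges inside [R], and the
    density condition on [R] contradicts the overload. *)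
Lemma balanced_owner n : (forall S, t * #|edges_in S| <= n * #|S|)%N ->
  forall own, valid_owner own ->
  exists own', valid_owner own' /\ forall v, (load own' v <= n)%N.
Proof.
move=> dens own; have [k] := ubnP (\sum_v (load own v - n)).
elim: k own => // k IH own kE vown.
have [/existsP[v0 v0n]|/existsPn H] := boolP [exists v, n < load own v]; last first.
  by exists own; split => // v; rewrite leqNgt.
pose R := [set b | connect (transfer own) v0 b].
have v0R : v0 \in R by rewrite inE connect0.
have [/existsP[b /andP[bR bn]]|/existsPn H] := boolP [exists b, (b \in R) && (load own b < n)].
  move: bR; rewrite inE => /connectP[p0 pp0 bE0].
  move: bE0; have [p pp up _] := shortenP pp0 => bE.
  have [own' [vown' l']] := augment vown up pp.
  apply: (IH own') => //; rewrite -ltnS; apply: leq_trans kE; rewrite ltnS.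
  have v0b : v0 != b by apply: contraTneq bn => <-; rewrite -leqNgt ltnW.
  rewrite (bigD1 v0) //= [ltnRHS](bigD1 v0) //= -addSn leq_add //.
    by have := l' v0; rewrite -bE eqxx (negbTE v0b); lia.
  apply: leq_sum => v vv0; have := l' v; rewrite -bE (negbTE vv0) addn0.
  by case: (eqVneq v b) => [->|_]; lia.
have sumR : (n * #|R| < \sum_(v in R) load own v)%N.
  rewrite mulnC -sum_nat_const (bigD1 v0) //= [ltnRHS](bigD1 v0) //= -addSn leq_add //.
  by apply: leq_sum => v /andP[vR _]; have := H v; rewrite vR -leqNgt.
have : (\sum_(v in R) load own v <= t * #|edges_in R|)%N.
  have -> : \sum_(v in R) load own v = #|[set k in copies | own k \in R]|.
    rewrite -sum1_card (partition_big own (mem R)) => [|k']; last by rewrite inE => /andP[].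
    apply: eq_bigr => v vR; rewrite /load -sum1_card; apply: eq_bigl => k'.
    by rewrite in_set [in RHS]in_set; case: (eqVneq (own k') v) => [->|_]; rewrite ?vR ?andbT ?andbF.
  have -> : (t * #|edges_in R|)%N = #|finset.setX (edges_in R) [set: 'I_t]|%N.
    by rewrite cardsX cardsT card_ord mulnC.
   apply/subset_leq_card/subsetP => -[e c].
  rewrite !inE /= andbT => /andP[eG oR]; rewrite eG /=; apply/subsetP => b be.
  have [bE|bo] := eqVneq b (own (e, c)); first by rewrite bE inE.
  move: oR; rewrite !inE => /connect_trans; apply; apply/connect1/existsP.
  by exists (e, c); rewrite inE /= eG eqxx be.
by rewrite leqNgt => /negP[]; apply: leq_ltn_trans sumR; exact: dens.
Qed.

(* Hakimi's theorem for the multigraph with [t] copies of every edge: the     *)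
(* slots of [x] carry the out-neighbours of [x], an unused slot carries [x].  *)
Lemma orientation n : (forall S, t * #|edges_in S| <= n * #|S|)%N ->
  exists sg : T -> 'I_n -> T,
    (forall x i, sg x i = x \/ adj G x (sg x i)) /\
    (forall x y, adj G x y ->
       #|[set i | sg x i == y]| + #|[set i | sg y i == x]| = t)%N.
Proof.
move=> dens; case: (pickP T) => [x0 _|T0]; last first.
  by exists (fun x _ => x); split => [x|x]; have := T0 x.
have [own [vown lown]] : exists own, valid_owner own /\ forall v, (load own v <= n)%N.
  apply: (balanced_owner dens (own := fun k => odflt x0 [pick x in k.1])) => -[e c].
  rewrite inE /= => /edgeP[x [y [-> _]]]; case: pickP => //= /(_ x).
  by rewrite !inE eqxx.
pose sl v := enum [set k in copies | own k == v].
have szl v : (size (sl v) <= n)%N by rewrite /sl -cardE lown.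
pose other v (e : {set T}) := odflt v [pick y in e :\ v].
have otherE x y : x != y -> other x [set x; y] = y.
  move=> xy; rewrite /other; case: pickP => [z|/(_ y)]; rewrite !inE.
    by case/andP => /negbTE -> /= /eqP.
  by rewrite eqxx orbT andbT eq_sym (negbTE xy).
pose sg v (i : 'I_n) := nth v [seq other v k.1 | k <- sl v] i.
have slP x k : k \in sl x -> [/\ k \in copies, own k = x & exists2 y, adj G x y & k.1 = [set x; y]].
  rewrite mem_enum inE => /andP[kC /eqP kx]; split => //.
  have := vown _ kC; move: kC; rewrite inE kx => /edgeP[a [b [-> ab]]].
  by case/set2P => ->; [exists b|exists a; rewrite 1?adjC // setUC].
exists sg; split => [x i|x y xy].
  rewrite /sg; have [isz|isz] := ltnP i (size (sl x)); last by left; rewrite nth_default ?size_map.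
  right; case Esl: (sl x) => [|k0 s]; first by rewrite Esl in isz.
  rewrite -Esl (nth_map k0) //; have [_ _ [y xy ->]] := slP _ _ (mem_nth k0 isz).
  by rewrite otherE // (adj_neq xy).
have cnt u v : adj G u v -> #|[set i | sg u i == v]| = #|[set c | own ([set u; v], c) == u]|.
  move=> uv; have vu : (u == v) = false by apply/negbTE/adj_neq/uv.
  transitivity (count (fun k : {set T} * 'I_t => k.1 == [set u; v]) (sl u)).
    have -> : #|[set i | sg u i == v]| = count (fun i => nth u [seq other u k.1 | k <- sl u] i == v) (iota 0 n).
      by rewrite -val_enum_ord count_map cardsE cardE size_filter -enumT.
    rewrite -(subnKC (szl u)) iotaD count_cat add0n addnC [X in (X + _)%N](_ : _ = 0%N) ?add0n.
      have -> : iota 0 (size (sl u)) = iota 0 (size [seq other u k.1 | k <- sl u]).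
        by rewrite size_map.
      rewrite -(count_map (nth u [seq other u k.1 | k <- sl u]) (pred1 v)).
      rewrite -/(mkseq _ _) mkseq_nth count_map; apply: eq_in_count => k /slP[_ _ [w uw kE]] /=.
      rewrite kE otherE ?(adj_neq uw) //; apply/eqP/eqP => [->//|/setP/(_ w)].
      by rewrite !inE eqxx orbT eq_sym (negbTE (adj_neq uw)) => /esym/eqP.
    apply/eqP; rewrite -leqn0 leqNgt -has_count; apply/hasPn => i; rewrite mem_iota => /andP[si _].
    by rewrite nth_default ?size_map // vu.
  rewrite -size_filter -(card_uniqP (filter_uniq _ (enum_uniq _))).
  rewrite -(card_imset (f := pair [set u; v])) => [|c c' []//].
  apply: eq_card => -[e c]; rewrite mem_filter mem_enum !inE /=.
  apply/and3P/imsetP => [[/eqP -> _ ou]|[c']].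
    by exists c => //; rewrite inE.
  by rewrite inE => /eqP ou [-> ->]; rewrite eqxx ou.
have yx : adj G y x by rewrite adjC.
rewrite !cnt // [X in (_ + X)%N](_ : _ = #|~: [set c | own ([set x; y], c) == x]|).
  by rewrite cardsC card_ord.
apply: eq_card => c; rewrite !inE setUC.
have /set2P[->|->] : own ([set x; y], c) \in [set x; y] by apply: vown; rewrite inE.
  by rewrite eqxx (negbTE (adj_neq xy)).
by rewrite eqxx [y == x]eq_sym (negbTE (adj_neq xy)).
Qed.

End Orientation.

(** * Copied bits *)

Section Slots.
Variables (h t : nat) (h_gt0 : (0 < h)%N) (th : (t <= h)%N).
Implicit Types (A B : {set 'I_h}).

Definition slot i : 'I_h := Ordinal (ltn_pmod i h_gt0).

Lemma count_slots A c p :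
  count (fun i => slot i \in A) (iota (c * h) (p * h)) = (p * #|A|)%N.
Proof.
elim: p c => [|p IH] c; first by rewrite mul0n.
rewrite mulSn iotaD count_cat -mulSnr IH mulSn; congr (_ + _)%N.
have -> : #|A| = count (mem A) (enum 'I_h).
  by rewrite cardE -size_filter enumT.
rewrite -{1}[(c * h)%N]addn0 iotaDl count_map -val_enum_ord count_map.
apply: eq_count => i /=; congr (_ \in A); apply: val_inj.
by rewrite /= modnMDl modn_small.
Qed.

(* Bit [i] of a vertex whose slot [i] points along an edge is a copy of bit   *)
(* [copy A B i] of the other end: [A] and [B] are the sets of slots which the *)
(* two ends use for this edge, and the bits in the slots [B] of the other end *)
(* are skipped, so that no bit is copied back and forth along an edge.        *)
Definition copy A B i : nat :=
  nth 0%N [seq g <- iota 0 i | slot g \notin B]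
    (count (fun j => slot j \in A) (iota h (i - h))).

Lemma count_notin B p : count (fun g => slot g \notin B) (iota 0 (p * h)) = (p * (h - #|B|))%N.
Proof.
rewrite (eq_count (a2 := fun g => slot g \in ~: B)) => [|g]; last by rewrite inE.
have := count_slots (~: B) 0 p; rewrite mul0n => ->; congr (_ * _)%N.
by rewrite -[h in (h - _)%N]card_ord -(cardsC B) addKn.
Qed.

Lemma card_slot_le B : (#|B| <= h)%N.
Proof. by rewrite -[leqRHS]card_ord max_card. Qed.

Lemma rank_lt A i : (h <= i)%N -> slot i \in A ->
  (count (fun j => slot j \in A) (iota h (i - h)) < i %/ h * #|A|)%N.
Proof.
move=> hi iA; have := count_slots A 1 (i %/ h); rewrite mul1n => <-.
have le : ((i - h).+1 <= i %/ h * h)%N.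
  by have := ltn_ceil i h_gt0; lia.
rewrite -(subnKC le) iotaD count_cat; apply: leq_trans (leq_addr _ _).
by rewrite -[(i - h).+1]addn1 iotaD count_cat /= subnKC // iA addn0 addn1.
Qed.

Lemma copy_mem A B i : (#|A| + #|B| = t)%N -> (h <= i)%N -> slot i \in A ->
  (count (fun j => slot j \in A) (iota h (i - h)) <
     size [seq g <- iota 0 i | slot g \notin B])%N.
Proof.
move=> AB hi iA; apply: leq_trans (rank_lt hi iA) _.
rewrite size_filter -{2}(subnKC (leq_trunc_div i h)) iotaD count_cat count_notin.
by apply: leq_trans (leq_addr _ _); rewrite leq_mul2l; apply/orP; right; lia.
Qed.

(** A period of $h$ bits has $|A|$ bits to fill and $h - |B| \ge |A|$ bits to copy from, and filling
    starts one period late, so the source lies before [i]. The number of its period shrinks by a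
    factor $|A|/(h - |B|) \le t/h$, as $|A| = t - |B|$; this keeps chains of copies short. *)
Lemma copyP A B i : (#|A| + #|B| = t)%N -> (h <= i)%N -> slot i \in A ->
  [/\ (copy A B i < i)%N, slot (copy A B i) \notin B &
      (copy A B i %/ h * h < i %/ h * t)%N].
Proof.
move=> AB hi iA; have sz := copy_mem AB hi iA.
have := mem_nth 0%N sz; rewrite mem_filter mem_iota add0n => /andP[gB /= gi].
split => //; set q := (_ %/ h)%N.
set j := count (fun j => slot j \in A) (iota h (i - h)) in sz.
have qj : (q * (h - #|B|) <= j)%N.
  rewrite leqNgt; apply/negP => jq.
  have qi : (q * h <= i)%N by apply: leq_trans (leq_trunc_div _ _) (ltnW gi).
  have := mem_nth 0%N (s := [seq g <- iota 0 (q * h) | slot g \notin B]) (n := j).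
  rewrite size_filter count_notin mem_filter mem_iota add0n => /(_ jq) /andP[_ /=].
  have -> : nth 0%N [seq g <- iota 0 (q * h) | slot g \notin B] j = copy A B i.
    rewrite /copy -/j -[in RHS](subnKC qi) iotaD filter_cat nth_cat size_filter.
    by rewrite count_notin jq.
  by rewrite ltnNge leq_trunc_div.
have jp := rank_lt hi iA; rewrite -/j in jp.
have := card_slot_le B; have A0 : (0 < #|A|)%N by apply/card_gt0P; exists (slot i).
set p := (i %/ h)%N in jp *; move=> Bh.
have lt1 : (q * (h - #|B|) < p * #|A|)%N by apply: leq_ltn_trans jp.
rewrite -(ltn_pmul2r A0); apply: leq_ltn_trans (_ : (q * (h - #|B|) * t < _)%N).
  by rewrite -!mulnA leq_mul2l; apply/orP; right; move: AB th; nia.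
by rewrite [ltnRHS]mulnAC ltn_pmul2r //; lia.
Qed.

Lemma copy_inj A B i i' : (#|A| + #|B| = t)%N -> (h <= i)%N -> slot i \in A ->
  (h <= i')%N -> slot i' \in A -> copy A B i = copy A B i' -> i = i'.
Proof.
move=> AB; wlog ii' : i i' / (i <= i')%N.
  by move=> H hi iA hi' i'A E; have [ii'|/ltnW ii'] := leqP i i'; [|symmetry]; exact: H.
move=> hi iA hi' i'A; have sz := copy_mem AB hi iA; have sz' := copy_mem AB hi' i'A.
move: ii'; rewrite leq_eqVlt => /predU1P[//|ii'].
have pre : [seq g <- iota 0 i' | slot g \notin B] =
    [seq g <- iota 0 i | slot g \notin B] ++ [seq g <- iota i (i' - i) | slot g \notin B].
  by rewrite -filter_cat -iotaD subnKC // ltnW.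
have -> : copy A B i = nth 0%N [seq g <- iota 0 i' | slot g \notin B]
    (count (fun j => slot j \in A) (iota h (i - h))).
  by rewrite pre nth_cat sz.
move/eqP; rewrite nth_uniq ?filter_uniq ?iota_uniq //; last first.
  by rewrite pre size_cat (leq_trans sz) ?leq_addr.
have -> : (i' - h = (i - h) + (i' - i))%N by lia.
rewrite iotaD count_cat subnKC // -[X in X == _]addn0 eqn_add2l.
have -> : (i' - i = 1 + (i' - i).-1)%N by lia.
by rewrite iotaD count_cat /= iA.
Qed.

Lemma ffun_agree_card (I : finType) (D : {set I}) (S : {set {ffun I -> bool}}) :
  (forall f g, f \in S -> g \in S -> {in D, f =1 g}) -> (#|S| <= 2 ^ (#|I| - #|D|))%N.
Proof.
move=> SD; have -> : (#|I| - #|D|)%N = #|~: D| by rewrite -(cardsC D) addKn.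
rewrite -card_powerset -(card_in_imset (f := fun f : {ffun I -> bool} => [set i in ~: D | f i]) (D := mem S)).
  apply/subset_leq_card/subsetP => Z /imsetP[f _ ->].
  by rewrite powersetE; apply/subsetP => i; rewrite inE => /andP[].
move=> f g fS gS /setP E; apply/ffunP => i; have [iD|iD] := boolP (i \in D).
  exact: SD.
by have := E i; rewrite !inE iD.
Qed.

(** For a vertex with bits [l], these are the prefixes that a neighbour can have if their edge uses
    the slots [A] here and [B] there: a slot of [A] constrains the bit of the neighbour that is
    copied, a slot of [B] the bit that is a copy. *)
Definition compatible k A B (l : nat -> bool) : {set {ffun 'I_k -> bool}} :=
  [set f : {ffun 'I_k -> bool} | [forall i : 'I_k, (h <= i)%N ==>
     ((slot i \in A) ==> [forall g : 'I_k, (val g == copy A B i) ==> (f g == l i)]) &&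
     ((slot i \in B) ==> (f i == l (copy B A i)))]].

(** The constrained positions are distinct: [copy] is injective, and a bit copied through [A] never
    sits in a slot of [B]. This gives $t$ of them for every full period except the first. *)
Lemma compatible_card k A B l : (#|A| + #|B| = t)%N ->
  (#|compatible k A B l| <= 2 ^ (k - t * (k %/ h).-1))%N.
Proof.
move=> AB; have BA : (#|B| + #|A| = t)%N by rewrite addnC.
pose DA := [set i : 'I_k | (h <= i)%N & slot i \in A].
pose DB := [set i : 'I_k | (h <= i)%N & slot i \in B].
pose cA (i : 'I_k) : 'I_k := insubd i (copy A B i).
have cAE i : i \in DA -> val (cA i) = copy A B i.
  rewrite inE => /andP[hi iA]; rewrite /cA val_insubd.
  by have [gi _ _] := copyP AB hi iA; rewrite (ltn_trans gi (ltn_ord i)).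
have cardD (C : {set 'I_h}) : (#|C| * (k %/ h).-1 <= #|[set i : 'I_k | (h <= i)%N & slot i \in C]|)%N.
  have [kh|hk] := ltnP k h; first by rewrite divn_small // muln0.
  have -> : #|[set i : 'I_k | (h <= i)%N & slot i \in C]| =
      count (fun i => (h <= i)%N && (slot i \in C)) (iota 0 k).
    by rewrite -val_enum_ord count_map cardsE cardE size_filter -enumT.
  have := count_slots C 1 (k %/ h).-1; rewrite mul1n => E; rewrite mulnC -E.
  have k1 : (0 < k %/ h)%N by rewrite divn_gt0.
  have le : (h + (k %/ h).-1 * h <= k)%N by rewrite -mulSn prednK // leq_trunc_div.
  rewrite -[k in iota 0 k](subnKC le) -addnA iotaD count_cat add0n iotaD count_cat.
  apply: leq_trans (leq_addl _ _); apply: leq_trans (leq_addr _ _).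
  by apply/eq_leq/eq_in_count => i; rewrite mem_iota => /andP[-> _].
pose D := (cA @: DA) :|: DB.
have dj : [disjoint cA @: DA & DB].
  rewrite -setI_eq0; apply/eqP/setP => j; rewrite in_setI in_set0; apply/negP => /andP[/imsetP[i iD jE]].
  rewrite inE jE => /andP[_]; move: (iD); rewrite inE => /andP[hi iA].
  have -> : slot (cA i) = slot (copy A B i) by rewrite (cAE _ iD).
  by have [_ /negP] := copyP AB hi iA.
have Dk : (t * (k %/ h).-1 <= #|D|)%N.
  rewrite cardsU (_ : _ :&: _ = set0) ?cards0 ?subn0; last by apply/eqP; rewrite setI_eq0.
  rewrite card_in_imset => [|i j iD jD /(congr1 val)]; last first.
    rewrite !cAE // => E; apply: val_inj; move: iD jD; rewrite !inE => /andP[? ?] /andP[? ?].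
    exact: copy_inj AB _ _ _ _ E.
  by rewrite -AB mulnDl leq_add // cardD.
apply: leq_trans (ffun_agree_card (D := D) _) _; last first.
  by rewrite card_ord leq_exp2l // leq_sub2l.
move=> f g; rewrite !inE => /forallP Hf /forallP Hg j.
rewrite inE => /orP[/imsetP[i iD ->]|].
  move: (iD); rewrite inE => /andP[hi iA].
  have := Hf i; have := Hg i; rewrite hi iA /= => /andP[/forallP/(_ (cA i)) + _] /andP[/forallP/(_ (cA i)) + _].
  by rewrite (cAE _ iD) eqxx /= => /eqP -> /eqP ->.
rewrite inE => /andP[hj jB]; have := Hf j; have := Hg j.
by rewrite hj jB /= => /andP[_ /eqP ->] /andP[_ /eqP ->].
Qed.

Definition patterns : {set {set 'I_h} * {set 'I_h}} := 
  [set P : {set 'I_h} * {set 'I_h} | (#|P.1| + #|P.2| == t)%N].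

(** A pattern is a [t]-subset of two disjoint copies of the set of slots. *)
Lemma patterns_card : (#|patterns| <= (2 * h) ^ t)%N.
Proof.
pose U (P : {set 'I_h} * {set 'I_h}) : {set 'I_h + 'I_h} :=
  (inl @: P.1) :|: (inr @: P.2).
have Uinj : injective U.
  move=> [A B] [A' B'] /setP E; congr (_, _); apply/setP => i.
    have := E (inl i); rewrite !inE !mem_imset; try by move=> ? ? [].
    have no C : (inl i \in [set inr x | x in C : {set 'I_h}]) = false.
      by apply/negP => /imsetP[].
    by rewrite !no !orbF.
  have := E (inr i); rewrite !inE.
  have no C : (inr i \in [set inl x | x in C : {set 'I_h}]) = false.
    by apply/negP => /imsetP[].
  by rewrite !no !mem_imset //; move=> ? ? [].
rewrite -(card_imset _ Uinj); apply: (@leq_trans 'C(2 * h, t)).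
  rewrite -[(2 * h)%N](_ : #|{: 'I_h + 'I_h}| = _); last by rewrite card_sum card_ord mul2n addnn.
  rewrite -card_draws; apply/subset_leq_card/subsetP => Z /imsetP[[A B]]; rewrite !inE /= => /eqP AB ->.
  rewrite cardsU !card_imset; [|by move=> ? ? []|by move=> ? ? []].
  rewrite (_ : _ :&: _ = set0) ?cards0 ?subn0 ?AB //.
  apply/setP => z; rewrite !inE; apply/negP => /andP[/imsetP[? _ ->]].
  by case/imsetP.
apply: leq_trans (_ : (2 * h) ^_ t <= _)%N; first by rewrite -bin_ffact leq_pmulr ?fact_gt0.
have le_exp x k : (x ^_ k <= x ^ k)%N.
  by elim: k => // k IH; rewrite ffactnSr expnSr leq_mul ?leq_subr.
exact: le_exp.
Qed.

End Slots.

(** * Non-backtracking walks *)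

Section Walks.
Variables (T : finType) (G : sgraph T).
Implicit Types (x y u v : T) (P Q : nat -> T) (W : {set T}).

(** A walk is a function on all of [nat] of which only the values up to [a] matter; hence
    [same_walk] instead of equality. *)
Definition nbwalk P a :=
  (forall i, (i < a)%N -> adj G (P i) (P i.+1)) /\
  (forall i, (i.+2 <= a)%N -> P i != P i.+2).

Definition same_walk P a Q b := a = b /\ forall i, (i <= a)%N -> P i = Q i.

Definition visited P a : {set T} := [set P (val i) | i : 'I_a.+1].

Lemma visitedP P a v : reflect (exists2 i, (i <= a)%N & P i = v) (v \in visited P a).
Proof.
apply: (iffP imsetP) => [[i _ ->]|[i ia <-]]; first by exists (val i); rewrite // -ltnS; exact: ltn_ord.
by exists (Ordinal (ia : (i < a.+1)%N)).
Qed.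

Lemma visited_mem P a i : (i <= a)%N -> P i \in visited P a.
Proof. by move=> ia; apply/visitedP; exists i. Qed.

Lemma nbwalk_shift P a : nbwalk P a.+1 -> nbwalk (fun i => P i.+1) a.
Proof. by case=> P1 P2; split => i ia; [exact: P1|exact: P2]. Qed.

Lemma nbwalk_prefix P a : nbwalk P a.+1 -> nbwalk P a.
Proof. by case=> P1 P2; split => i ia; [apply: P1; exact: leqW|apply: P2; exact: leqW]. Qed.

(** That is, the subgraph induced on [W] has minimum degree at least two. *)
Definition core W := forall v, v \in W -> exists y z,
  [/\ y != z, y \in W /\ z \in W & adj G v y /\ adj G v z].

(** Cut off common first and last steps as long as possible. What remains is a pair of walks that
    leave their start by different edges and enter their end by different edges, or one closed walk
    whose first and last edges differ. As nothing backtracks, every visited vertex then has two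
    visited neighbours. *)
Lemma core_of_walks P a Q b : nbwalk P a -> nbwalk Q b ->
  P 0%N = Q 0%N -> P a = Q b -> ~ same_walk P a Q b ->
  exists W, [/\ W != set0, W \subset visited P a :|: visited Q b & core W].
Proof.
have [n] := ubnP (a + b); elim: n P a Q b => // n IH P a Q b abn.
wlog ab : P a Q b abn / (a <= b)%N.
  move=> H wP wQ PQ0 PQ nPQ; have [ab|/ltnW ba] := leqP a b; first exact: H.
  have [||W [W0 WS cW]] := H Q b P a _ ba wQ wP (esym PQ0) (esym PQ).
  - by rewrite addnC.
  - by case=> ba' QP; apply: nPQ; split => // i ia; rewrite QP // ba'.
  by exists W; split => //; rewrite setUC.
case: a ab abn => [|a] ab abn wP wQ PQ0 PQ nPQ.
  case: b ab abn wQ PQ nPQ => [|b] _ bn wQ PQ nPQ.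
    by case: nPQ; split => // i; rewrite leqn0 => /eqP ->.
  have [Qa Qb] := wQ.
  case: b bn wQ PQ nPQ Qa Qb => [|b] bn wQ PQ nPQ Qa Qb.
    by have := Qa 0%N isT; rewrite -PQ PQ0 => /adj_neq; rewrite eqxx.
  case: b bn wQ PQ nPQ Qa Qb => [|b] bn wQ PQ nPQ Qa Qb.
    by have := Qb 0%N isT; rewrite -PQ PQ0 eqxx.
  (* [P] has length zero, so [Q] is closed. If its second and its last but one vertices agree, both
     end edges are the same, and cutting them shortens the walk by two. *)
  have [E|NE] := eqVneq (Q 1%N) (Q b.+2).
    have [||||W [W0 WS cW]] := IH (fun=> Q 1%N) 0%N (fun i => Q i.+1) b.+1 _ _ _ erefl E.
    - by move: bn; lia.
    - by split=> i.
    - exact/nbwalk_prefix/nbwalk_shift.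
    - by case=> /eqP.
    exists W; split => //; apply: subset_trans WS _; apply/subsetP => v; rewrite !inE.
    case/orP => /visitedP[i ib <-]; apply/orP; right; last by apply: visited_mem; lia.
    exact: visited_mem.
  exists (visited Q b.+3); split; [|exact: subsetUr|].
    by apply/set0Pn; exists (Q 0%N); exact: visited_mem.
  move=> v /visitedP[i ib <-].
  case: i ib => [|i] ib.
    exists (Q 1%N), (Q b.+2); split => //; first by split; apply: visited_mem.
    by split; [exact: Qa|rewrite -PQ0 PQ adjC; exact: Qa].
  move: ib; rewrite leq_eqVlt => /predU1P[->|ib].
    exists (Q 1%N), (Q b.+2); split => //; first by split; apply: visited_mem.
    by split; [rewrite -PQ PQ0; exact: Qa|rewrite adjC; exact: Qa].
  exists (Q i), (Q i.+2); split; first exact: Qb.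
    by split; apply: visited_mem => //; lia.
  by split; [rewrite adjC; apply: Qa; lia|exact: Qa].
case: b ab abn wQ PQ nPQ => // b ab abn wQ PQ nPQ.
(* A common first step is cut off here, a common last step below. *)
have [E|NE] := eqVneq (P 1%N) (Q 1%N).
  have [||||W [W0 WS cW]] := IH (fun i => P i.+1) a (fun i => Q i.+1) b _ _ _ E PQ.
  - by move: abn; rewrite addSn addnS; lia.
  - exact: nbwalk_shift.
  - exact: nbwalk_shift.
  - case=> ab' PQi; apply: nPQ; split; first by rewrite ab'.
    by case=> // i ia; apply: PQi.
  exists W; split => //; apply: subset_trans WS _; apply/subsetP => v; rewrite !inE.
  by case/orP => /visitedP[i ib <-]; apply/orP; [left|right]; apply: visited_mem.
have [E|NE'] := eqVneq (P a) (Q b).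
  have [||||W [W0 WS cW]] := IH P a Q b _ _ _ PQ0 E.
  - by move: abn; rewrite addSn addnS; lia.
  - exact: nbwalk_prefix.
  - exact: nbwalk_prefix.
  - case=> ab' PQi; apply: nPQ; split; first by rewrite ab'.
    by move=> i; rewrite leq_eqVlt => /predU1P[-> //|]; [rewrite PQ ab'|exact: PQi].
  exists W; split => //; apply: subset_trans WS _; apply/subsetP => v; rewrite !inE.
  by case/orP => /visitedP[i ib <-]; apply/orP; [left|right]; apply/visited_mem/leqW.
have [Pa Pb] := wP; have [Qa Qb] := wQ.
exists (visited P a.+1 :|: visited Q b.+1); split => //.
  by apply/set0Pn; exists (P 0%N); rewrite inE visited_mem.
have PS i : (i <= a.+1)%N -> P i \in visited P a.+1 :|: visited Q b.+1.
  by move=> ia; rewrite inE visited_mem.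
have QS i : (i <= b.+1)%N -> Q i \in visited P a.+1 :|: visited Q b.+1.
  by move=> ia; rewrite inE visited_mem // orbT.
have c0 : exists y z, [/\ y != z, y \in visited P a.+1 :|: visited Q b.+1 /\
    z \in visited P a.+1 :|: visited Q b.+1 & adj G (P 0%N) y /\ adj G (P 0%N) z].
  exists (P 1%N), (Q 1%N); split => //; first by split; [exact: PS|exact: QS].
  by split; [exact: Pa|rewrite PQ0; exact: Qa].
have c1 : exists y z, [/\ y != z, y \in visited P a.+1 :|: visited Q b.+1 /\
    z \in visited P a.+1 :|: visited Q b.+1 & adj G (P a.+1) y /\ adj G (P a.+1) z].
  exists (P a), (Q b); split => //; first by split; [exact: PS|exact: QS].
  by split; rewrite adjC; [exact: Pa|rewrite PQ; exact: Qa].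
move=> v; rewrite inE => /orP[] /visitedP[i ia <-]; case: i ia => [|i] //.
- rewrite leq_eqVlt => /predU1P[-> //|ia].
  exists (P i), (P i.+2); split; first exact: Pb.
    by split; apply: PS => //; lia.
  by split; [rewrite adjC; apply: Pa; lia|exact: Pa].
- by rewrite -PQ0.
rewrite leq_eqVlt => /predU1P[->|ia]; first by rewrite -PQ.
exists (Q i), (Q i.+2); split; first exact: Qb.
  by split; apply: QS => //; lia.
by split; [rewrite adjC; apply: Qa; lia|exact: Qa].
Qed.

Lemma sum_degree_in W : (\sum_(v in W) #|nbh G v :&: W| = 2 * #|edges_in G W|)%N.
Proof.
have -> : (2 * #|edges_in G W| = \sum_(e in edges_in G W) #|e|)%N.
  rewrite mulnC -sum_nat_const; apply: eq_bigr => e; rewrite inE => /andP[eG _].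
  by have [x [y [-> /adj_neq xy]]] := edgeP eG; rewrite cards2 xy.
under [RHS]eq_bigr => e eW do rewrite -sum1_card.
rewrite (exchange_big_dep (mem W)) /=; last first.
  by move=> e v; rewrite inE => /andP[_ /subsetP]; apply.
apply: eq_bigr => v vW; rewrite sum1dep_card.
rewrite -(card_in_imset (f := fun y => [set v; y]) (D := mem (nbh G v :&: W))).
  apply: eq_card => e; rewrite !inE; apply/imsetP/andP.
    case=> y; rewrite !inE => /andP[vy yW] ->; split; last by rewrite !inE eqxx.
    by rewrite -/(adj G v y) vy /= subUset !sub1set vW yW.
  case=> /andP[/[dup] eG /edgeP[x [y [-> xy]]]]; rewrite subUset !sub1set !inE => /andP[xW yW].
  case/orP => /eqP ->; first by exists y; rewrite ?inE ?xy.
  by exists x; rewrite ?inE 1?adjC ?xy // setUC.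
move=> y z; rewrite !inE => /andP[/adj_neq yx _] /andP[/adj_neq zx _] /setP/(_ y).
by rewrite !inE eqxx orbT [y == v]eq_sym (negbTE yx) => /esym/eqP.
Qed.

Lemma core_dense W : core W -> (#|W| <= #|edges_in G W|)%N.
Proof.
move=> cW; rewrite -(leq_pmul2l (isT : 0 < 2)%N) -sum_degree_in mulnC -sum_nat_const.
apply: leq_sum => v /cW[y [z [yz [yW zW] [vy vz]]]].
by apply/card_gt1P; exists y, z; rewrite !inE vy vz.
Qed.

Fixpoint ball k x : {set T} :=
  if k is k'.+1 then \bigcup_(y in ball k' x) (y |: nbh G y) else [set x].

Lemma ball_card D k x : (forall y, degree G y <= D)%N -> (#|ball k x| <= D.+1 ^ k)%N.
Proof.
move=> GD; elim: k => [|k IH] /=; first by rewrite cards1.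
apply: leq_trans (_ : \sum_(y in ball k x) D.+1 <= _)%N; last first.
  by rewrite sum_nat_const expnSr leq_mul2r IH orbT.
elim/big_rec2: _ => [|y A n _ IHA]; first by rewrite cards0.
rewrite (leq_trans (leq_of_leqif (leq_card_setU _ _))) // leq_add // cardsU1.
by rewrite card_nbh (leq_trans _ (_ : 1 + D <= D.+1)%N) // leq_add // leq_b1.
Qed.

Lemma ball_step k x y z : y \in ball k x -> (z == y) || adj G y z -> z \in ball k.+1 x.
Proof. by move=> yx yz; apply/bigcupP; exists y => //; rewrite !inE. Qed.

Lemma ball_sub k l x : (k <= l)%N -> ball k x \subset ball l x.
Proof.
move/subnKC => <-; elim: (l - k)%N => [|j IH]; first by rewrite addn0.
by apply: subset_trans IH _; rewrite addnS; apply/subsetP => y yx; apply: ball_step yx _; rewrite eqxx.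
Qed.

Lemma ball_add k l x y z : y \in ball k x -> z \in ball l y -> z \in ball (k + l) x.
Proof.
move=> yx; elim: l z => [|l IH] z /=; first by rewrite inE addn0 => /eqP ->.
case/bigcupP => u uy; rewrite !inE => uz; rewrite addnS.
by apply: ball_step (IH _ uy) _.
Qed.

Lemma walk_ball P a : (forall i, (i < a)%N -> adj G (P i) (P i.+1)) ->
  P a \in ball a (P 0%N) /\ P 0%N \in ball a (P a).
Proof.
elim: a => [|a IH] Pa; first by rewrite !inE.
have [i|P1 P2] := IH; first by move=> ia; apply: Pa; exact: leqW.
split; first by apply: ball_step P1 _; rewrite Pa ?orbT.
rewrite -add1n; apply: ball_add P2; apply/bigcupP; exists (P a.+1); rewrite !inE //.
by rewrite adjC Pa ?orbT.
Qed.

Definition unique_walks L x := forall P a Q b, (a <= L)%N -> (b <= L)%N ->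
  nbwalk P a -> nbwalk Q b -> P 0%N = x -> Q 0%N = x -> P a = Q b -> same_walk P a Q b.

Definition dense_sets l : {set {set T}} :=
  [set W : {set T} | [&& W != set0, (#|W| <= l)%N & (#|W| <= #|edges_in G W|)%N]].

(** Two walks of length at most [L] visit at most [(2 * L).+2] vertices, so the dense set made by
    two different walks from [x] with the same end has this size and meets the ball around [x]. *)
Definition cyclic_part L : {set T} :=
  \bigcup_(W in dense_sets (2 * L).+2) \bigcup_(w in W) ball L w.

Lemma unique_walksP L x : x \notin cyclic_part L -> unique_walks L x.
Proof.
move=> xX P a Q b aL bL wP wQ P0 Q0 PQ.
have [//|nPQ] := pselect (same_walk P a Q b).
have [W [W0 WS cW]] := core_of_walks wP wQ (etrans P0 (esym Q0)) PQ nPQ.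
case/negP: xX; apply/bigcupP; exists W.
  rewrite inE W0 core_dense // andbT; apply: leq_trans (subset_leq_card WS) _.
  apply: leq_trans (leq_of_leqif (leq_card_setU _ _)) _.
  have vc R c : (#|visited R c| <= c.+1)%N.
    by rewrite (leq_trans (leq_imset_card _ _)) // cardT size_enum_ord.
  by have := vc P a; have := vc Q b; lia.
have [w wW] := set0Pn _ W0; apply/bigcupP; exists w => //.
have near R c : (c <= L)%N -> nbwalk R c -> R 0%N = x -> w \in visited R c -> x \in ball L w.
  move=> cL [wR _] R0 /visitedP[i ic <-].
  have [|_] := @walk_ball R i; first by move=> j ji; apply: wR; exact: leq_trans ic.
  rewrite R0; apply/subsetP/ball_sub; exact: leq_trans cL.
by have := subsetP WS _ wW; rewrite inE => /orP[]; [exact: near aL wP P0|exact: near bL wQ Q0].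
Qed.

Lemma cyclic_part_card D L : (forall y, degree G y <= D)%N ->
  (#|cyclic_part L| <= #|dense_sets (2 * L).+2| * ((2 * L).+2 * D.+1 ^ L))%N.
Proof.
move=> GD; rewrite /cyclic_part -sum_nat_const.
have U (I : finType) (P : pred I) (F : I -> {set T}) :
    (#|\bigcup_(i | P i) F i| <= \sum_(i | P i) #|F i|)%N.
  elim/big_rec2: _ => [|i n A _ IH]; first by rewrite cards0.
  by rewrite (leq_trans (leq_of_leqif (leq_card_setU _ _))) // leq_add2l.
apply: leq_trans (U _ _ _) _; apply: leq_sum => W; rewrite inE => /and3P[_ Wl _].
apply: leq_trans (U _ _ _) _; apply: leq_trans (_ : \sum_(w in W) D.+1 ^ L <= _)%N.
  by apply: leq_sum => w _; exact: ball_card.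
by rewrite sum_nat_const leq_mul2r Wl orbT.
Qed.

End Walks.

(** * Contracting along labels *)

Lemma card_bigcup_disjoint (I U : finType) (Y : {set I}) (F : I -> {set U}) :
  {in Y &, forall x y, x != y -> [disjoint F x & F y]} ->
  #|\bigcup_(x in Y) F x| = \sum_(x in Y) #|F x|.
Proof.
have [k] := ubnP #|Y|; elim: k Y => // k IH Y Yk Yd.
have [->|[x xY]] := set_0Vmem Y; first by rewrite !big_set0 cards0.
rewrite (big_setD1 x) //= [RHS](big_setD1 x) //= cardsU IH.
- rewrite (_ : _ :&: _ = set0) ?cards0 ?subn0 //; apply/eqP; rewrite setI_eq0 disjoint_sym.
  rewrite disjoint_sym; apply/bigcup_disjointP => y; rewrite !inE => /andP[yx yY].
  by apply: Yd; rewrite // eq_sym.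
- by move: Yk; rewrite (cardsD1 x) xY.
- by move=> u v; rewrite !inE => /andP[_ uY] /andP[_ vY]; exact: Yd.
Qed.

Section Labels.
Variables (T : finType) (G : sgraph T) (h t m L D : nat).
Variables (h_gt0 : (0 < h)%N) (th : (t <= h)%N) (sg : T -> 'I_h -> T).
Hypothesis sgA : forall x i, sg x i = x \/ adj G x (sg x i).
Hypothesis sgC : forall x y, adj G x y ->
  (#|[set i | sg x i == y]| + #|[set i | sg y i == x]| = t)%N.
Hypothesis mL : (m * t ^ L < h ^ L)%N.
Hypothesis degD : forall x, (degree G x <= D)%N.

Local Notation slot := (slot h_gt0).
Local Notation copy := (copy h_gt0).

Definition out x y : {set 'I_h} := [set i | sg x i == y].
Definition hd x i := sg x (slot i).
Definition fresh (s : T * nat) := (s.2 < h)%N || (hd s.1 s.2 == s.1).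
(** The position from which a bit is copied. Fresh positions are fixed points, so that [L]
    iterations reach the origin of every bit, whatever the length of its chain. *)
Definition nxt (s : T * nat) := if fresh s then s else
  (hd s.1 s.2, copy (out s.1 (hd s.1 s.2)) (out (hd s.1 s.2) s.1) s.2).

Lemma nfreshP x i y : hd x i = y -> ~~ fresh (x, i) ->
  [/\ (h <= i)%N, adj G x y, slot i \in out x y & nxt (x, i) = (y, copy (out x y) (out y x) i)].
Proof.
move=> <- nf; have := nf; rewrite /fresh negb_or -leqNgt => /andP[hi /= /eqP nx].
split => //; first by case: (sgA x (slot i)).
  by rewrite inE.
by rewrite /nxt (negbTE nf).
Qed.

Lemma nxt_fresh s : fresh s -> nxt s = s.
Proof. by rewrite /nxt => ->. Qed.

(** The third property comes from the slots skipped by [copy] and makes the walk of a bit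
    non-backtracking; the fourth bounds the length of this walk. *)
Lemma nxt_spec s : ~~ fresh s ->
  [/\ adj G s.1 (nxt s).1, ((nxt s).2 < s.2)%N, hd (nxt s).1 (nxt s).2 != s.1 &
      ((nxt s).2 %/ h * h < s.2 %/ h * t)%N].
Proof.
case: s => x i nf; have [hi xy ix ->] := nfreshP erefl nf.
have [c1 c2 c3] := copyP th (sgC xy) hi ix; split => //.
by move: c2; rewrite inE.
Qed.

Lemma iter_fresh k l s : (k <= l)%N -> fresh (iter k nxt s) -> iter l nxt s = iter k nxt s.
Proof.
move=> /subnKC <- fk; elim: (l - k)%N => [|j IH]; first by rewrite addn0.
by rewrite addnS iterS IH nxt_fresh.
Qed.

Lemma iter_snd k s : ((iter k nxt s).2 <= s.2)%N.
Proof.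
elim: k => // k IH; rewrite iterS; have [f|nf] := boolP (fresh (iter k nxt s)).
  by rewrite nxt_fresh.
by have [_ /ltnW lt _ _] := nxt_spec nf; exact: leq_trans IH.
Qed.

Lemma iter_period k s : ~~ fresh (iter k nxt s) ->
  ((iter k nxt s).2 %/ h * h ^ k <= s.2 %/ h * t ^ k)%N.
Proof.
elim: k => [|k IH] nf; first by rewrite !muln1.
have nf' : ~~ fresh (iter k nxt s).
  by apply: contra nf => f; rewrite iterS nxt_fresh.
have [_ _ _ lt] := nxt_spec nf'; have := IH nf'; rewrite iterS !expnS => IHk.
rewrite mulnA (leq_trans (_ : _ <= (iter k nxt s).2 %/ h * t * h ^ k)%N) //.
  by rewrite leq_mul2r (ltnW lt) orbT.
by rewrite mulnAC (leq_trans (leq_mul IHk (leqnn t))) // -mulnA leq_mul2l [(t * _)%N]mulnC leqnn orbT.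
Qed.

(** Each copy multiplies the number of the period by at most $t/h$. After [L] copies it would be
    below $m(t/h)^L < 1$, and the bits of period zero are fresh. *)
Lemma fresh_depth s : (s.2 < m)%N -> fresh (iter L nxt s).
Proof.
move=> sm; apply/negPn/negP => nf; have := iter_period nf.
have i1 : (1 <= (iter L nxt s).2 %/ h)%N.
  by move: nf; rewrite /fresh negb_or -leqNgt => /andP[hi _]; rewrite divn_gt0.
move=> le; have : (h ^ L <= m * t ^ L)%N.
  rewrite (leq_trans (_ : _ <= (iter L nxt s).2 %/ h * h ^ L)%N) //; first by rewrite leq_pmull.
  rewrite (leq_trans le) // leq_mul2r (leq_trans (leq_div _ _)) ?orbT //; exact: ltnW.
by rewrite leqNgt mL.
Qed.

Definition trace s := iter L nxt s.

Lemma trace_walk s : (s.2 < m)%N -> exists a,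
  [/\ (a <= L)%N, nbwalk G (fun k => (iter k nxt s).1) a,
      forall k, (k < a)%N -> ~~ fresh (iter k nxt s) & trace s = iter a nxt s].
Proof.
move=> sm; have exf : exists k, fresh (iter k nxt s) by exists L; exact: fresh_depth.
have [a fa amin] := ex_minnP exf; have aL : (a <= L)%N by apply/amin/fresh_depth.
have nf k : (k < a)%N -> ~~ fresh (iter k nxt s).
  by move=> ka; apply: contraTN ka => /amin; rewrite -leqNgt.
exists a; split => //; last exact: iter_fresh aL fa.
split=> k ka; first by have [] := nxt_spec (nf k ka).
have [_ _ nx _] := nxt_spec (nf k (ltnW ka)).
have := nf k.+1 ka; case E : (iter k.+1 nxt s) nx => [y g] nx nfy.
rewrite -iterS in nx; have [_ _ _] := nfreshP erefl nfy.
rewrite [iter k.+2 _ _]iterS E => -> /=.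
by move: nx; rewrite E eq_sym.
Qed.

Lemma nxt_inj x i j : ~~ fresh (x, i) -> ~~ fresh (x, j) -> nxt (x, i) = nxt (x, j) -> i = j.
Proof.
move=> nfi nfj; have [hi xy ix ->] := nfreshP erefl nfi.
have [hj _ jx ->] := nfreshP erefl nfj => -[yE] E; rewrite -yE in jx E.
exact: copy_inj (sgC xy) hi ix hj jx E.
Qed.

(** Equal origins lie at the same vertex, so the two walks from [x] coincide. Copying along a given
    edge is injective, and this takes the equality back to the start. *)
Lemma trace_inj x i j : unique_walks G L x -> (i < m)%N -> (j < m)%N ->
  trace (x, i) = trace (x, j) -> i = j.
Proof.
move=> ux im jm; have [a [aL wa nfa ->]] := @trace_walk (x, i) im.
have [b [bL wb nfb ->]] := @trace_walk (x, j) jm => E.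
have [ab same] := ux _ _ _ _ aL bL wa wb erefl erefl (congr1 fst E); rewrite -ab {b ab bL wb} in nfb E.
have : forall k, (k <= a)%N -> iter (a - k) nxt (x, i) = iter (a - k) nxt (x, j).
  elim=> [|k IH] ka; first by rewrite subn0.
  have ak : (a - k = (a - k.+1).+1)%N by lia.
  have lt : (a - k.+1 < a)%N by lia.
  have := IH (ltnW ka); rewrite ak !iterS => {}E.
  have := same (a - k.+1)%N (ltnW lt); have := nfa _ lt; have := nfb _ lt; move: E.
  case: (iter _ _ (x, i)) => [u g]; case: (iter _ _ (x, j)) => [v g'] /= E nv nu uv.
  by rewrite uv in nu E *; rewrite (nxt_inj nu nv E).
by move/(_ a (leqnn a)); rewrite subnn => -[].
Qed.

Definition label (b : T * nat -> bool) x i := b (trace (x, i)).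

Lemma label_nxt b x i y : hd x i = y -> ~~ fresh (x, i) -> (i < m)%N ->
  label b x i = label b y (copy (out x y) (out y x) i).
Proof.
move=> xy nf im; have [_ _ _ E] := nfreshP xy nf; rewrite /label -E; congr b.
by rewrite /trace -iterSr iterS nxt_fresh //; exact: fresh_depth.
Qed.

Lemma label_compatible b x y k : adj G x y -> (k <= m)%N ->
  [ffun i : 'I_k => label b y i] \in compatible h_gt0 k (out x y) (out y x) (label b x).
Proof.
have nf u v i : adj G u v -> (h <= i)%N -> slot i \in out u v -> hd u i = v /\ ~~ fresh (u, i).
  move=> uv hi; rewrite inE => /eqP E; split => //.
  by rewrite /fresh negb_or -leqNgt hi /= /hd E eq_sym (adj_neq uv).
move=> xy km; rewrite inE; apply/forallP => i; have im := leq_trans (ltn_ord i) km.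
apply/implyP => hi; apply/andP; split; apply/implyP => iA.
  have [E F] := nf _ _ _ xy hi iA; apply/forallP => g; apply/implyP => /eqP gE.
  by rewrite ffunE gE -(label_nxt b E F im).
have yx : adj G y x by rewrite adjC.
by have [E F] := nf _ _ _ yx hi iA; rewrite ffunE (label_nxt b E F im).
Qed.

(** The positions of the random bits from which the label of [x] is read. *)
Definition traces x : {set T * 'I_m} :=
  [set z | [exists i : 'I_m, (z.1, val z.2) == trace (x, val i)]].

Lemma traces_card x : unique_walks G L x -> #|traces x| = m.
Proof.
move=> ux; case: (pickP 'I_m) => [i0 _|I0]; last first.
  rewrite (_ : traces x = set0); last by apply/setP => -[z g]; have := I0 g.
  by have := eq_card0 I0; rewrite card_ord cards0.
pose c (i : 'I_m) : T * 'I_m := ((trace (x, val i)).1, insubd i0 (trace (x, val i)).2).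
have cE i : (val (c i).2) = (trace (x, val i)).2.
  by rewrite /c val_insubd (leq_ltn_trans (iter_snd L (x, val i)) (ltn_ord i)).
rewrite -[RHS]card_ord -(card_imset (f := c)) => [|i j cij].
  apply: eq_card => -[z g]; rewrite inE; apply/existsP/imsetP => [[i /eqP /= E]|[i _ E]]; exists i => //.
    by congr (_, _); [rewrite -E|apply: val_inj; rewrite cE -E].
  by rewrite /= [trace _]surjective_pairing -cE -E; have := congr1 fst E => /= ->.
apply: val_inj; apply: (trace_inj ux (ltn_ord i) (ltn_ord j)).
by rewrite [LHS]surjective_pairing [RHS]surjective_pairing -!cE cij; have := congr1 fst cij => /= ->.
Qed.

Lemma traces_ball x y : ~~ [disjoint traces x & traces y] -> y \in ball G (L + L) x.
Proof.
case/pred0Pn => -[z g] /andP[]; rewrite !inE => /existsP[i /eqP Ei] /existsP[j /eqP Ej].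
have [a [aL [wa _] _ Ea]] := @trace_walk (x, val i) (ltn_ord i).
have [b [bL [wb _] _ Eb]] := @trace_walk (y, val j) (ltn_ord j).
have [za _] := walk_ball wa; have [_ yb] := walk_ball wb.
rewrite -Ea -Ei /= in za; rewrite -Eb -Ej /= in yb.
apply: ball_add (subsetP (ball_sub _ _ aL) _ za) (subsetP (ball_sub _ _ bL) _ yb).
Qed.

(** Greedy choice: vertices whose traces meet are at distance at most $2L$, so a chosen vertex
    excludes no more than a ball. *)
Lemma separated_subset s (C : {set T}) : (s * D.+1 ^ (L + L) <= #|C|)%N ->
  exists Y : {set T}, [/\ Y \subset C, #|Y| = s &
    {in Y &, forall x y, x != y -> [disjoint traces x & traces y]}].
Proof.
elim: s C => [|s IH] C sC.
  by exists set0; rewrite sub0set cards0; split => // x y; rewrite inE.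
have G0 : (0 < D.+1 ^ (L + L))%N by rewrite expn_gt0.
have /card_gt0P[y yC] : (0 < #|C|)%N by apply: leq_trans sC; rewrite mulSn addn_gt0 G0.
have [|Y [YC Ys Yd]] := IH (C :\: ball G (L + L) y).
  have := ball_card (L + L) y degD; have := cardsID (ball G (L + L) y) C.
  have := subset_leq_card (subsetIr C (ball G (L + L) y)).
  by move: sC; rewrite mulSn; lia.
have yY : y \notin Y.
  apply/negP => /(subsetP YC); rewrite inE => /andP[/negP[]].
  by apply: (subsetP (@ball_sub _ G 0 _ y (leq0n _))); rewrite inE.
have dyY z : z \in Y -> [disjoint traces y & traces z].
  move=> /(subsetP YC); rewrite inE => /andP[zb _].
  by apply: contraNT zb; exact: traces_ball.
exists (y |: Y); split; last first.
- move=> u v /setU1P[->|uY] /setU1P[->|vY]; rewrite ?eqxx // => uv.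
  + exact: dyY.
  + by rewrite disjoint_sym dyY.
  + exact: Yd.
- by rewrite cardsU1 yY Ys.
- by rewrite subUset sub1set yC (subset_trans YC) // subsetDl.
Qed.

(** Random tables live on the finite set of positions below [m]. The default [false] is never read
    by labels of length [m], because copying only lowers positions. *)
Definition bits (b : {ffun T * 'I_m -> bool}) (s : T * nat) : bool :=
  if insub s.2 is Some g then b (s.1, g) else false.

Definition full_label b x : {ffun 'I_m -> bool} := [ffun i => label (bits b) x (val i)].

Variable X : {set T}.
Hypothesis uX : forall x, x \notin X -> unique_walks G L x.

(* First moment over uniformly random bits: no [s] vertices with disjoint     *)
(* traces share a label.                                                      *)
Lemma balanced_labels s : (2 ^ m * #|T| ^ s < s`! * 2 ^ (m * s))%N ->
  exists b, forall l, (#|[set x | (x \notin X) && (full_label b x == l)]| <= s * D.+1 ^ (L + L))%N.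
Proof.
move=> sm; pose sep : {set {set T}} := [set Y : {set T} | [&& #|Y| == s, [disjoint Y & X] &
  [forall x in Y, forall y in Y, (x != y) ==> [disjoint traces x & traces y]]]].
pose S (Yl : {set T} * {ffun 'I_m -> bool}) := [set b | [forall x in Yl.1, full_label b x == Yl.2]].
pose N := #|{: T * 'I_m}|.
(* A common label on [Y] prescribes the table on all traces of [Y], and these are $ms$ different
   positions. *)
have SN Yl : Yl.1 \in sep -> (#|S Yl| * 2 ^ (m * s) <= 2 ^ N)%N.
  case: Yl => Y l /=; rewrite inE => /and3P[/eqP Ys YX /forallP Yd].
  have Ydis : {in Y &, forall x y, x != y -> [disjoint traces x & traces y]}.
    by move=> x y xY yY xy; have /implyP/(_ xY)/forallP/(_ y)/implyP/(_ yY)/implyP := Yd x; exact.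
  pose Z := \bigcup_(x in Y) traces x.
  have Zc : #|Z| = (m * s)%N.
    rewrite card_bigcup_disjoint // -Ys mulnC -sum_nat_const; apply: eq_bigr => x xY.
    by apply: traces_card; apply: uX; rewrite (disjointFr YX xY).
  have ZN : (m * s <= N)%N by rewrite -Zc max_card.
  have := @ffun_agree_card _ Z (S (Y, l)); rewrite Zc => SZ.
  rewrite -(leq_pmul2r (expn_gt0 2 (m * s))) in SZ; rewrite -[leqRHS](_ : 2 ^ (N - m * s) * 2 ^ (m * s) = _)%N; last first.
    by rewrite -expnD subnK.
  apply: SZ => f g; rewrite !inE => /forallP Sf /forallP Sg z /bigcupP[x xY].
  rewrite inE => /existsP[i /eqP zx].
  have := Sf x; have := Sg x; rewrite xY /= => /eqP <- /eqP /ffunP/(_ i).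
  by rewrite !ffunE /label -zx /bits /= valK -surjective_pairing.
have [/existsP[b /forallP Hb]|/existsPn bad] := boolP [exists b, [forall Yl : {set T} * {ffun 'I_m -> bool}, (Yl.1 \in sep) ==> (b \notin S Yl)]].
  exists b => l; rewrite leqNgt; apply/negP => /ltnW /separated_subset[Y [YC Ys Yd]].
  have := Hb (Y, l); rewrite !inE /= Ys eqxx /=.
  have -> /= : [disjoint Y & X].
    by apply/pred0P => x; apply/negbTE/andP => -[/= /(subsetP YC)]; rewrite inE => /andP[/negP].
  have -> /= : [forall x in Y, forall y in Y, (x != y) ==> [disjoint traces x & traces y]].
    apply/forallP => x; apply/implyP => xY; apply/forallP => y; apply/implyP => yY.
    by apply/implyP; exact: Yd.
  by case/negP; apply/forallP => x; apply/implyP => /(subsetP YC); rewrite inE => /andP[].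
have cover : (2 ^ N <= \sum_(Yl in finset.setX sep [set: {ffun 'I_m -> bool}]) #|S Yl|)%N.
  have -> : (2 ^ N = #|{: {ffun T * 'I_m -> bool}}|)%N by rewrite card_ffun card_bool.
  rewrite -cardsT; apply: leq_trans (_ : #|\bigcup_(Yl in finset.setX sep [set: {ffun 'I_m -> bool}]) S Yl| <= _)%N.
    apply/subset_leq_card/subsetP => b _.
    have := bad b; rewrite negb_forall => /existsP[Yl]; rewrite negb_imply negbK => /andP[Ysep bS].
    by apply/bigcupP; exists Yl => //; rewrite inE Ysep inE.
  elim/big_rec2: _ => [|i n A _ IH]; first by rewrite cards0.
  by rewrite (leq_trans (leq_of_leqif (leq_card_setU _ _))) // leq_add2l.
have cnt : (2 ^ N * 2 ^ (m * s) <= #|sep| * 2 ^ m * 2 ^ N)%N.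
  apply: leq_trans (leq_mul cover (leqnn _)) _; rewrite big_distrl /=.
  apply: leq_trans (_ : \sum_(Yl in finset.setX sep [set: {ffun 'I_m -> bool}]) 2 ^ N <= _)%N.
    by apply: leq_sum => Yl; rewrite inE => /andP[Ysep _]; exact: SN.
  by rewrite sum_nat_const cardsX cardsT card_ffun card_bool card_ord.
have sepc : (#|sep| * s`! <= #|T| ^ s)%N.
  apply: leq_trans (_ : 'C(#|T|, s) * s`! <= _)%N.
    rewrite leq_mul2r -card_draws; apply/orP; right; apply/subset_leq_card/subsetP => Y.
    by rewrite !inE => /and3P[].
  rewrite bin_ffact; elim: (s) => // k IH; rewrite ffactnSr expnSr leq_mul ?leq_subr //.
have {cnt} cnt : (2 ^ (m * s) <= #|sep| * 2 ^ m)%N.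
  by rewrite -(leq_pmul2l (expn_gt0 2 N)) mulnC [leqRHS]mulnC mulnC.
suff : (s`! * 2 ^ (m * s) <= 2 ^ m * #|T| ^ s)%N by rewrite leqNgt sm.
rewrite (leq_trans (leq_mul (leqnn _) cnt)) // mulnA mulnC leq_mul2l [(s`! * _)%N]mulnC.
by rewrite sepc orbT.
Qed.

Lemma card_preim_le r u : (#|qnbh G r u| <= #|[set a | r a == u]| * D)%N.
Proof.
apply: leq_trans (_ : #|r @: \bigcup_(a in [set a | r a == u]) nbh G a| <= _)%N.
  apply/subset_leq_card/subsetP => v; rewrite inE => /andP[_ /existsP[a /existsP[b /and3P[au /eqP <- ab]]]].
  by apply: imset_f; apply/bigcupP; exists a; rewrite inE.
apply: leq_trans (leq_imset_card _ _) _; rewrite -sum_nat_const.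
apply: leq_trans (_ : \sum_(a in [set a | r a == u]) #|nbh G a| <= _)%N.
  elim/big_rec2: _ => [|i n A _ IH]; first by rewrite cards0.
  by rewrite (leq_trans (leq_of_leqif (leq_card_setU _ _))) // leq_add2l.
by apply: leq_sum => a _; rewrite card_nbh.
Qed.

(** Outside [X] a key determines the class, so adjacent classes can be counted by keys; each vertex
    of [X] is charged one class of its own. *)
Lemma card_qnbh_keys (Key : finType) (r : T -> T) u (ky : T -> Key) (K : {set Key}) :
  (forall a b, r a = u -> adj G a b -> b \notin X -> ky b \in K) ->
  (forall b b', b \notin X -> b' \notin X -> ky b = ky b' -> r b = r b') ->
  (#|qnbh G r u| <= #|X| + #|K|)%N.
Proof.
move=> H1 H2; pose g k := r (odflt u [pick b | (b \notin X) && (ky b == k)]).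
apply: leq_trans (_ : #|(r @: X) :|: (g @: K)| <= _)%N; last first.
  by rewrite (leq_trans (leq_of_leqif (leq_card_setU _ _))) // leq_add // leq_imset_card.
apply/subset_leq_card/subsetP => v; rewrite inE => /andP[_ /existsP[a /existsP[b /and3P[/eqP au /eqP <- ab]]]].
rewrite inE; have [bX|bX] := boolP (b \in X); first by rewrite imset_f.
apply/orP; right; apply/imsetP; exists (ky b); first exact: H1 au ab bX.
rewrite /g; case: pickP => [c /andP[cX /eqP kc]|/(_ b)]; last by rewrite bX eqxx.
exact: H2.
Qed.

Lemma mkseq_eqP (f g : nat -> bool) k : mkseq f k = mkseq g k <-> forall j, (j < k)%N -> f j = g j.
Proof.
split=> [E j jk|fg]; first by rewrite -(nth_mkseq false f jk) E nth_mkseq.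
by apply/eq_in_map => j; rewrite mem_iota => /andP[_]; exact: fg.
Qed.

(* The contraction first merges vertices with equal labels in any order, then *)
(* forgets the bits of the labels one by one, starting with the last one; the *)
(* vertices of [X] stay singletons until the end.                             *)
Lemma contraction_of_labels s E w : (0 < #|T|)%N -> (0 < s)%N ->
  (2 ^ m * #|T| ^ s < s`! * 2 ^ (m * s))%N ->
  (forall k, (k <= m)%N -> (k - t * (k %/ h).-1 <= E)%N) ->
  (s * D.+1 ^ (L + L) * D <= w)%N ->
  (#|X| + (2 * h) ^ t * 2 ^ E * 2 <= w)%N ->
  has_contraction_sequence w (trigraph_of G).
Proof.
move=> T0 s0 sm kE w1 w2; have [b0 balanced] := balanced_labels sm.
pose lab := label (bits b0).
(* Level 0 is discrete. Level $i + 1$ keeps the first $m - i$ bits outside [X] and separates the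
   vertices of [X]; level [m.+2] puts everything together. *)
pose f i x : T + seq bool := if i is i'.+1 then
   if (i' <= m)%N then if x \in X then inl x else inr (mkseq (lab x) (m - i')) else inr [::]
  else inl x.
have Dw : (D <= w)%N by apply: leq_trans w1; rewrite leq_pmull // muln_gt0 s0 expn_gt0.
apply: (@contraction_of_phases _ _ G w m.+2 f) => //.
- by move=> x y [].
- move=> [|i] x y /=; first by case=> ->.
  case: (leqP i m) => [im|mi]; last by rewrite leqNgt ltnW.
  case: (x \in X) (boolP (y \in X)) => [] [yX|yX] //.
    by case=> ->; case: ltnP; rewrite ?yX.
  case=> /mkseq_eqP E1; case: ltnP => // _.
  by congr inr; apply/mkseq_eqP => j jm; apply: E1; apply: leq_trans jm _; lia.
- by move=> x y /=; rewrite ltnn.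
move=> i r im [rf rg] u.
have single x : x \in X -> (forall y, r y = u -> y = x) -> (#|qnbh G r u| <= w)%N.
  move=> xX ux'; apply: leq_trans (card_preim_le _ _) (leq_trans _ Dw).
  rewrite -[leqRHS]mul1n leq_mul2r -(cards1 x); apply/orP; right.
  by apply/subset_leq_card/subsetP => y; rewrite !inE => /eqP/ux' ->.
case: (pickP (fun a => r a == u)) => [a0 /eqP a0u|nou]; last first.
  apply: leq_trans (card_preim_le _ _) _; rewrite (_ : [set a | r a == u] = set0) ?cards0 ?mul0n //.
  by apply/setP => a; rewrite !inE nou.
case: i im rf rg => [|i] im rf rg.
  have [a0X|a0X] := boolP (a0 \in X).
    apply: (single _ a0X) => y yu; have := rg a0 y; rewrite a0u yu => /(_ erefl) /=.
    by rewrite a0X; case: ifP => // _ [].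
  apply: leq_trans (card_preim_le _ _) _; apply: leq_trans w1; rewrite leq_mul2r; apply/orP; right.
  apply: leq_trans (balanced (full_label b0 a0)); apply/subset_leq_card/subsetP => y.
  rewrite !inE => /eqP yu; have := rg a0 y; rewrite a0u yu => /(_ erefl) /=.
  rewrite (negbTE a0X); case: ifP => // yX [] /mkseq_eqP E1 /=; apply/eqP/ffunP => j.
  have jm : (val j < m - 0)%N by rewrite subn0; exact: ltn_ord.
  by rewrite /full_label !ffunE; exact/esym/(E1 _ jm).
move: im; rewrite ltnS leq_eqVlt => /predU1P[im|im].
  have {}im : i = m by case: im.
  apply: leq_trans w2; apply: leq_trans (@card_qnbh_keys unit r u (fun=> tt) [set: unit] _ _) _ => //.
    by move=> b b' bX b'X _; apply: rf; rewrite /= im leqnn (negbTE bX) (negbTE b'X) subnn.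
  by rewrite leq_add2l cardsT card_unit !muln_gt0 !expn_gt0 muln_gt0 h_gt0.
rewrite ltnS in im.
have [a0X|a0X] := boolP (a0 \in X).
  apply: (single _ a0X) => y yu; have := rg a0 y; rewrite a0u yu => /(_ erefl) /=.
  by rewrite im a0X; case: ifP => // _ [].
pose k := (m - i.+1)%N; have km : (k <= m)%N by exact: leq_subr.
(* In this phase all vertices of the class [u] share their first [k] bits, while $k + 1$ bits
   determine a class. Bit [k] of a neighbour is left unconstrained, whence the factor 2. *)
pose ky x := ([ffun j : 'I_k => lab x j], lab x k).
pose K0 := \bigcup_(P in patterns h t) compatible h_gt0 k P.1 P.2 (lab a0).
have K0c : (#|K0| <= (2 * h) ^ t * 2 ^ E)%N.
  apply: leq_trans (_ : \sum_(P in patterns h t) 2 ^ E <= _)%N; last first.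
    by rewrite sum_nat_const leq_mul2r patterns_card orbT.
  apply: leq_trans (_ : \sum_(P in patterns h t) #|compatible h_gt0 k P.1 P.2 (lab a0)| <= _)%N.
    rewrite /K0; elim/big_rec2: _ => [|P n A _ IH]; first by rewrite cards0.
    by rewrite (leq_trans (leq_of_leqif (leq_card_setU _ _))) // leq_add2l.
  apply: leq_sum => -[A B]; rewrite inE => /eqP /= AB.
  by rewrite (leq_trans (compatible_card h_gt0 th k (lab a0) AB)) // leq_exp2l // kE.
apply: leq_trans w2; apply: leq_trans (@card_qnbh_keys _ r u ky (finset.setX K0 [set: bool]) _ _) _.
- move=> a b au ab bX; rewrite !inE andbT; apply/bigcupP.
  exists (out a b, out b a); first by rewrite inE /= sgC.
  have aX : a \notin X.
    apply: contra a0X => aX; have := rg a a0; rewrite au a0u => /(_ erefl) /=.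
    by rewrite im aX; case: ifP.
  have := label_compatible (bits b0) ab km; rewrite /compatible !inE /=.
  suff la : forall j, (j < k)%N -> lab a j = lab a0 j.
    move=> /forallP H; apply/forallP => j; have := H j.
    case hj : (h <= j)%N => //= /andP[/implyP H1 /implyP H2]; apply/andP; split; apply/implyP => jA.
      have /forallP H3 := H1 jA; apply/forallP => g; have := H3 g.
      by rewrite -/lab la.
    have := H2 jA; rewrite -/lab la //.
    have BA : (#|out b a| + #|out a b| = t)%N by rewrite addnC sgC.
    by have [lt _ _] := copyP th BA hj jA; exact: ltn_trans lt (ltn_ord j).
  have := rg a a0; rewrite au a0u => /(_ erefl) /=; rewrite im (negbTE aX) (negbTE a0X).
  by case=> /mkseq_eqP.
- move=> b b' bX b'X [/ffunP E1 E2]; apply: rf; rewrite /= ltnW // (negbTE bX) (negbTE b'X).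
  congr inr; apply/mkseq_eqP => j jm; have : (j <= k)%N by rewrite /k; lia.
  rewrite leq_eqVlt => /predU1P[-> //|jk].
  by have := E1 (Ordinal jk); rewrite !ffunE.
- by rewrite leq_add2l cardsX cardsT card_bool leq_mul2r K0c orbT.
Qed.

End Labels.

(** * Blocks of a contraction sequence *)

Section Chunks.
Variables (T : finType) (G : sgraph T) (S : {set T}) (sz w D : nat).
Implicit Types (H : trigraph T) (ph : T -> T) (bk : T -> T + T) (F : {set T}).

(* [ph] maps the vertices of [G] to those of the trigraph [H]. Chunks of [S]  *)
(* are frozen as soon as they have [sz] elements: the frozen chunk of [r] is  *)
(* called [inl r], and [inr v] is what is left of the vertex [v] of [H]. An   *)
(* edge between two chunks is recorded by the chunk that was frozen first, so *)
(* that every chunk records at most [w + D + 1] others.                       *)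
Record chunked H ph bk F (os : T -> {set T + T}) : Prop := Chunked {
  ch_vert : forall x, ph x \in tvert H;
  ch_surj : forall v, v \in tvert H -> exists x, ph x = v;
  ch_edge : forall x y, adj G x y -> ph x != ph y -> [set ph x; ph y] \in tedge H;
  ch_black : forall x y, ph x != ph y -> [set ph x; ph y] \in tblack H -> adj G x y;
  ch_blk : forall x, x \in S -> bk x = inr (ph x) \/ exists2 r, r \in F & bk x = inl r;
  ch_rep : forall r, r \in F -> r \in S /\ bk r = inl r;
  ch_small : forall v, (#|[set x in S | bk x == inr v]| < sz)%N;
  ch_big : forall r, r \in F -> (sz <= #|[set x in S | bk x == inl r]| < 2 * sz)%N;
  ch_out : forall r, r \in F -> (#|os r| <= w + D + 1)%N;
  ch_cover : forall x y r, x \in S -> y \in S -> adj G x y -> bk x = inl r ->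
    bk y \in os r \/ exists2 r', bk y = inl r' & bk x \in os r' }.

Lemma card_set2_nbrs (F : {set {set T}}) (A : {set T}) u : F \subset pairs A ->
  #|[set v | [set u; v] \in F]| = #|[set e in F | u \in e]|.
Proof.
move=> /subsetP FA.
have neq a b : [set a; b] \in F -> a != b.
  by move/FA; rewrite inE cards2 => /andP[_]; case: (a == b).
rewrite -(card_in_imset (f := fun v => [set u; v]) (D := mem [set v | [set u; v] \in F])).
  apply: eq_card => e; rewrite [in RHS]inE; apply/imsetP/andP => [[v]|[eF]].
    by rewrite inE => uv ->; rewrite uv !inE eqxx.
  have := FA _ eF; rewrite inE => /andP[_ /cards2P[a [b [ab eE]]]].
  rewrite eE in eF *; case/set2P => ->; first by exists b; rewrite ?inE.
  by exists a; rewrite ?inE // setUC.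
move=> a b; rewrite !inE => /neq ua /neq ub /setP/(_ a).
by rewrite !inE eqxx orbT [a == u]eq_sym (negbTE ua) => /esym/eqP.
Qed.

Lemma contract_edge H H' u v z x : contracts_to H H' u v z -> x \in tvert H :\: [set u; v] ->
  ([set z; x] \in tedge H') = ([set u; x] \in tedge H) || ([set v; x] \in tedge H).
Proof.
move=> [_ _ cb cr _] xr; rewrite [LHS]in_setU cb // cr //.
rewrite !in_setU; case: ([set u; x] \in tblack H) => //=; case: ([set v; x] \in tblack H) => //=.
  by rewrite orbT.
by rewrite andbT.
Qed.

(** The remainders of [u] and [v] are joined under the name [z]. If the union reaches [sz] it is
    frozen and named after one of its elements [r0]; it has fewer than [2 * sz] elements, since both
    parts were below [sz]. It records itself and the remainders at the at most $w + D$ neighbours of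
    [z]. *)
Lemma chunked_merge H H' u v z ph bk F os :
  (forall x, degree G x <= D)%N -> (forall x, x \in tvert H' -> red_degree H' x <= w)%N ->
  contracts_to H H' u v z -> chunked H ph bk F os ->
  exists ph' bk' F' os', chunked H' ph' bk' F' os'.
Proof.
move=> degD redw cH ch; have [[uH vH uv] [zr HE] cb cr co] := cH.
set rest := tvert H :\: [set u; v] in zr HE cb cr co.
pose muv a := (a == u) || (a == v).
pose ph' x := if muv (ph x) then z else ph x.
have restE a : a \in tvert H -> ~~ muv a -> a \in rest by move=> aH; rewrite !inE => -> /=.
have phr x : ~~ muv (ph x) -> ph x \in rest by apply: restE; exact: ch_vert ch x.
have zV : z \in tvert H' by rewrite HE setU11.
have zn a : a \in rest -> (z == a) = false by move=> ar; apply: contraNF zr => /eqP ->.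
have vert' x : ph' x \in tvert H'.
  by rewrite /ph'; case: (boolP (muv (ph x))) => // m; rewrite HE in_setU1 phr ?orbT.
have surj' a : a \in tvert H' -> exists x, ph' x = a.
  rewrite HE in_setU1 => /orP[/eqP ->|].
    by have [x xu] := ch_surj ch uH; exists x; rewrite /ph' /muv xu eqxx.
  rewrite inE in_set2 -/(muv a) => /andP[m aH].
  by have [x xa] := ch_surj ch aH; exists x; rewrite /ph' xa (negbTE m).
have edge1 x y : adj G x y -> muv (ph x) -> ~~ muv (ph y) -> [set z; ph y] \in tedge H'.
  move=> xy mx my; rewrite (contract_edge cH) ?phr //.
  have /(ch_edge ch xy) : ph x != ph y by apply: contraNneq my => <-.
  by case/orP: mx => /eqP -> ->; rewrite ?orbT.
have edge' x y : adj G x y -> ph' x != ph' y -> [set ph' x; ph' y] \in tedge H'.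
  rewrite /ph' => xy; case: (boolP (muv (ph x))) => mx; case: (boolP (muv (ph y))) => my.
  - by rewrite eqxx.
  - by move=> _; exact: edge1 xy mx my.
  - by move=> _; rewrite setUC; apply: edge1 my mx; rewrite adjC.
  move=> pxy; have := ch_edge ch xy pxy; rewrite !in_setU.
  by have [-> ->] := co _ _ (phr _ mx) (phr _ my).
have black1 x y : muv (ph x) -> ~~ muv (ph y) -> [set z; ph y] \in tblack H' -> adj G x y.
  move=> mx my; rewrite cb ?phr // => /andP[bu bv].
  apply: (ch_black ch); first by apply: contraNneq my => <-.
  by case/orP: mx => /eqP ->.
have black' x y : ph' x != ph' y -> [set ph' x; ph' y] \in tblack H' -> adj G x y.
  rewrite /ph'; case: (boolP (muv (ph x))) => mx; case: (boolP (muv (ph y))) => my.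
  - by rewrite eqxx.
  - by move=> _; exact: black1.
  - by move=> _; rewrite setUC adjC; exact: black1.
  by move=> pxy; have [-> _] := co _ _ (phr _ mx) (phr _ my); exact: (ch_black ch).
pose f1 (b : T + T) : T + T := if b is inr a then if muv a then inr z else inr a else b.
pose bk1 x := f1 (bk x).
pose os1 r : {set T + T} := f1 @: os r.
have blk1 x : x \in S -> bk1 x = inr (ph' x) \/ exists2 r, r \in F & bk1 x = inl r.
  case/(ch_blk ch) => [E|[r rF E]]; rewrite /bk1 E; last by right; exists r.
  by left; rewrite /f1 /ph'; case: ifP.
have rep1 r : r \in F -> r \in S /\ bk1 r = inl r.
  by case/(ch_rep ch) => rS E; rewrite /bk1 E.
have big1 r : [set x in S | bk1 x == inl r] = [set x in S | bk x == inl r].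
  by apply/setP => x; rewrite !inE /bk1; case: (bk x) => // a /=; case: ifP.
have small1 a : a != z -> (#|[set x in S | bk1 x == inr a]| < sz)%N.
  move=> az; apply: leq_ltn_trans (ch_small ch a); apply/subset_leq_card/subsetP => x.
  rewrite !inE /bk1 => /andP[->]; case: (bk x) => // b /=.
  by case: ifP => //= _ /eqP[E]; rewrite -E eqxx in az.
have out1 r : r \in F -> (#|os1 r| <= w + D + 1)%N.
  by move=> rF; apply: leq_trans (leq_imset_card _ _) (ch_out ch rF).
have cover1 x y r : x \in S -> y \in S -> adj G x y -> bk1 x = inl r ->
    bk1 y \in os1 r \/ exists2 r', bk1 y = inl r' & bk1 x \in os1 r'.
  move=> xS yS xy; rewrite /bk1; case E : (bk x) => [r0|a] /=; last by case: ifP.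
  case=> <-; case: (ch_cover ch xS yS xy E) => [yr|[r' yr' xr']].
    by left; exact: imset_f.
  right; exists r'; first by rewrite yr'.
  by have := imset_f f1 xr'; rewrite E.
have [smallz|bigz] := ltnP #|[set x in S | bk1 x == inr z]| sz.
  exists ph', bk1, F, os1; split => //.
    by move=> a; have [->|] := eqVneq a z; last exact: small1.
  by move=> r rF; rewrite big1; exact: (ch_big ch).
have sz0 : (0 < sz)%N by apply: leq_ltn_trans (ch_small ch z).
have /card_gt0P[r0] : (0 < #|[set x in S | bk1 x == inr z]|)%N by apply: leq_trans bigz.
rewrite inE => /andP[r0S /eqP r0z].
have r0F : r0 \notin F by apply/negP => /rep1[_]; rewrite r0z.
pose f2 (b : T + T) : T + T := if b == inr z then inl r0 else b.
have f2l r : f2 (inl r) = inl r by [].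
pose bk2 x := f2 (bk1 x).
pose nb : {set T} := [set a | [set z; a] \in tedge H'].
pose os2 r : {set T + T} := if r == r0 then inl r0 |: (inr @: nb) else f2 @: os1 r.
(* A black edge at [z] joins all pairs of vertices of its two classes, so every black neighbour of
   [z] contains a neighbour of one fixed vertex of [G]: there are at most [D] of them, besides [w]
   red ones. *)
have nbc : (#|nb| <= w + D)%N.
  apply: leq_trans (_ : #|[set a | [set z; a] \in tred H'] :|: [set a | [set z; a] \in tblack H']| <= _)%N.
    by apply/subset_leq_card/subsetP => a; rewrite !inE orbC.
  apply: leq_trans (leq_of_leqif (leq_card_setU _ _)) _; apply: leq_add.
    by rewrite (card_set2_nbrs z (tredP H')); exact: redw.
  have [x xz] := surj' _ zV; apply: leq_trans (degD x); rewrite -card_nbh.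
  apply: leq_trans (leq_imset_card ph' _); apply/subset_leq_card/subsetP => a.
  rewrite inE => za; have := subsetP (tblackP H') _ za; rewrite inE subUset !sub1set => /andP[/andP[_ aH] /eqP].
  rewrite cards2; case: (eqVneq z a) => // z_a _.
  have [y ya] := surj' _ aH; rewrite -ya; apply: imset_f; rewrite inE.
  by apply: black'; rewrite xz ya.
have bk2E x r : r != r0 -> (bk2 x == inl r) = (bk1 x == inl r).
  move=> rr0; rewrite /bk2 /f2; case: (eqVneq (bk1 x) (inr z)) => [E|//].
  by rewrite E; apply/negbTE; apply: contra rr0 => /eqP[->].
have bk20 x : x \in S -> (bk2 x == inl r0) = (bk1 x == inr z).
  move=> xS; rewrite /bk2 /f2; case: (eqVneq (bk1 x) (inr z)) => [_|nz]; first by rewrite eqxx.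
  apply/negbTE; apply: contraNneq r0F => E; case: (blk1 _ xS) => [|[r rF]]; rewrite E // => -[->] //.
exists ph', bk2, (r0 |: F), os2; split => //.
- move=> x xS; case: (blk1 _ xS) => [E|[r rF E]]; rewrite /bk2 /f2 E.
    case: eqP => [_|]; first by right; exists r0; rewrite ?setU11.
    by left.
  by right; exists r; rewrite // setU1r.
- move=> r /setU1P[->|rF]; first by rewrite /bk2 /f2 r0z eqxx.
  by have [rS E] := rep1 r rF; rewrite /bk2 E.
- move=> a; have [->|az] := eqVneq a z.
    rewrite (_ : [set x in S | _] = set0) ?cards0 //; apply/setP => x; rewrite !inE /bk2 /f2.
    by case: ifP => [_|/negbT/negbTE ->]; rewrite ?andbF.
  apply: leq_ltn_trans (small1 a az); apply/subset_leq_card/subsetP => x.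
  by rewrite !inE /bk2 /f2; case: ifP => //; rewrite andbF.
- move=> r /setU1P[->|rF]; last first.
    have rr0 : r != r0 by apply: contraNneq r0F => <-.
    have -> : [set x in S | bk2 x == inl r] = [set x in S | bk x == inl r].
      by rewrite -big1; apply/setP => x; rewrite !inE bk2E.
    exact: (ch_big ch).
  have -> : [set x in S | bk2 x == inl r0] = [set x in S | bk1 x == inr z].
    by apply/setP => x; rewrite !inE; case: (boolP (x \in S)) => //= /bk20 ->.
  rewrite bigz /=; have ru := ch_small ch u; have rv := ch_small ch v.
  apply: leq_ltn_trans (_ : #|[set x in S | bk x == inr u] :|: [set x in S | bk x == inr v]| < _)%N; last first.
    apply: leq_ltn_trans (leq_of_leqif (leq_card_setU _ _)) _.
    by rewrite mul2n -addnn -addSn leq_add // ltnW.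
  apply/subset_leq_card/subsetP => x; rewrite !inE => /andP[xS]; rewrite xS /=.
  rewrite /bk1; case: (ch_blk ch xS) => [E|[r' _ E]]; rewrite E //=.
  case: ifP => [/orP[]/eqP -> _|/negbT m /eqP[E']]; rewrite ?eqxx ?orbT //.
  by move: (zn _ (phr _ m)); rewrite E' eqxx.
- move=> r /setU1P[->|rF]; rewrite /os2 ?eqxx.
    rewrite cardsU1 addnC leq_add ?leq_b1 //; exact: leq_trans (leq_imset_card _ _) nbc.
  have -> : (r == r0) = false by apply: contraNF r0F => /eqP <-.
  exact: leq_trans (leq_imset_card _ _) (out1 r rF).
move=> x y r xS yS xy xr.
have os2F r' : bk1 x = inl r' \/ bk1 y = inl r' -> (r' == r0) = false.
  move=> H0; apply: contraNF r0F => /eqP <-.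
  case: H0 => E; [case: (blk1 x xS)|case: (blk1 y yS)]; rewrite E // => -[r'' ? [->]] //.
case: (blk1 _ xS) => [xz|[r1 r1F E]]; last first.
  have rE : r = r1 by move: xr; rewrite /bk2 E f2l => -[].
  case: (cover1 _ _ _ xS yS xy E) => [yr|[r' yr' xr']].
    by left; rewrite rE /os2 os2F ?E; [exact: imset_f|left].
  right; exists r'; first by rewrite /bk2 yr'.
  by rewrite /os2 os2F ?yr'; [rewrite /bk2; exact: imset_f|right].
have xz' : ph' x = z.
  by move: xr; rewrite /bk2 /f2 xz; case: eqP => [[]|].
have rE : r = r0 by move: xr; rewrite /bk2 /f2 xz xz' eqxx => -[].
rewrite rE; case: (blk1 _ yS) => [yz|[r1 r1F E]].
  left; rewrite /os2 eqxx /bk2 /f2 yz; case: (eqVneq (ph' y) z) => [->|yz'].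
    by rewrite eqxx setU11.
  rewrite (_ : (inr (ph' y) == inr z :> T + T) = false); last by apply: contraNF yz' => /eqP[->].
  by rewrite setU1r // imset_f // inE -xz'; apply: edge'; rewrite // xz' eq_sym.
right; exists r1; first by rewrite /bk2 E.
have yx : adj G y x by rewrite adjC.
case: (cover1 _ _ _ yS xS yx E) => [yr|[r' xr']]; last by rewrite xz in xr'.
by rewrite /os2 os2F; [rewrite /bk2; exact: imset_f|right].
Qed.

Lemma chunks : (2 <= sz)%N -> (forall x, degree G x <= D)%N ->
  has_contraction_sequence w (trigraph_of G) ->
  exists (bk : T -> T + T) (I : {set T + T}) (os : T + T -> {set T + T}),
    [/\ (#|I| <= #|S| %/ sz + 1)%N, forall x, x \in S -> bk x \in I,
        forall b, (#|[set x in S | bk x == b]| <= 2 * sz)%N,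
        forall b, b \in I -> (#|os b| <= w + D + 1)%N &
        forall x y, x \in S -> y \in S -> adj G x y ->
          bk y \in os (bk x) \/ bk x \in os (bk y)].
Proof.
move=> sz2 degD [l [H [H0 Hs Hl Hw]]].
have step : forall i, (i <= l)%N -> exists ph bk F os, chunked (H i) ph bk F os.
  elim=> [_|i IH il]; last first.
    have [ph [bk [F [os ch]]]] := IH (ltnW il); have [u [v [z cz]]] := Hs _ il.
    by apply: chunked_merge cz ch => // x; exact: Hw.
  exists id, inr, set0, (fun=> set0); rewrite H0; split => //=.
  - by move=> v; exists v.
  - by move=> x y xy _; rewrite in_setU; apply/orP; left; exact: xy.
  - by move=> x _; left.
  - by move=> r; rewrite inE.
  - move=> v; apply: leq_trans sz2; rewrite ltnS -(cards1 v).
    by apply/subset_leq_card/subsetP => x; rewrite !inE => /andP[_ /eqP[->]].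
  - by move=> r; rewrite inE.
  - by move=> r; rewrite inE.
have [ph [bk [F [os ch]]]] := step l (leqnn l).
have /eqP/cards1P[z zE] := Hl.
have phz x : ph x = z by have := ch_vert ch x; rewrite zE inE => /eqP.
have Fsz : (#|F| * sz <= #|S|)%N.
  pose B r := [set x in S | bk x == inl r].
  apply: leq_trans (_ : #|\bigcup_(r in F) B r| <= _)%N; last first.
    by apply/subset_leq_card/bigcupsP => r _; apply/subsetP => x; rewrite inE => /andP[].
  rewrite card_bigcup_disjoint => [|r r' _ _ rr'].
    by rewrite -sum_nat_const; apply: leq_sum => r /(ch_big ch) /andP[].
  apply/pred0P => x; rewrite !inE; apply/negP => /andP[/andP[_ /eqP ->] /andP[_ /eqP[E]]].
  by rewrite E eqxx in rr'.
have bkI x : x \in S -> bk x \in inr z |: (inl @: F).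
  case/(ch_blk ch) => [|[r rF]] ->; first by rewrite phz setU11.
  by rewrite setU1r // imset_f.
exists bk, (inr z |: (inl @: F)), (fun b => if b is inl r then os r else [set inr z]); split => //.
- rewrite cardsU1 addnC leq_add ?leq_b1 // (leq_trans (leq_imset_card _ _)) //.
  by rewrite leq_divRL //; apply: leq_trans sz2.
- move=> b; case: b => [r|v]; last by have := ch_small ch v; lia.
  have [rF|rF] := boolP (r \in F); first by have /andP[_ /ltnW] := ch_big ch rF.
  rewrite (_ : [set x in S | _] = set0) ?cards0 //; apply/setP => x; rewrite !inE.
  apply/negP => /andP[xS /eqP E]; case: (ch_blk ch xS) => [|[r' r'F]]; rewrite E // => -[rE].
  by rewrite rE r'F in rF.
- move=> b /setU1P[->|/imsetP[r rF ->]]; first by rewrite cards1 addn1.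
  exact: (ch_out ch).
move=> x y xS yS xy; case: (ch_blk ch xS) => [xz|[r rF xr]]; last first.
  case: (ch_cover ch xS yS xy xr) => [yr|[r' yr' xr']]; first by left; rewrite xr.
  by right; rewrite yr'.
case: (ch_blk ch yS) => [yz|[r rF yr]]; first by left; rewrite xz yz !phz inE.
have yx : adj G y x by rewrite adjC.
case: (ch_cover ch yS xS yx yr) => [yr'|[r' xr']]; first by right; rewrite yr.
by rewrite xz in xr'.
Qed.

End Chunks.

Local Open Scope ring_scope.

(** * First moments *)

Section FirstMoment.
Variables (R : realType) (n : nat) (mu : sgraph 'I_n -> R).
Hypothesis mu_ge0 : forall G, 0 <= mu G.
Implicit Types (A B : pred (sgraph 'I_n)) (F : {set {set 'I_n}}) (W : {set 'I_n}).

Local Notation P := (graph_prob mu).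

Lemma graph_prob_ge0 A : 0 <= P A.
Proof. exact: sumr_ge0. Qed.

Lemma graph_prob_le A B : (forall G, A G -> B G) -> P A <= P B.
Proof.
move=> AB; rewrite /graph_prob [leRHS](bigID A) /=.
rewrite (eq_bigl A) => [|G]; last by case: (boolP (A G)) => [/AB ->|]; rewrite ?andbF.
by rewrite lerDl sumr_ge0.
Qed.

Lemma graph_prob_union (I : finType) (D : pred I) (E : I -> pred (sgraph 'I_n)) A :
  (forall G, A G -> exists2 i, D i & E i G) -> P A <= \sum_(i | D i) P (E i).
Proof.
move=> AE; rewrite /graph_prob.
under [leRHS]eq_bigr => i _ do rewrite big_mkcond.
rewrite exchange_big big_mkcond /=; apply: ler_sum => G _.
case: ifP => [/AE[i Di EiG]|_]; last by apply: sumr_ge0 => i _; case: ifP.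
rewrite (bigD1 i) //= EiG lerDl; apply: sumr_ge0 => j _; by case: ifP.
Qed.

Lemma graph_prob_union2 A B C : (forall G, A G -> B G || C G) -> P A <= P B + P C.
Proof.
move=> ABC; have := @graph_prob_union bool xpredT (fun b => if b then B else C) A.
by rewrite big_bool /=; apply => G /ABC/orP[]; [exists true|exists false].
Qed.

Lemma graph_probC A : \sum_G mu G = 1 -> P A = 1 - P (predC A).
Proof. by move=> s1; apply/esym/eqP; rewrite subr_eq -s1 (bigID A). Qed.

Lemma graph_prob_markov (f : sgraph 'I_n -> nat) K :
  K%:R * P (fun G => (K <= f G)%N) <= \sum_G mu G * (f G)%:R.
Proof.
rewrite /graph_prob mulr_sumr [leRHS](bigID (fun G => (K <= f G)%N)) /=.
rewrite -[leLHS]addr0 lerD //; last by apply: sumr_ge0 => G _; rewrite mulr_ge0.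
by apply: ler_sum => G Kf; rewrite mulrC ler_wpM2l // ler_nat.
Qed.

Variable q : R.
Hypothesis q_ge0 : 0 <= q.
Hypothesis sparse : forall F, P (fun G => F \subset edges G) <= q ^+ #|F|.

Lemma prob_many_edges (D : {set {set 'I_n}}) e :
  P (fun G => (e <= #|edges G :&: D|)%N) <= ('C(#|D|, e))%:R * q ^+ e.
Proof.
apply: le_trans (_ : \sum_(F : {set {set 'I_n}} | (F \subset D) && (#|F| == e)) P (fun G => F \subset edges G) <= _).
  apply: graph_prob_union => G eD.
  exists [set x in take e (enum (edges G :&: D))].
    have sz : size (take e (enum (edges G :&: D))) = e by rewrite size_takel // -cardE.
    rewrite cardsE (card_uniqP (take_uniq _ (enum_uniq _))) sz eqxx andbT.
    by apply/subsetP => x; rewrite inE => /mem_take; rewrite mem_enum inE => /andP[].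
  by apply/subsetP => x; rewrite inE => /mem_take; rewrite mem_enum inE => /andP[].
apply: le_trans (_ : \sum_(F : {set {set 'I_n}} | (F \subset D) && (#|F| == e)) q ^+ e <= _).
  by apply: ler_sum => F /andP[_ /eqP <-].
by rewrite sumr_const -[X in X <= _]mulr_natl -cards_draws cardsE; exact: lexx.
Qed.

Lemma edges_in_pairs G W : edges_in G W = edges G :&: pairs W.
Proof.
apply/setP => e; rewrite !inE; case: (boolP (e \in edges G)) => //= eG.
by have := subsetP (edgesP G) _ eG; rewrite inE => /andP[_ ->]; rewrite andbT.
Qed.

Lemma card_pairs_le W : (#|pairs W| <= #|W| * #|W|)%N.
Proof.
have -> : #|pairs W| = 'C(#|W|, 2).
  by rewrite -cards_draws; apply: eq_card => e; rewrite !inE.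
by rewrite bin2 -divn2 (leq_trans (leq_div _ _)) // leq_mul2l leq_pred orbT.
Qed.

Lemma expected_dense_sets s e :
  \sum_(W : {set 'I_n} | #|W| == s) P (fun G => (e <= #|edges_in G W|)%N)
    <= ('C(n, s) * 'C(s * s, e))%:R * q ^+ e.
Proof.
apply: le_trans (_ : \sum_(W : {set 'I_n} | #|W| == s) ('C(s * s, e))%:R * q ^+ e <= _).
  apply: ler_sum => W /eqP Ws.
  apply: le_trans (graph_prob_le (B := fun G => (e <= #|edges G :&: pairs W|)%N) _) _.
    by move=> G; rewrite edges_in_pairs.
  apply: le_trans (prob_many_edges _ _) _; rewrite ler_wpM2r ?exprn_ge0 // ler_nat.
  by rewrite leq_bin2l // -Ws card_pairs_le.
have -> : 'C(n, s) = #|[set W : {set 'I_n} | #|W| == s]| by rewrite card_draws card_ord.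
by rewrite sumr_const natrM -mulrA -[X in X <= _]mulr_natl cardsE; exact: lexx.
Qed.

Lemma prob_degree r : P (fun G => [exists x, (r <= degree G x)%N]) <= n%:R * (('C(n, r))%:R * q ^+ r).
Proof.
apply: le_trans (_ : \sum_(x : 'I_n) ('C(n, r))%:R * q ^+ r <= _); last first.
  by rewrite sumr_const card_ord -[X in X <= _]mulr_natl; exact: lexx.
apply: le_trans (graph_prob_union (D := xpredT) (E := fun (x : 'I_n) G => (r <= degree G x)%N) _) _.
  by move=> G /existsP[x xr]; exists x.
apply: ler_sum => x _; pose D := [set [set x; y] | y : 'I_n].
apply: le_trans (graph_prob_le (B := fun G => (r <= #|edges G :&: D|)%N) _) _.
  move=> G /leq_trans; apply; apply/subset_leq_card/subsetP => e; rewrite !inE => /andP[eG xe].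
  rewrite eG /=; have [a [b [eE _]]] := edgeP eG; rewrite eE in xe *.
  by case/set2P: xe => <-; apply/imsetP; [exists b|exists a; rewrite // setUC].
apply: le_trans (prob_many_edges _ _) _; rewrite ler_wpM2r ?exprn_ge0 // ler_nat.
by rewrite leq_bin2l // (leq_trans (leq_imset_card _ _)) // card_ord.
Qed.

(** * Sets whose edges join few pairs of blocks *)

Section Cover.
Variables (N r z : nat).
Implicit Types (bk : 'I_n -> 'I_N.+1) (Q : {set 'I_N.+1 * 'I_N.+1}).

(** The outcome of [chunks] in countable form, with [Q] the set of recorded pairs of blocks. *)
Definition covers G W bk Q := [&& (#|Q| <= r)%N,
  [forall b, (#|[set x in W | bk x == b]| <= z)%N] &
  [forall x in W, forall y in W, adj G x y ==> (((bk x, bk y) \in Q) || ((bk y, bk x) \in Q))]].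

Definition covered_pairs W bk Q : {set {set 'I_n}} :=
  \bigcup_(p in Q) [set [set x; y] | x in [set x in W | bk x == p.1], y in [set y in W | bk y == p.2]].

Lemma covered_pairs_card W bk Q : (#|Q| <= r)%N ->
  (forall b, (#|[set x in W | bk x == b]| <= z)%N) -> (#|covered_pairs W bk Q| <= r * (z * z))%N.
Proof.
move=> Qr bz; apply: leq_trans (_ : \sum_(p in Q) z * z <= _)%N; last first.
  by rewrite sum_nat_const leq_mul2r Qr orbT.
apply: leq_trans (_ : \sum_(p in Q) #|[set [set x; y] | x in [set x in W | bk x == p.1], y in [set y in W | bk y == p.2]]| <= _)%N.
  rewrite /covered_pairs; elim/big_rec2: _ => [|p k A _ IH]; first by rewrite cards0.
  by rewrite (leq_trans (leq_of_leqif (leq_card_setU _ _))) // leq_add2l.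
apply: leq_sum => p _; rewrite curry_imset2X (leq_trans (leq_imset_card _ _)) //.
by rewrite cardsX leq_mul.
Qed.

Lemma prob_covered s e :
  P (fun G => [exists W : {set 'I_n}, [&& #|W| == s, (e <= #|edges_in G W|)%N &
      [exists bk : {ffun 'I_n -> 'I_N.+1}, [exists Q, covers G W bk Q]]]])
  <= ('C(n, s) * N.+1 ^ s * #|[set Q : {set 'I_N.+1 * 'I_N.+1} | (#|Q| <= r)%N]| *
      'C(r * (z * z), e))%:R * q ^+ e.
Proof.
pose I := ({set 'I_n} * ({ffun 'I_n -> 'I_N.+1} * {set 'I_N.+1 * 'I_N.+1}))%type.
pose ok (i : I) := (#|i.1| == s) && ((i.2.1 \in pffun_on ord0 (mem i.1) predT) && (#|i.2.2| <= r)%N).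
pose okz (i : I) := ok i && [forall b, (#|[set x in i.1 | i.2.1 x == b]| <= z)%N].
apply: le_trans (_ : \sum_(i | okz i) P (fun G => (e <= #|edges G :&: covered_pairs i.1 i.2.1 i.2.2|)%N) <= _).
  apply: graph_prob_union => G /existsP[W /and3P[Ws We /existsP[bk /existsP[Q /and3P[Qr bz /forallP QW]]]]].
  (* The map is set to a default outside [W], so that only $(N+1)^s$ maps enter the union bound. *)
  pose bk' := [ffun x => if x \in W then bk x else ord0].
  have bkE x : x \in W -> bk' x = bk x by rewrite ffunE => ->.
  exists (W, (bk', Q)).
    rewrite /okz /ok /= Ws Qr andbT /=; apply/andP; split.
      apply/pffun_onP; split => //; apply/subsetP => x; apply: contraLR => xW.
      by rewrite supportE negbK /bk' ffunE (negbTE xW).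
    apply/forallP => b; rewrite (leq_trans _ (forallP bz b)) //.
    by apply/subset_leq_card/subsetP => x; rewrite !inE => /andP[xW]; rewrite xW bkE.
  apply: leq_trans We _; apply/subset_leq_card/subsetP => a; rewrite !inE => /andP[aG aW].
  rewrite aG /=; have [x [y [aE xy]]] := edgeP aG; move: aW; rewrite aE subUset !sub1set => /andP[xW yW].
  have := QW x; rewrite xW /= => /forallP/(_ y); rewrite yW xy /= => /orP[] p; apply/bigcupP.
    exists (bk x, bk y) => //; apply/imset2P; exists x y => //; by rewrite inE ?xW ?yW /= bkE.
  by exists (bk y, bk x) => //; rewrite setUC; apply/imset2P; exists y x => //; rewrite inE ?xW ?yW /= bkE.
apply: le_trans (_ : \sum_(i | okz i) ('C(r * (z * z), e))%:R * q ^+ e <= _).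
  apply: ler_sum => i /andP[/and3P[_ _ Qr] /forallP bz].
  apply: le_trans (prob_many_edges _ _) _; rewrite ler_wpM2r ?exprn_ge0 // ler_nat.
  by rewrite leq_bin2l // covered_pairs_card.
rewrite sumr_const -[X in X <= _]mulr_natl mulrA -natrM ler_wpM2r ?exprn_ge0 // ler_nat leq_mul2r.
apply/orP; right; apply: leq_trans (_ : #|ok| <= _)%N.
  by apply/subset_leq_card/subsetP => i /andP[].
rewrite -[#|ok|]sum1_card.
rewrite (_ : \sum_(i in ok) 1 = \sum_(W : {set 'I_n} | #|W| == s) \sum_(p : {ffun 'I_n -> 'I_N.+1} * {set 'I_N.+1 * 'I_N.+1} | (p.1 \in pffun_on ord0 (mem W) predT) && (#|p.2| <= r)%N) 1)%N; last first.
  by rewrite pair_big_dep; apply: eq_bigl => -[W [bk Q]].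
have -> : 'C(n, s) = #|[set W : {set 'I_n} | #|W| == s]| by rewrite card_draws card_ord.
rewrite -mulnA cardsE -sum_nat_const; apply: eq_leq; apply: eq_bigr => W /eqP Ws.
rewrite -(pair_big (fun bk : {ffun 'I_n -> 'I_N.+1} => bk \in pffun_on ord0 (mem W) predT) (fun Q : {set 'I_N.+1 * 'I_N.+1} => (#|Q| <= r)%N) (fun _ _ => 1%N)) /=.
rewrite sum_nat_const card_pffun_on Ws; congr (_ ^ _ * _)%N.
  by rewrite card_ord.
by rewrite sum1dep_card.
Qed.

End Cover.

(** Chernoff's trick: the weights $x^{|Q|}$ of all subsets sum to $(1+x)^{|U|}$, and a set with at
    most [r] elements has weight at least $x^r$. *)
Lemma card_small_subsets (U : finType) (r : nat) (x : R) : 0 < x -> x <= 1 ->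
  (#|[set Q : {set U} | (#|Q| <= r)%N]|)%:R <= (1 + x) ^+ #|U| * x ^- r.
Proof.
move=> x0 x1; rewrite ler_pdivlMr ?exprn_gt0 //.
have -> : (1 + x) ^+ #|U| = \sum_(Q : {set U}) x ^+ #|Q|.
  rewrite addrC exprD1n (partition_big (fun Q : {set U} => inord #|Q| : 'I_(#|U|).+1) xpredT) //=.
  apply: eq_bigr => k _; rewrite -[in RHS](inord_val k).
  have -> : 'C(#|U|, k) = #|[set Q : {set U} | #|Q| == k]| by rewrite card_draws.
  rewrite cardsE -sumr_const; apply: eq_big => [Q|Q /eqP -> //].
  by rewrite unfold_in -val_eqE /= !inordK // ltnS max_card.
rewrite -sum1_card natr_sum mulr_suml; under eq_bigr => Q _ do rewrite mul1r.
rewrite [leRHS](bigID (mem [set Q : {set U} | (#|Q| <= r)%N])) /= -[leLHS]addr0.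
rewrite lerD ?sumr_ge0 // => [|Q _]; last by rewrite exprn_ge0 // ltW.
apply: ler_sum => Q; rewrite inE => Qr.
by apply: ler_wiXn2l; rewrite // ltW.
Qed.

End FirstMoment.

(** * Binomial and uniform random graphs *)

Lemma covers_of_contraction n (G : sgraph 'I_n) (W : {set 'I_n}) sz w D :
  (2 <= sz)%N -> (forall x, (degree G x <= D)%N) ->
  has_contraction_sequence w (trigraph_of G) ->
  exists (bk : {ffun 'I_n -> 'I_(#|W| %/ sz).+1}) Q,
    covers ((#|W| %/ sz).+1 * (w + D + 1)) (2 * sz) G W bk Q.
Proof.
move=> sz2 degD hG; have [bk [I [os [Ic bkI bz osc cov]]]] := chunks W sz2 degD hG.
rewrite addn1 in Ic; set N := (#|W| %/ sz)%N in Ic *.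
pose idx (b : 'I_n + 'I_n) : 'I_N.+1 := inord (index b (enum I)).
have idx_inj : {in I &, injective idx}.
  move=> b b' bI b'I /(congr1 val); have lt c : c \in I -> (index c (enum I) < N.+1)%N.
    by move=> cI; apply: leq_trans Ic; rewrite cardE index_mem mem_enum.
  rewrite /= !inordK ?lt // => E.
  have := nth_index b (_ : b \in enum I); rewrite mem_enum => /(_ bI) <-.
  by rewrite E nth_index ?mem_enum.
exists [ffun x => idx (bk x)], (\bigcup_(b in I) [set (idx b, idx b') | b' in os b]).
apply/and3P; split.
- apply: leq_trans (_ : \sum_(b in I) (w + D + 1) <= _)%N; last first.
    by rewrite sum_nat_const leq_mul2r Ic orbT.
  apply: leq_trans (_ : \sum_(b in I) #|[set (idx b, idx b') | b' in os b]| <= _)%N.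
    elim/big_rec2: _ => [|b k A _ IH]; first by rewrite cards0.
    by rewrite (leq_trans (leq_of_leqif (leq_card_setU _ _))) // leq_add2l.
  by apply: leq_sum => b bI; rewrite (leq_trans (leq_imset_card _ _)) // osc.
- apply/forallP => j; case: (pickP (fun b => (b \in I) && (idx b == j))) => [b /andP[bI /eqP bj]|noj].
    apply: leq_trans (bz b); apply/subset_leq_card/subsetP => x; rewrite !inE ffunE => /andP[xW /eqP xj].
    by rewrite xW; apply/eqP/idx_inj; rewrite ?bkI // xj.
  rewrite (_ : [set x in W | _] = set0) ?cards0 //; apply/setP => x; rewrite !inE ffunE.
  by apply/negP => /andP[xW xj]; have := noj (bk x); rewrite /= bkI // xj.
apply/forallP => x; apply/implyP => xW; apply/forallP => y; apply/implyP => yW; apply/implyP => xy.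
rewrite !ffunE; apply/orP; case: (cov x y xW yW xy) => E; [left|right]; apply/bigcupP.
  by exists (bk x); [exact: bkI|exact: imset_f].
by exists (bk y); [exact: bkI|exact: imset_f].
Qed.

Section Binomial.
Variables (R : realType) (n : nat).
Implicit Types (G : sgraph 'I_n) (e : {set 'I_n}) (F : {set {set 'I_n}}).

Definition all_pairs : {set {set 'I_n}} := pairs [set: 'I_n].

Lemma card_all_pairs : #|all_pairs| = 'C(n, 2).
Proof.
have -> : 'C(n, 2) = 'C(#|[set: 'I_n]|, 2) by rewrite cardsT card_ord.
by rewrite -cards_draws; apply: eq_card => e; rewrite !inE.
Qed.

Definition empty_graph : sgraph 'I_n := SGraph (sub0set _).
Definition graph_of F : sgraph 'I_n := insubd empty_graph F.

Lemma edges_graph_of F : F \subset all_pairs -> edges (graph_of F) = F.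
Proof. by move=> FP; rewrite /graph_of -[LHS]/(val _) val_insubd FP. Qed.

Lemma graph_of_edges G : graph_of (edges G) = G.
Proof. by apply: val_inj; rewrite /= edges_graph_of // edgesP. Qed.

Definition add_edge G e := graph_of (e |: edges G).
Definition del_edge G e := graph_of (edges G :\ e).

Lemma edges_add G e : e \in all_pairs -> edges (add_edge G e) = e |: edges G.
Proof. by move=> eP; rewrite edges_graph_of // subUset sub1set eP edgesP. Qed.

Lemma edges_del G e : edges (del_edge G e) = edges G :\ e.
Proof. by rewrite edges_graph_of // (subset_trans (subsetDl _ _)) // edgesP. Qed.

Variable p : R.
Local Notation mu := (random_gnp p (n := n)).

Definition mean (f : sgraph 'I_n -> R) := \sum_G mu G * f G.

Lemma mean1 : \sum_G mu G = 1.
Proof.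
pose Fp e : R := if e \in all_pairs then p else 0.
pose Fq e : R := if e \in all_pairs then 1 - p else 1.
have : \prod_(e : {set 'I_n}) (Fp e + Fq e) = 1.
  by rewrite big1 // => e _; rewrite /Fp /Fq; case: ifP => _; rewrite ?add0r // addrC subrK.
rewrite bigA_distr => <-; rewrite [RHS](bigID (fun J : {set {set 'I_n}} => J \subset all_pairs)) /=.
rewrite [X in _ = _ + X]big1 ?addr0 => [|J /subsetPn[e eJ eP]]; last first.
  by rewrite (bigD1 e) //= eJ /Fp (negbTE eP) mul0r.
rewrite [RHS](reindex_onto (@edges _) graph_of) /= => [|J JP]; last exact: edges_graph_of.
apply: eq_big => G; first by rewrite graph_of_edges eqxx edgesP.
move=> _; rewrite /random_gnp [RHS](bigID (mem all_pairs)) /=.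
rewrite [X in _ = _ * X]big1 ?mulr1 => [|e eP]; last first.
  rewrite /Fq (negbTE eP); case: ifP => // eG.
  by have := subsetP (edgesP G) _ eG; rewrite -/all_pairs (negbTE eP).
by apply: eq_bigr => e eP; rewrite /Fp /Fq eP.
Qed.

(* The presence of [e] is independent of the rest of the graph. *)
Lemma mean_edge e f : e \in all_pairs ->
  (forall G, f (add_edge G e) = f (del_edge G e)) ->
  mean (fun G => (e \in edges G)%:R * f G) = p * mean f.
Proof.
move=> eP fe; rewrite /mean.
have -> : \sum_G mu G * ((e \in edges G)%:R * f G) = \sum_(G | e \in edges G) mu G * f G.
  rewrite [RHS]big_mkcond; apply: eq_bigr => G _.
  by case: ifP => _; rewrite ?mul1r // mul0r mulr0.
rewrite [in RHS](bigID (fun G => e \in edges G)) /=.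
(* Adding [e] changes the weight by $p/(1-p)$; written without division, this covers $p = 0$ and $p
   = 1$. *)
have E G : e \notin edges G -> (1 - p) * (mu (add_edge G e) * f (add_edge G e)) = p * (mu G * f G).
  move=> eG; have -> : f (add_edge G e) = f G.
    rewrite fe; congr f; apply: val_inj; rewrite /= edges_del.
    by apply/setP => a; rewrite !inE; case: (eqVneq a e) => [->|]; rewrite ?(negbTE eG).
  rewrite ![_ * (_ * f G)]mulrA; congr (_ * _).
  rewrite /random_gnp -/all_pairs (bigD1 e) //= [in RHS](bigD1 e) //= edges_add // setU11 (negbTE eG).
  rewrite mulrA [in RHS]mulrA [p * _]mulrC; congr (_ * _).
  by apply: eq_bigr => a /andP[_ ae]; rewrite !inE (negbTE ae).
have reidx : \sum_(G | e \in edges G) mu G * f G =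
    \sum_(G | e \notin edges G) mu (add_edge G e) * f (add_edge G e).
  rewrite (reindex_onto (add_edge^~ e) (del_edge^~ e)) /= => [|G eG].
    apply: eq_bigl => G; rewrite edges_add // setU11 /=; apply/eqP/idP => [<-|eG].
      by rewrite edges_del !inE eqxx.
    apply: val_inj; rewrite /= edges_del edges_add //.
    by apply/setP => a; rewrite !inE; case: (eqVneq a e) => [->|]; rewrite ?(negbTE eG).
  apply: val_inj; rewrite /= edges_add // edges_del.
  by apply/setP => a; rewrite !inE; case: (eqVneq a e) => [->|]; rewrite ?eG.
have : (1 - p) * \sum_(G | e \in edges G) mu G * f G = p * \sum_(G | e \notin edges G) mu G * f G.
  by rewrite reidx !mulr_sumr; apply: eq_bigr => G /E.
by rewrite mulrBl mul1r mulrDr => <-; ring.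
Qed.

Hypothesis p01 : 0 <= p <= 1.

Lemma gnp_ge0 G : 0 <= mu G.
Proof.
by have /andP[p0 p1] := p01; apply: prodr_ge0 => e _; case: ifP => _ //; rewrite subr_ge0.
Qed.

Lemma gnp_sparse F : graph_prob mu (fun G => F \subset edges G) <= p ^+ #|F|.
Proof.
have PE A : graph_prob mu A = mean (fun G => (A G)%:R).
  by rewrite /graph_prob big_mkcond; apply: eq_bigr => G _; case: ifP; rewrite ?mulr1 ?mulr0.
have /andP[p0 p1] := p01.
have [FP|/subsetPn[e eF eP]] := boolP (F \subset all_pairs); last first.
  rewrite /graph_prob big_pred0 ?exprn_ge0 // => G; apply/negP => /subsetP/(_ _ eF).
  by move/(subsetP (edgesP G)); rewrite -/all_pairs (negbTE eP).
rewrite PE le_eqVlt; apply/orP; left; apply/eqP.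
have [k] := ubnP #|F|; elim: k F FP => // k IH F FP Fk.
have [F0|[e eF]] := set_0Vmem F.
  rewrite F0 cards0 expr0; transitivity (\sum_G mu G); last exact: mean1.
  by apply: eq_bigr => G _; rewrite sub0set mulr1.
rewrite (cardsD1 e) eF exprS -(IH (F :\ e)); last 2 first.
- exact: subset_trans (subsetDl _ _) FP.
- by move: Fk; rewrite (cardsD1 e) eF.
rewrite -(@mean_edge e); last 2 first.
- exact: (subsetP FP).
- move=> G; rewrite edges_add ?(subsetP FP) // edges_del; congr (nat_of_bool _)%:R.
  by apply/subsetP/subsetP => H a aF; have := H a aF; move: aF; rewrite !inE => /andP[/negbTE -> _].
apply: eq_bigr => G _; congr (_ * _); rewrite -natrM mulnb; congr (nat_of_bool _)%:R.
by rewrite -{1}(setD1K eF) subUset sub1set.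
Qed.

End Binomial.

Section UniformEdges.
Variables (R : realType) (n m : nat).
Local Notation M := 'C(n, 2).
Local Notation mu := (random_gnm R m (n := n)).

Lemma gnm_count (F : {set {set 'I_n}}) : F \subset all_pairs n ->
  (#|[set G : sgraph 'I_n | (#|edges G| == m) && (F \subset edges G)]| <= 'C(M - #|F|, m - #|F|))%N.
Proof.
move=> FP.
have -> : (M - #|F| = #|all_pairs n :\: F|)%N.
  by rewrite -card_all_pairs cardsD (setIidPr FP).
rewrite -cards_draws -(card_in_imset (f := fun G : sgraph 'I_n => edges G :\: F) (D := mem [set G : sgraph 'I_n | (#|edges G| == m) && (F \subset edges G)])).
  apply/subset_leq_card/subsetP => A /imsetP[G + ->]; rewrite !inE => /andP[/eqP Gm FG].
  by rewrite setSD ?edgesP //= cardsD (setIidPr FG) Gm.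
move=> G H; rewrite !inE => /andP[_ FG] /andP[_ FH] E; apply: val_inj => /=.
by rewrite -(setID (edges G) F) -(setID (edges H) F) (setIidPr FG) (setIidPr FH) E.
Qed.

(** One more prescribed pair contributes the factor $(m-f)/(M-f)$, which is at most $m/M$ because $m
    \le M$. *)
Lemma bin_ratio f : (f <= m)%N -> (m <= M)%N -> ('C(M - f, m - f) * M ^ f <= 'C(M, m) * m ^ f)%N.
Proof.
elim: f => [|f IH] fm mM; first by rewrite !subn0.
have := IH (ltnW fm) mM => {}IH.
have Mf : (0 < M - f)%N by rewrite subn_gt0 (leq_trans fm mM).
rewrite -(leq_pmul2l Mf) mulnA.
have -> : ((M - f) * 'C(M - f.+1, m - f.+1) = (m - f) * 'C(M - f, m - f))%N.
  have -> : (M - f.+1 = (M - f).-1)%N by rewrite subnS.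
  have -> : (m - f.+1 = (m - f).-1)%N by rewrite subnS.
  have mf : (0 < m - f)%N by rewrite subn_gt0.
  by rewrite mul_bin_diag prednK.
rewrite !expnS -mulnA [('C(_, _) * (M * _))%N]mulnCA mulnA.
apply: leq_trans (_ : (m - f) * M * ('C(M, m) * m ^ f) <= _)%N; first by rewrite leq_mul2l IH orbT.
rewrite [('C(M, m) * (m * _))%N]mulnCA [leqRHS]mulnA leq_mul2r; apply/orP; right.
by rewrite !mulnBl [(m * _)%N]mulnC leq_sub2l // leq_mul2l mM orbT.
Qed.

Lemma gnm_card : (m <= M)%N -> #|[set G : sgraph 'I_n | #|edges G| == m]| = 'C(M, m).
Proof.
move=> mM; rewrite -card_all_pairs -cards_draws.
rewrite -(card_imset (f := @edges 'I_n)); last exact: val_inj.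
apply: eq_card => A; rewrite inE; apply/imsetP/andP => [[G]|[AP Am]].
  by rewrite inE => Gm ->; rewrite edgesP.
by exists (graph_of A); rewrite ?inE edges_graph_of.
Qed.

Lemma gnm_sum : (m <= M)%N -> \sum_G mu G = 1.
Proof.
move=> mM; rewrite /random_gnm /uniform_graph -big_mkcond /= sumr_const.
rewrite -[_ *+ _]mulr_natr mulVf // pnatr_eq0 -lt0n.
have := gnm_card mM; rewrite cardsE => ->; by rewrite bin_gt0.
Qed.

Lemma gnm_ge0 G : 0 <= mu G.
Proof. by rewrite /random_gnm /uniform_graph; case: ifP => // _; rewrite invr_ge0 ler0n. Qed.

Lemma gnm_sparse (F : {set {set 'I_n}}) : (0 < m)%N -> (m <= M)%N ->
  graph_prob mu (fun G => F \subset edges G) <= (m%:R / M%:R) ^+ #|F|.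
Proof.
move=> m0 mM; have M0 : (0 < M)%N by exact: leq_trans mM.
have [FP|/subsetPn[e eF eP]] := boolP (F \subset all_pairs n); last first.
  rewrite /graph_prob big_pred0 ?exprn_ge0 ?divr_ge0 // => G; apply/negP => /subsetP/(_ _ eF).
  by move/(subsetP (edgesP G)); rewrite -/(all_pairs n) (negbTE eP).
have -> : graph_prob mu (fun G => F \subset edges G) =
    #|[set G : sgraph 'I_n | (#|edges G| == m) && (F \subset edges G)]|%:R / 'C(M, m)%:R.
  rewrite /graph_prob /random_gnm /uniform_graph -big_mkcondr /= sumr_const.
  rewrite -[_ *+ _]mulr_natl; congr (_ / _); last by have := gnm_card mM; rewrite cardsE => ->.
  by congr _%:R; rewrite cardsE; apply: eq_card => G; rewrite !unfold_in andbC.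
have C0 : 0 < 'C(M, m)%:R :> R by rewrite ltr0n bin_gt0.
have M0' : 0 < M%:R ^+ #|F| :> R by rewrite exprn_gt0 // ltr0n.
rewrite expr_div_n ler_pdivrMr // mulrAC ler_pdivlMr // -!natrX -!natrM ler_nat.
have [fm|mf] := leqP #|F| m; last first.
  rewrite (_ : [set G : sgraph 'I_n | _] = set0) ?cards0 //; apply/setP => G; rewrite !inE.
  apply/negP => /andP[/eqP Gm /subset_leq_card]; rewrite Gm leqNgt mf //.
rewrite [leqRHS]mulnC; apply: leq_trans (bin_ratio fm mM).
by rewrite leq_mul2r gnm_count ?orbT.
Qed.

End UniformEdges.

(** * Random regular graphs *)

Section Circulant.
Variable (n : nat).
Local Notation V := 'I_n.+1.

Lemma card_ord_interval a b : (b <= n.+1)%N -> #|[set z : V | (a <= z < b)%N]| = (b - a)%N.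
Proof.
move=> bn; have -> : #|[set z : V | (a <= z < b)%N]| = count (fun z => (a <= z < b)%N) (iota 0 n.+1).
  by rewrite -val_enum_ord count_map cardsE cardE size_filter -enumT.
have [ab|/ltnW ba] := leqP a b; last first.
  rewrite (eq_in_count (a2 := pred0)) ?count_pred0; first by apply/esym/eqP; rewrite subn_eq0.
  by move=> z _ /=; apply/negP => /andP[az zb]; have := leq_trans zb ba; rewrite ltnNge az.
have -> : iota 0 n.+1 = iota 0 a ++ iota a (b - a) ++ iota b (n.+1 - b).
  rewrite [in LHS](_ : n.+1 = a + ((b - a) + (n.+1 - b)))%N; last by lia.
  by rewrite !iotaD add0n subnKC.
rewrite !count_cat.
rewrite (@eq_in_count _ _ pred0 (iota 0 a)) => [|z]; last first.
  by rewrite mem_iota => /andP[_ za] /=; rewrite leqNgt za.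
rewrite (@eq_in_count _ _ predT (iota a (b - a))) => [|z]; last first.
  by rewrite mem_iota subnKC // => ->.
rewrite (@eq_in_count _ _ pred0 (iota b _)) => [|z]; last first.
  by rewrite mem_iota => /andP[bz _] /=; rewrite ltnNge bz andbF.
by rewrite !count_pred0 count_predT size_iota addn0.
Qed.

(** The connection set of a circulant graph on $\mathbb{Z}/(n+1)$: $\pm1,\dots,\pm\lfloor
    k/2\rfloor$ and, for odd $k$, the antipode $(n+1)/2$, where $n+1$ is even as $k(n+1)$ is. *)
Definition steps k : {set V} :=
  [set z : V | (1 <= z < k./2.+1)%N] :|: [set z : V | (n.+1 - k./2 <= z < n.+1)%N]
  :|: (if odd k then [set z : V | (n.+1./2 <= z < n.+1./2.+1)%N] else set0).

Lemma steps_card k : (k <= n)%N -> ~~ odd (k * n.+1) -> #|steps k| = k.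
Proof.
move=> kn par; have k2 := odd_double_half k; have n2 := odd_double_half n.+1.
rewrite cardsU (_ : _ :&: (if _ then _ else _) = set0) ?cards0 ?subn0; last first.
  case ok : (odd k) => /=; last by rewrite setI0.
  have on : odd n.+1 = false by move: par; rewrite oddM ok => /negbTE.
  apply/setP => z; rewrite !inE; apply/negP => /andP[/orP[]]; move: k2 n2; rewrite ok on; lia.
rewrite cardsU (_ : _ :&: [set z : V | (n.+1 - _ <= _ < _)%N] = set0) ?cards0 ?subn0; last first.
  by apply/setP => z; rewrite !inE; apply/negP => /andP[]; move: k2 n2; case: (odd k); case: (odd n.+1); lia.
rewrite !card_ord_interval //; last by move: k2 n2; lia.
case ok : (odd k) => /=; last by rewrite cards0; move: k2; rewrite ok; lia.
rewrite card_ord_interval; last by move: n2; lia.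
by move: k2; rewrite ok; lia.
Qed.

Lemma steps_sym k (z : V) : (k <= n)%N -> ~~ odd (k * n.+1) -> z \in steps k -> (- z) \in steps k /\ z != 0.
Proof.
move=> kn par; have k2 := odd_double_half k; have n2 := odd_double_half n.+1.
have nz : z != 0 -> val (- z) = (n.+1 - z)%N.
  move=> z0; rewrite /= modn_small //; have : (0 < z)%N by rewrite lt0n.
  by have := ltn_ord z; lia.
move=> zS; have z0 : z != 0.
  apply: contraTneq zS => ->; rewrite !inE /=; move: k2 n2.
  by case: (odd k) => /=; rewrite ?inE /=; lia.
split => //; move: zS; rewrite !inE nz //; have := ltn_ord z; have : (0 < z)%N by rewrite lt0n.
case ok : (odd k); rewrite ?inE ?nz //=; last by move: k2 n2; lia.
have on : odd n.+1 = false by move: par; rewrite oddM ok => /negbTE.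
by move: k2 n2; rewrite ok on; lia.
Qed.

Lemma regular_exists k : (k <= n)%N -> ~~ odd (k * n.+1) -> exists G : sgraph V, regular k G.
Proof.
move=> kn par; pose F := [set e in all_pairs n.+1 | [exists x : V, exists y : V, (e == [set x; y]) && (y - x \in steps k)]].
have FP : F \subset all_pairs n.+1 by apply/subsetP => e; rewrite inE => /andP[].
have kE := steps_card kn par.
exists (graph_of F); apply/forallP => x; rewrite -card_nbh; apply/eqP; rewrite -[RHS]kE.
rewrite -(card_imset _ (addIr (- x))); apply/eq_card => z.
apply/imsetP/idP => [[y + ->]|zS].
  rewrite inE /adj edges_graph_of // inE => /andP[_ /existsP[u /existsP[v /andP[/eqP/set2_eq E uv]]]].
  case: E => [[-> ->] //|[-> ->]].
  by have [+ _] := steps_sym kn par uv; rewrite opprB.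
exists (z + x); last by rewrite addrK.
have [_ z0] := steps_sym kn par zS.
rewrite inE /adj edges_graph_of // !inE finset.subsetT cards2 /=.
have -> /= : x != z + x by rewrite eq_sym -subr_eq0 addrK.
by apply/existsP; exists x; apply/existsP; exists (z + x); rewrite eqxx addrK.
Qed.

End Circulant.

(** * Switchings in regular graphs *)

Section Regular.
Variables (R : realType) (n k : nat).
Implicit Types (G : sgraph 'I_n) (F : {set {set 'I_n}}) (x y u v a : 'I_n).

Lemma degree_add G e a : e \in all_pairs n -> e \notin edges G ->
  degree (add_edge G e) a = (degree G a + (a \in e))%N.
Proof.
move=> eP eG; rewrite /degree edges_add //; case: (boolP (a \in e)) => ae.
  rewrite addn1 (cardsD1 e) !inE eqxx ae add1n; congr (_.+1).
  by apply: eq_card => b; rewrite !inE; case: (eqVneq b e) => //= ->; rewrite (negbTE eG).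
rewrite addn0; apply: eq_card => b; rewrite !inE.
by case: (eqVneq b e) => //= ->; rewrite (negbTE eG) (negbTE ae).
Qed.

Lemma degree_del G e a : e \in edges G -> (degree (del_edge G e) a + (a \in e) = degree G a)%N.
Proof.
move=> eG; rewrite /degree edges_del; case: (boolP (a \in e)) => ae.
  rewrite addn1 [in RHS](cardsD1 e) !inE eG ae add1n; congr (_.+1).
  by apply: eq_card => b; rewrite !inE andbA.
rewrite addn0; apply: eq_card => b; rewrite !inE.
by case: (eqVneq b e) => //= ->; rewrite (negbTE ae) andbF.
Qed.

Definition regular_over F : {set sgraph 'I_n} := [set G | regular k G && (F \subset edges G)].

Lemma mem_pairs2 x y : ([set x; y] \in all_pairs n) = (x != y).
Proof. by rewrite inE finset.subsetT cards2; case: (x == y). Qed.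

Section Switch.
Variables (F : {set {set 'I_n}}) (x y : 'I_n).
Hypotheses (xy : x != y) (eF : [set x; y] \notin F).

(** The conditions under which replacing $xy$ and $uv$ by $xu$ and $yv$ gives a simple graph that
    still contains [F]. *)
Definition switchable G u v :=
  [&& adj G u v, [set u; v] \notin [set x; y] |: F, u \notin [set x; y], v \notin [set x; y],
      ~~ adj G x u & ~~ adj G y v].

Definition switch G u v := add_edge (add_edge (del_edge (del_edge G [set x; y]) [set u; v]) [set x; u]) [set y; v].

(** The last equation recovers the graph from its switching and the pair $(u,v)$; it provides the
    injectivity in the double counting. *)
Lemma switch_spec G u v : G \in regular_over ([set x; y] |: F) -> switchable G u v ->
  [/\ switch G u v \in regular_over F, adj (switch G u v) x u, adj (switch G u v) y v &
      edges G = [set x; y] |: ([set u; v] |: (edges (switch G u v) :\ [set x; u] :\ [set y; v]))].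
Proof.
rewrite inE subUset sub1set => /andP[/forallP regG /andP[xyG FG]] /and5P[uv + ux vx /andP[xu yv]].
rewrite !inE negb_or => /andP[uvxy uvF].
move: ux vx; rewrite !inE !negb_or => /andP[ux uy] /andP[vx vy].
have uv' := adj_neq uv.
have xuP : [set x; u] \in all_pairs n by rewrite mem_pairs2 eq_sym.
have yvP : [set y; v] \in all_pairs n by rewrite mem_pairs2 eq_sym.
have yvxu : [set y; v] != [set x; u].
  by apply: contra_neq xy => /set2_eq[] [E1 E2]; [rewrite E1|rewrite E1 eqxx in uy].
have E1 : edges (switch G u v) = [set y; v] |: ([set x; u] |: (edges G :\ [set x; y] :\ [set u; v])).
  by rewrite /switch !edges_add // !edges_del.
split.
- apply/andP; split; last first.
    rewrite E1; apply/subsetP => a aF; rewrite !inE (subsetP FG _ aF) andbT.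
    rewrite (_ : a != _) 1?(_ : a != _) ?orbT //; by [apply: contraNneq eF => <-|apply: contraNneq uvF => <-].
  apply/forallP => a; have dG := eqP (regG a).
  have uvG' : [set u; v] \in edges (del_edge G [set x; y]) by rewrite edges_del !inE uvxy.
  have xuG' : [set x; u] \notin edges (del_edge (del_edge G [set x; y]) [set u; v]).
    by rewrite !edges_del !inE (negbTE (xu : [set x; u] \notin edges G)) !andbF.
  have yvG' : [set y; v] \notin edges (add_edge (del_edge (del_edge G [set x; y]) [set u; v]) [set x; u]).
    by rewrite edges_add // !edges_del !inE (negbTE (yv : [set y; v] \notin edges G)) !andbF orbF.
  rewrite /switch !degree_add // -dG -(degree_del a xyG) -(degree_del a uvG') !inE.
  move: xy ux uy vx vy uv'; rewrite -!addnA eqn_add2l.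
  have ne b c : b != c -> ~~ ((a == b) && (a == c)).
    by apply: contra => /andP[/eqP <- /eqP <-].
  move=> /ne + /ne + /ne + /ne + /ne + /ne.
  by case: (a == x); case: (a == y); case: (a == u); case: (a == v).
- by rewrite /adj E1 !inE eqxx ?orbT.
- by rewrite /adj E1 !inE eqxx.
rewrite E1; apply/setP => a; rewrite !inE.
case: (eqVneq a [set x; y]) => [->|_] //=; case: (eqVneq a [set u; v]) => [->|_] //=.
case: (eqVneq a [set y; v]) => [->|_] /=; first by rewrite (negbTE (yv : [set y; v] \notin edges G)).
by case: (eqVneq a [set x; u]) => [->|_] //=; rewrite (negbTE (xu : [set x; u] \notin edges G)).
Qed.

(** Of the $kn$ oriented edges $(u,v)$, at most two are lost for every pair of [F] and for $xy$, at
    most $4k$ because they meet $x$ or $y$, and at most $2k^2$ because $u$ is adjacent to $x$ or $v$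
    to $y$. *)
Lemma switchable_card G : G \in regular_over ([set x; y] |: F) ->
  (k * n - 2 * (#|F|).+1 - 4 * k - 2 * (k * k) <= #|[set p : 'I_n * 'I_n | switchable G p.1 p.2]|)%N.
Proof.
rewrite inE => /andP[/forallP regG FG].
have nbc a : #|nbh G a| = k by rewrite card_nbh; exact/eqP.
pose A := [set p : 'I_n * 'I_n | adj G p.1 p.2].
have Ac : #|A| = (k * n)%N.
  have -> : #|A| = \sum_(a : 'I_n) #|nbh G a|.
    rewrite -sum1_card (eq_bigl (fun p : 'I_n * 'I_n => xpredT p.1 && adj G p.1 p.2)) => [|p]; last by rewrite inE.
    rewrite -(pair_big_dep xpredT (fun a b => adj G a b) (fun _ _ => 1%N)) /=.
    by apply: eq_bigr => a _; rewrite sum1dep_card.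
  by rewrite (eq_bigr (fun=> k)) => [|a _ //]; rewrite sum_nat_const card_ord mulnC.
pose B1 := \bigcup_(e in [set x; y] |: F) [set p : 'I_n * 'I_n | [set p.1; p.2] == e].
have B1c : (#|B1| <= 2 * #|F|.+1)%N.
  apply: leq_trans (_ : \sum_(e in [set x; y] |: F) 2 <= _)%N; last first.
    by rewrite sum_nat_const mulnC leq_mul2l cardsU1 eF add1n leqnn.
  apply: leq_trans (_ : \sum_(e in [set x; y] |: F) #|[set p : 'I_n * 'I_n | [set p.1; p.2] == e]| <= _)%N.
    rewrite /B1; elim/big_rec2: _ => [|i m C _ IH]; first by rewrite cards0.
    by rewrite (leq_trans (leq_of_leqif (leq_card_setU _ _))) // leq_add2l.
  apply: leq_sum => e _; case: (pickP (fun p : 'I_n * 'I_n => [set p.1; p.2] == e)) => [[a b] /eqP eE|no].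
    rewrite (leq_trans (subset_leq_card (_ : _ \subset [set (a, b); (b, a)]))) ?cards2 ?ltnS ?leq_b1 //.
    apply/subsetP => -[c d]; rewrite !inE -eE /= => /eqP/set2_eq[] [-> ->]; rewrite eqxx ?orbT //.
  by rewrite (_ : [set p : _ | _] = set0) ?cards0 //; apply/setP => p; rewrite !inE no.
pose st a := [set (a, b) | b in nbh G a].
pose ts a := [set (b, a) | b in nbh G a].
have stc a : (#|st a| <= k)%N by rewrite (leq_trans (leq_imset_card _ _)) ?nbc.
have tsc a : (#|ts a| <= k)%N by rewrite (leq_trans (leq_imset_card _ _)) ?nbc.
pose B2 := (st x :|: st y) :|: (ts x :|: ts y).
have U2 (I : finType) (C D : {set I}) c d : (#|C| <= c)%N -> (#|D| <= d)%N -> (#|C :|: D| <= c + d)%N.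
  by move=> Cc Dd; rewrite (leq_trans (leq_of_leqif (leq_card_setU _ _))) // leq_add.
have B2c : (#|B2| <= (k + k) + (k + k))%N by apply: (@U2); apply: (@U2).
have bigc (f : 'I_n -> {set 'I_n * 'I_n}) a : (forall b, #|f b| <= k)%N -> (#|\bigcup_(b in nbh G a) f b| <= k * k)%N.
  move=> fk; rewrite -{1}(nbc a) -sum_nat_const; apply: leq_trans (_ : \sum_(b in nbh G a) #|f b| <= _)%N.
    elim/big_rec2: _ => [|i m C _ IH]; first by rewrite cards0.
    by rewrite (leq_trans (leq_of_leqif (leq_card_setU _ _))) // leq_add2l.
  exact: leq_sum.
pose B3 := (\bigcup_(b in nbh G x) st b) :|: (\bigcup_(b in nbh G y) ts b).
have B3c : (#|B3| <= k * k + k * k)%N by apply: (@U2); apply: (@bigc).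
have : (#|A| <= #|[set p : 'I_n * 'I_n | switchable G p.1 p.2]| + (#|B1| + (#|B2| + #|B3|)))%N.
  apply: leq_trans (_ : #|[set p : 'I_n * 'I_n | switchable G p.1 p.2] :|: (B1 :|: (B2 :|: B3))| <= _)%N.
    apply/subset_leq_card/subsetP => -[u v]; rewrite inE /= => uv.
    have vu : adj G v u by rewrite adjC.
    rewrite inE; apply/orP; case: (boolP (switchable G u v)) => [|ns]; first by left; rewrite inE.
    right; move: ns; rewrite /switchable uv /= !negb_and !negbK => /or4P[h|h|h|h].
    - by rewrite inE; apply/orP; left; apply/bigcupP; exists [set u; v]; rewrite // inE.
    - rewrite inE; apply/orP; right; rewrite inE; apply/orP; left; rewrite inE; apply/orP; left.
      by case/set2P: h uv vu => -> uv vu; rewrite inE imset_f ?orbT // inE.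
    - rewrite inE; apply/orP; right; rewrite inE; apply/orP; left; rewrite inE; apply/orP; right.
      by case/set2P: h uv vu => -> uv vu; rewrite inE imset_f ?orbT // inE.
    rewrite inE; apply/orP; right; rewrite inE; apply/orP; right; rewrite inE; apply/orP.
    by case/orP: h => h; [left|right]; apply/bigcupP; [exists u|exists v]; rewrite ?inE // imset_f // inE.
  do 3![apply: (leq_trans (leq_of_leqif (leq_card_setU _ _))); rewrite leq_add2l].
  by [].
by rewrite Ac; move: B1c B2c B3c; lia.
Qed.

(** Double counting: after the switching $u$ is a neighbour of $x$ and $v$ one of $y$, so a given
    graph arises at most $k^2$ times. *)
Lemma switch_count :
  (#|regular_over ([set x; y] |: F)| * (k * n - 2 * (#|F|).+1 - 4 * k - 2 * (k * k)) <= k * k * #|regular_over F|)%N.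
Proof.
pose Sw := [set t : sgraph 'I_n * ('I_n * 'I_n) | (t.1 \in regular_over ([set x; y] |: F)) && switchable t.1 t.2.1 t.2.2].
apply: leq_trans (_ : #|Sw| <= _)%N.
  rewrite -sum_nat_const; apply: leq_trans (_ : \sum_(G in regular_over ([set x; y] |: F)) #|[set p : 'I_n * 'I_n | switchable G p.1 p.2]| <= _)%N.
    by apply: leq_sum => G; exact: switchable_card.
  rewrite -[leqRHS]sum1_card (eq_bigl (fun t : sgraph 'I_n * ('I_n * 'I_n) => (t.1 \in regular_over ([set x; y] |: F)) && switchable t.1 t.2.1 t.2.2)) => [|t]; last by rewrite inE.
  rewrite -(pair_big_dep (mem (regular_over ([set x; y] |: F))) (fun G (p : 'I_n * 'I_n) => switchable G p.1 p.2) (fun _ _ => 1%N)) /=.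
  by apply: eq_leq; apply: eq_bigr => G _; rewrite sum1dep_card.
pose Ta := [set t : sgraph 'I_n * ('I_n * 'I_n) | (t.1 \in regular_over F) && ((t.2.1 \in nbh t.1 x) && (t.2.2 \in nbh t.1 y))].
apply: leq_trans (_ : #|Ta| <= _)%N; last first.
  rewrite mulnC -sum_nat_const -sum1_card (eq_bigl (fun t : sgraph 'I_n * ('I_n * 'I_n) => (t.1 \in regular_over F) && ((t.2.1 \in nbh t.1 x) && (t.2.2 \in nbh t.1 y)))) => [|t]; last by rewrite inE.
  rewrite -(pair_big_dep (mem (regular_over F)) (fun G (p : 'I_n * 'I_n) => (p.1 \in nbh G x) && (p.2 \in nbh G y)) (fun _ _ => 1%N)) /=.
  apply: leq_sum => G; rewrite inE => /andP[/forallP regG _].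
  rewrite -(pair_big (mem (nbh G x)) (mem (nbh G y)) (fun _ _ => 1%N)) /= sum_nat_const sum1_card !card_nbh.
  by rewrite (eqP (regG x)) (eqP (regG y)).
rewrite -(card_in_imset (f := fun t : sgraph 'I_n * ('I_n * 'I_n) => (switch t.1 t.2.1 t.2.2, t.2)) (D := mem Sw)).
  apply/subset_leq_card/subsetP => t /imsetP[[G [u v]] + ->]; rewrite [_ \in mem Sw]inE /= => /andP[regG sw].
  by have [regS xu yv _] := switch_spec regG sw; rewrite [_ \in Ta]inE /= regS !inE xu yv.
move=> [G [u v]] [H [u' v']]; rewrite [_ \in mem Sw]inE /= => /andP[regG swG].
rewrite [_ \in mem Sw]inE /= => /andP[regH swH] [E Eu Ev]; rewrite -Eu -Ev in swH E *.
have [_ _ _ EG] := switch_spec regG swG; have [_ _ _ EH] := switch_spec regH swH.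
have EE : edges G = edges H.
  rewrite EH.
  rewrite -E.
  exact: EG.
suff -> : G = H by [].
exact: val_inj EE.
Qed.

End Switch.

Lemma regular_edges G : regular k G -> (2 * #|edges G| = k * n)%N.
Proof.
move=> /forallP regG; have := sum_degree_in G [set: 'I_n].
have -> : edges_in G [set: 'I_n] = edges G by apply/setP => e; rewrite inE finset.subsetT andbT.
move=> <-; rewrite (eq_bigr (fun=> k)) => [|a _]; last by rewrite setIT card_nbh (eqP (regG a)).
by rewrite sum_nat_const cardsT card_ord mulnC.
Qed.

Local Notation mu := (random_regular R k (n := n)).
Local Notation N F := (#|regular_over F|).

Lemma regular_sum : (0 < #|[set G : sgraph 'I_n | regular k G]|)%N -> \sum_G mu G = 1.
Proof.
move=> N0; rewrite /random_regular /uniform_graph -big_mkcond /= sumr_const.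
by rewrite -[_ *+ _]mulr_natr mulVf // pnatr_eq0 -lt0n -cardsE.
Qed.

Lemma regular_ge0 G : 0 <= mu G.
Proof. by rewrite /random_regular /uniform_graph; case: ifP => // _; rewrite invr_ge0 ler0n. Qed.

Lemma regular_probE F :
  graph_prob mu (fun G => F \subset edges G) = (N F)%:R / (#|[set G : sgraph 'I_n | regular k G]|)%:R.
Proof.
rewrite /graph_prob /random_regular /uniform_graph -big_mkcondr /= sumr_const.
rewrite -[_ *+ _]mulr_natl; congr (_ / _); last by rewrite cardsE.
by congr _%:R; rewrite cardsE; apply: eq_card => G; rewrite !unfold_in andbC.
Qed.

(** The pairs of [F] are removed one by one. By [switch_count] a removal with $f$ pairs left gains a
    factor $k^2/(2(M-f))$, as the condition on [M] leaves at least $2(M-f)$ switchings. *)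
Lemma regular_count M F : (2 * M + 2 + 4 * k + 2 * (k * k) <= k * n)%N ->
  (#|F| <= M)%N -> (N F * (2 ^ #|F| * M ^_ #|F|) <= (k * k) ^ #|F| * N set0)%N.
Proof.
move=> Mk; have [j] := ubnP #|F|; elim: j F => // j IH F Fj FM.
have [->|[e eF]] := set_0Vmem F; first by rewrite cards0 !expn0 ffactn0 mul1n muln1 mul1n.
have FeM : (#|F :\ e| < M)%N by apply: leq_trans FM; rewrite [leqRHS](cardsD1 e) eF.
have Fe : #|F| = (#|F :\ e|).+1 by rewrite (cardsD1 e) eF.
have {}IH := IH (F :\ e) _ (ltnW FeM); rewrite -ltnS -Fe in IH; have {}IH := IH Fj.
have FE : e |: (F :\ e) = F by rewrite setD1K.
have [eP|eP] := boolP (e \in all_pairs n); last first.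
  rewrite (_ : regular_over F = set0) ?cards0 ?mul0n //; apply/setP => G; rewrite !inE.
  apply/negP => /andP[_ /subsetP/(_ _ eF)] /(subsetP (edgesP G)).
  by rewrite -/(all_pairs n) (negbTE eP).
move: (eP); rewrite inE => /andP[_ /cards2P[x [y [xy eE]]]].
have step := @switch_count (F :\ e) x y xy; rewrite -eE FE in step.
have {}step := step (negbT (setD11 e F)).
rewrite Fe; set f := #|F :\ e| in FeM IH step *.
have le : (2 * (M - f) <= k * n - 2 * f.+1 - 4 * k - 2 * (k * k))%N by move: Mk FeM; lia.
rewrite ffactnSr !expnS.
have -> : (N F * (2 * 2 ^ f * (M ^_ f * (M - f))) = (N F * (2 * (M - f))) * (2 ^ f * M ^_ f))%N by lia.
apply: leq_trans (leq_mul (leq_trans (leq_mul (leqnn _) le) step) (leqnn _)) _.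
by rewrite -!mulnA [(k * (k * _))%N]mulnA [leqRHS]mulnA leq_mul2l IH orbT.
Qed.

(** $f^f \le (2f)(2f-1)\cdots(f+1) = \binom{2f}{f} f!$. *)
Lemma expn_fact f : (f ^ f <= 4 ^ f * f`!)%N.
Proof.
have c4 : ('C(f + f, f) <= 4 ^ f)%N.
  have -> : (4 ^ f = (1 + 1) ^ (f + f))%N by rewrite expnD -expnMn.
  rewrite Pascal; have lt : (f < (f + f).+1)%N by rewrite ltnS leq_addl.
  rewrite (bigD1 (Ordinal lt)) //= !exp1n !muln1.
  exact: leq_addr.
apply: leq_trans (leq_mul c4 (leqnn _)); rewrite bin_ffact ffact_prod.
have -> : (f ^ f = \prod_(i < f) f)%N by rewrite prod_nat_const card_ord.
apply: leq_prod => i _.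
by have := ltn_ord i; lia.
Qed.

Lemma expn_ffact M f : (f <= M)%N -> (M ^ f <= 4 ^ f * M ^_ f)%N.
Proof.
move=> fM; have [->|f0] := posnP f; first by rewrite !expn0 ffactn0.
have le : (M ^ f * f`! <= f ^ f * M ^_ f)%N.
  have E c : (c ^ f = \prod_(i < f) c)%N by rewrite prod_nat_const card_ord.
  rewrite -ffactnn !ffact_prod !E -!big_split.
  apply: leq_prod => i _ /=; have := ltn_ord i; rewrite !mulnBr => il.
  by rewrite [(f * M)%N]mulnC leq_sub2l // leq_mul2r fM orbT.
have f1 : (0 < f`!)%N by exact: fact_gt0.
rewrite -(leq_pmul2r f1) (leq_trans le) // mulnAC leq_mul2r; apply/orP; right.
exact: expn_fact.
Qed.

(** Up to $|F| = M$ the count by switchings applies. A larger [F] with at most $kn/2$ pairs exceeds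
    [M] by at most $4k^2$; it is cut down to [M] pairs, and doubling the base of the power pays for
    the missing factors, each at least $1/n$, by $n^{4k^2} \le 2^M$. *)
Lemma regular_sparse M F : (0 < k)%N -> (0 < #|[set G : sgraph 'I_n | regular k G]|)%N ->
  (0 < M)%N -> (2 * M + 2 + 4 * k + 2 * (k * k) <= k * n)%N ->
  (k * n <= 2 * M + 8 * (k * k))%N -> (n ^ (4 * (k * k)) <= 2 ^ M)%N ->
  graph_prob mu (fun G => F \subset edges G) <= (4 * (k * k)%:R / M%:R) ^+ #|F|.
Proof.
move=> k0 N0 M0 Mk kM nM.
pose q : R := 2 * (k * k)%:R / M%:R.
have M0' : 0 < M%:R :> R by rewrite ltr0n.
have q0 : 0 <= q by rewrite divr_ge0 ?mulr_ge0.
have small F' : (#|F'| <= M)%N -> graph_prob mu (fun G => F' \subset edges G) <= q ^+ #|F'|.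
  move=> FM; rewrite regular_probE ler_pdivrMr ?ltr0n // /q expr_div_n mulrAC ler_pdivlMr ?exprn_gt0 //.
  rewrite -natrM -!natrX -!natrM ler_nat.
  have -> : [set G : sgraph 'I_n | regular k G] = regular_over set0.
    by apply/setP => G; rewrite !inE sub0set andbT.
  have := regular_count Mk FM; rewrite -(leq_pmul2l (expn_gt0 4 #|F'|)) => le.
  apply: leq_trans (leq_mul (leqnn _) (expn_ffact FM)) _.
  rewrite -(leq_pmul2l (expn_gt0 2 #|F'|)).
  have -> : (2 ^ #|F'| * (N F' * (4 ^ #|F'| * M ^_ #|F'|)) = 4 ^ #|F'| * (N F' * (2 ^ #|F'| * M ^_ #|F'|)))%N by lia.
  apply: leq_trans le _; by rewrite -[4%N]/(2 * 2)%N !expnMn -!mulnA.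
have -> : 4 * (k * k)%:R / M%:R = 2 * q by rewrite /q; ring.
have [FM|MF] := leqP #|F| M.
  by apply: le_trans (small _ FM) _; rewrite lerXn2r ?nnegrE ?mulr_ge0 // ler_peMl // ler1n.
have [kF|Fk] := ltnP (k * n) (2 * #|F|).
  rewrite /graph_prob big1 ?exprn_ge0 ?mulr_ge0 // => G FG.
  rewrite /random_regular /uniform_graph; case: ifP => // /regular_edges E.
  by have := subset_leq_card FG; move: E kF; lia.
pose F' := [set x in take M (enum F)].
have F'F : F' \subset F by apply/subsetP => x; rewrite inE => /mem_take; rewrite mem_enum.
have F'c : #|F'| = M.
  by rewrite cardsE (card_uniqP (take_uniq _ (enum_uniq _))) size_takel // -cardE ltnW.
apply: le_trans (_ : q ^+ M <= _).
  rewrite -{1}F'c; apply: le_trans (small F' _); last by rewrite F'c.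
  apply: graph_prob_le => [|G FG]; [exact: regular_ge0|exact: subset_trans F'F FG].
have -> : (2 * q) ^+ #|F| = q ^+ M * (2 ^+ #|F| * q ^+ (#|F| - M)).
  by rewrite [RHS]mulrCA -exprD subnKC ?exprMn // ltnW.
rewrite ler_peMr ?exprn_ge0 //.
have n0 : (0 < n)%N by case: (n) Mk => //; rewrite muln0; lia.
have qn : n%:R^-1 <= q.
  rewrite /q ler_pdivlMr // mulrC ler_pdivrMr ?ltr0n // -!natrM ler_nat.
  by move: Mk k0 n0; nia.
have qj : n%:R^-1 ^+ (#|F| - M) <= q ^+ (#|F| - M) by rewrite lerXn2r ?nnegrE ?invr_ge0.
apply: le_trans (ler_pM _ _ (lexx (2 ^+ #|F|)) qj); rewrite ?exprn_ge0 ?invr_ge0 //.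
rewrite exprVn ler_pdivlMr ?exprn_gt0 ?ltr0n // mul1r -!natrX ler_nat.
apply: leq_trans (_ : n ^ (4 * (k * k)) <= _)%N.
  by rewrite leq_pexp2l //; move: kM Fk; lia.
by apply: leq_trans nM _; rewrite leq_pexp2l // ltnW.
Qed.

End Regular.

(** * A dense part of the binomial random graph *)

Section Strategy.
Variables (R : realType) (n : nat) (p : R).
Hypothesis p01 : 0 <= p <= 1.
Local Notation mu := (random_gnp p (n := n)).
Local Notation avg := (@mean R n p).

Variables (S : Type) (ask : S -> option {set 'I_n}) (upd : S -> bool -> S)
  (asked : S -> {set {set 'I_n}}) (valid : S -> Prop) (phi : S -> R).

Definition answer (G : sgraph 'I_n) s := if ask s is Some e then e \in edges G else false.

Fixpoint play k s (G : sgraph 'I_n) : S := if k is k'.+1 then play k' (upd s (answer G s)) G else s.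

Hypothesis ask_spec : forall s e, valid s -> ask s = Some e ->
  [/\ e \in all_pairs n, e \notin asked s & forall b, valid (upd s b) /\ asked (upd s b) = e |: asked s].
Hypothesis wait_spec : forall s, valid s -> ask s = None ->
  [/\ valid (upd s false), asked s \subset asked (upd s false) & phi (upd s false) = phi s].
Hypothesis phi_spec : forall s e, valid s -> ask s = Some e ->
  exists w : bool, forall b : bool, phi (upd s b) = phi s + w%:R * (b%:R - p).

(** A pair is asked at most once, so after its question the run no longer depends on it; this allows
    the use of [mean_edge] below. *)
Lemma play_asked k s e G : valid s -> e \in asked s -> e \in all_pairs n ->
  play k s (add_edge G e) = play k s (del_edge G e).
Proof.
move=> + + eP; elim: k s => //= k IH s vs es.
case E : (ask s) => [a|]; rewrite /answer E.
  have [aP aS vA] := ask_spec vs E; have ae : a != e by apply: contraNneq aS => ->.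
  rewrite edges_add // edges_del !inE (negbTE ae) /=; have [vb ab] := vA (a \in edges G).
  by apply: IH; rewrite // ab !inE es orbT.
by have [vb ab _] := wait_spec vs E; apply: IH; rewrite // (subsetP ab).
Qed.

Lemma meanD f g : avg (fun G => f G + g G) = avg f + avg g.
Proof. by rewrite /mean -big_split; apply: eq_bigr => G _; rewrite mulrDr. Qed.

Lemma mean_cst c : avg (fun=> c) = c.
Proof. by rewrite /mean -mulr_suml mean1 mul1r. Qed.

(* [phi] is a martingale whose increments have variance at most [p]. *)
Lemma mean_play_sqr k s : valid s -> avg (fun G => phi (play k s G) ^+ 2) <= phi s ^+ 2 + k%:R * p.
Proof.
have /andP[p0 p1] := p01.
elim: k s => [|k IH] s vs; first by rewrite [X in X <= _](mean_cst (phi s ^+ 2)) mul0r addr0.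
case E : (ask s) => [e|]; last first.
  have [vb ab pb] := wait_spec vs E.
  have -> : avg (fun G => phi (play k.+1 s G) ^+ 2) = avg (fun G => phi (play k (upd s false) G) ^+ 2).
    by apply: eq_bigr => G _; rewrite /= /answer E.
  apply: le_trans (IH _ vb) _; rewrite pb lerD2l ler_wpM2r // ler_nat //.
have [eP eS vA] := ask_spec vs E; have [w wE] := phi_spec vs E.
(* The run continues from one of two states; the continuation from either of them is independent of
   the pair [e] just asked. *)
pose f b (G : sgraph 'I_n) := phi (play k (upd s b) G) ^+ 2.
have fe b : avg (fun G => (e \in edges G)%:R * f b G) = p * avg (f b).
  apply: mean_edge => // G; rewrite /f; have [vb ab] := vA b.
  by rewrite play_asked // ab setU11.
have -> : avg (fun G => phi (play k.+1 s G) ^+ 2) =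
    avg (fun G => (e \in edges G)%:R * f true G + (f false G + (-1) * ((e \in edges G)%:R * f false G))).
  apply: eq_bigr => G _; congr (_ * _); rewrite /= /answer E /f.
  by case: (e \in edges G); rewrite /= ?mul1r ?mul0r ?mulr0 ?addr0 ?add0r ?mulN1r ?subrr ?addr0.
rewrite !meanD fe.
have -> : avg (fun G => -1 * ((e \in edges G)%:R * f false G)) = - (p * avg (f false)).
  rewrite -fe /mean -sumrN; apply: eq_bigr => G _; ring.
have b1 := IH _ (vA true).1; have b0 := IH _ (vA false).1.
rewrite -/(f true) -/(f false) !wE in b1 b0.
have q0 : 0 <= 1 - p by rewrite subr_ge0.
have h1 := ler_wpM2l p0 b1; have h0 := ler_wpM2l q0 b0.
have w2 : (w%:R : R) ^+ 2 * (p * (1 - p)) <= p.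
  have : p * (1 - p) <= p by rewrite ler_piMr // lerBlDr lerDl.
  have : 0 <= p * (1 - p) by rewrite mulr_ge0.
  by case: (w); rewrite ?expr1n ?mul1r // expr0n mul0r.
have kE : k.+1%:R = k%:R + 1 :> R by rewrite natr1.
rewrite kE; move: h1 h0 w2; rewrite /= => h1 h0 w2.
have : p * avg (f true) + (1 - p) * avg (f false) <=
    phi s ^+ 2 + w%:R ^+ 2 * (p * (1 - p)) + k%:R * p.
  apply: le_trans (lerD h1 h0) _; rewrite le_eqVlt; apply/orP; left; apply/eqP; ring.
lra.
Qed.

(** Chebyshev's inequality for the martingale. *)
Lemma prob_play_large k s (lam : R) : 0 < lam -> valid s -> phi s = 0 ->
  graph_prob mu (fun G => lam <= `|phi (play k s G)|) <= k%:R * p / lam ^+ 2.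
Proof.
move=> l0 vs p0; have := mean_play_sqr k vs; rewrite p0 expr0n add0r => le.
rewrite ler_pdivlMr ?exprn_gt0 //; apply: le_trans le.
rewrite /graph_prob mulr_suml big_mkcond /=; apply: ler_sum => G _.
case: ifP => [lp|_]; last by rewrite mulr_ge0 ?gnp_ge0 // sqr_ge0.
rewrite ler_wpM2l ?gnp_ge0 //.
by rewrite -[leRHS]real_normK ?num_real // lerXn2r ?nnegrE // ltW.
Qed.

End Strategy.

(** * A search that leaves the pairs of waiting vertices unqueried *)

Section Exploration.
Variables (n K h : nat).
Hypothesis Khn : (K + h < n)%N.
Hypothesis K0 : (0 < K)%N.
Local Notation V := 'I_n.

(* State of a graph search that stops after [K] vertices or once [h] vertices *)
(* are waiting, and then queries all pairs of waiting vertices.               *)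
Record search := Search {
  fin : bool; done_ : {set V}; cur : V; todo : {set V}; active : {set V}; comp : {set V};
  pending : {set {set V}}; seen : {set {set V}};
  qb : nat; pb : nat; qf : nat; pf : nat }.

Definition unseen s : {set V} := ~: (cur s |: (done_ s :|: active s)).

Definition pick_in (U : finType) (A : {set U}) : option U := [pick x in A].

Lemma pick_in_some (U : finType) (A : {set U}) x : pick_in A = Some x -> x \in A.
Proof. by rewrite /pick_in; case: pickP => // y yA [<-]. Qed.

Lemma pick_in_none (U : finType) (A : {set U}) : pick_in A = None -> A = set0.
Proof. by rewrite /pick_in; case: pickP => // A0 _; apply/setP => x; rewrite inE; exact: A0. Qed.

Definition ask s : option {set V} :=
  if fin s then pick_in (pending s)
  else if pick_in (todo s) is Some v then Some [set cur s; v] else None.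

(** During the search [qb] counts questions and [pb] positive answers; [qf] and [pf] do so for the
    pairs of waiting vertices afterwards. [comp] is the explored part of the current component,
    restarted at a new root when no vertex waits. *)
Definition upd s (b : bool) : search :=
  if fin s then
    if pick_in (pending s) is Some e then
      Search true (done_ s) (cur s) (todo s) (active s) (comp s) (pending s :\ e) (e |: seen s)
        (qb s) (pb s) (qf s).+1 (pf s + b)
    else s
  else if pick_in (todo s) is Some v then
    Search false (done_ s) (cur s) (todo s :\ v) (if b then v |: active s else active s)
      (if b then v |: comp s else comp s) set0 ([set cur s; v] |: seen s) (qb s).+1 (pb s + b) 0 0
  else if (h <= #|active s|)%N || (K <= #|done_ s|.+1)%N then
    Search true (done_ s) (cur s) (todo s) (active s) (comp s) (pairs (active s)) (seen s)
      (qb s) (pb s) 0 0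
  else if pick_in (active s) is Some u then
    Search false (cur s |: done_ s) u (unseen s) (active s :\ u) (comp s) set0 (seen s) (qb s) (pb s) 0 0
  else if pick_in (unseen s) is Some u then
    Search false (cur s |: done_ s) u (unseen s :\ u) set0 [set u] set0 (seen s) (qb s) (pb s) 0 0
  else s.

(** A positive answer makes a vertex wait, whence the bound on [pb]. Every vertex is compared with
    all vertices unseen at that time, at least $n - K - h$ of them, whence the bound on [qb]. A
    question asked in the search contains a finished or the current vertex, so the pairs of waiting
    vertices are new. *)
Definition valid s : Prop :=
  [/\ cur s \notin done_ s, cur s \notin active s, [disjoint done_ s & active s], (#|done_ s| < K)%N
    & (pb s <= #|done_ s| + #|active s|)%N] /\
  (if fin s then
     [/\ pending s \subset pairs (active s), [disjoint pending s & seen s],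
         (qf s + #|pending s| = #|pairs (active s)|)%N &
         (h <= #|active s|)%N \/ (K <= #|done_ s|.+1)%N /\ ((#|done_ s|.+1) * (n - K - h) <= qb s)%N]
   else
     [/\ todo s \subset unseen s,
         forall e, e \in seen s -> (exists2 a, a \in done_ s & a \in e) \/
           (exists2 v, e = [set cur s; v] & v \notin todo s),
         (#|done_ s|.+1 * (n - K - h) <= qb s + #|todo s|)%N & qf s = 0%N /\ pf s = 0%N]).

Lemma unseenP s v : v \in unseen s = [&& v != cur s, v \notin done_ s & v \notin active s].
Proof. by rewrite !inE !negb_or. Qed.

Lemma unseen_card s : cur s \notin done_ s -> cur s \notin active s -> [disjoint done_ s & active s] ->
  (#|unseen s| + (1 + (#|done_ s| + #|active s|)) = n)%N.
Proof.
move=> cd ca da; rewrite -[RHS](card_ord n) -(cardsC (unseen s)) /unseen setCK; congr (_ + _)%N.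
rewrite cardsU1 inE negb_or cd ca cardsU (_ : _ :&: _ = set0) ?cards0 ?subn0 //.
by apply/eqP; rewrite setI_eq0.
Qed.

Lemma set2_inj x u v : [set x; u] = [set x; v] :> {set V} -> u = v.
Proof. by case/set2_eq => [[]|[-> ->]]. Qed.

Lemma todo_unasked s v : valid s -> fin s = false -> v \in todo s ->
  v \in unseen s /\ [set cur s; v] \notin seen s.
Proof.
case=> [[cd _ _ _ _]] + fs; rewrite fs => -[tu sn _ _] vt; have vu := subsetP tu _ vt; split => //.
have := vu; rewrite unseenP => /and3P[vc vd va].
apply/negP => /sn[[a ad]|[w /set2_inj wv]]; last by rewrite -wv vt.
by rewrite !inE => /orP[]/eqP E; move: ad; rewrite E; [rewrite (negbTE cd)|rewrite (negbTE vd)].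
Qed.

Lemma ask_valid s e : valid s -> ask s = Some e ->
  [/\ e \in all_pairs n, e \notin seen s & forall b, valid (upd s b) /\ seen (upd s b) = e |: seen s].
Proof.
move=> vs; have [[cd ca da dK pbs]] := vs; rewrite /ask /upd; case fs : (fin s).
  move=> [pp ps qp qq] E; have ep := pick_in_some E.
  have es : e \notin seen s by rewrite (disjointFr ps ep).
  split => //; first by have := subsetP pp _ ep; rewrite !inE finset.subsetT => /andP[_ ->].
  move=> b; rewrite E; split => //; split => //=; split => //.
  - exact: subset_trans (subsetDl _ _) pp.
  - apply/pred0P => a; rewrite /= !inE; apply/negP => /andP[/andP[ae ap] /orP[|as_]].
      by rewrite (negbTE ae).
    by rewrite (disjointFr ps ap) in as_.
  - by rewrite -qp (cardsD1 e (pending s)) ep addSnnS add1n.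
move=> [tu sn qt q0]; case E : (pick_in (todo s)) => [v|] // [<-].
have vt := pick_in_some E; have [vu es] := todo_unasked vs fs vt.
have := vu; rewrite unseenP => /and3P[vc vd va].
split => //; first by rewrite mem_pairs2 eq_sym.
move=> b; split => //; split => /=.
  split => //.
  - by case: b; rewrite // !inE negb_or ca eq_sym vc.
  - case: b => //; apply/pred0P => a; rewrite /= !inE; apply/negP => /andP[ad /orP[/eqP av|aa]].
      by rewrite av (negbTE vd) in ad.
    by rewrite (disjointFr da ad) in aa.
  - case: b => /=; last by rewrite addn0.
    by rewrite cardsU1 va addn1 add1n addnS ltnS.
split => //.
- apply/subsetP => a; rewrite in_setD1 => /andP[av /(subsetP tu)].
  rewrite !unseenP /= => /and3P[-> -> aa]; case: b => //=.
  by rewrite !inE negb_or av aa.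
- move=> a; rewrite in_setU1 => /orP[/eqP ->|/sn[[c cdn ca']|[w -> wt]]].
  + by right; exists v; rewrite // !inE eqxx.
  + by left; exists c.
  + by right; exists w; rewrite // !inE (negbTE wt) andbF.
- by rewrite addSn -addnS (leq_trans qt) // leq_add2l (cardsD1 v (todo s)) vt.
Qed.

Lemma wait_valid s : valid s -> ask s = None -> valid (upd s false) /\ seen (upd s false) = seen s.
Proof.
move=> vs; have [[cd ca da dK pbs]] := vs; rewrite /ask /upd; case fs : (fin s).
  by move=> _ E; rewrite E.
move=> [tu sn qt q0]; case E : (pick_in (todo s)) => [v|] // _.
have t0 := pick_in_none E; rewrite t0 cards0 addn0 in qt.
case: ifPn => [stop|]; first split => //.
  split => //=; split => //.
  - apply/pred0P => e /=; apply/negP => /andP[]; rewrite inE => /andP[/subsetP ea _] /sn[[a ad ae]|[v eE _]].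
      by have := ea _ ae; rewrite (disjointFr da ad).
    by have := ea (cur s); rewrite eE !inE eqxx (negbTE ca) => /(_ isT).
  - by case/orP: stop; [left|right].
rewrite negb_or -!ltnNge => /andP[ah dK1].
have uc := unseen_card cd ca da.
have uM : (n - K - h <= #|unseen s|)%N by move: ah dK1 uc; lia.
case Eu : (pick_in (active s)) => [u|].
  have ua := pick_in_some Eu.
  have ucr : u != cur s by apply: contraNneq ca => <-.
  have ud : u \notin done_ s by rewrite (disjointFl da ua).
  split => //; split => /=.
    split => //.
    - by rewrite !inE negb_or ucr ud.
    - by rewrite !inE eqxx.
    - apply/pred0P => a; rewrite /= !inE; apply/negP => /andP[/orP[/eqP ->|ad] /andP[_ aa]].
        by rewrite aa in ca.
      by rewrite (disjointFr da ad) in aa.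
    - by rewrite cardsU1 cd.
    - by rewrite cardsU1 cd add1n addSnnS (leq_trans pbs) // leq_add2l (cardsD1 u (active s)) ua.
  split => //.
  - apply/subsetP => a; rewrite !unseenP /= => /and3P[ac ad aa]; rewrite !inE !negb_or ac ad (negbTE aa) andbF /= andbT.
    by apply: contraNneq aa => ->.
  - move=> e /sn[[a ad ae]|[v -> _]]; left; first by exists a; rewrite // !inE ad orbT.
    by exists (cur s); rewrite !inE eqxx.
  - by rewrite cardsU1 cd add1n mulSn addnC leq_add.
have a0 := pick_in_none Eu; case Ev : (pick_in (unseen s)) => [u|] //.
have := pick_in_some Ev => uu; have := uu; rewrite unseenP => /and3P[ucr ud _].
split => //; split => /=.
  split => //.
  - by rewrite !inE negb_or ucr ud.
  - by rewrite inE.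
  - by rewrite -setI_eq0 setI0.
  - by rewrite cardsU1 cd.
  - by rewrite cardsU1 cd cards0 add1n addn0 (leq_trans pbs) // a0 cards0 addn0.
split => //.
- apply/subsetP => a; rewrite in_setD1 !unseenP /= => /andP[au /and3P[ac ad aa]].
  by rewrite !inE !negb_or au ac ad.
- move=> e /sn[[a ad ae]|[v -> _]]; left; first by exists a; rewrite // !inE ad orbT.
  by exists (cur s); rewrite !inE eqxx.
- rewrite cardsU1 cd add1n mulSn addnC leq_add //.
  have c : #|unseen s| = #|unseen s :\ u|.+1 by rewrite (cardsD1 u (unseen s)) uu.
  rewrite a0 cards0 addn0 c in uc; move: uc dK1; move: #|_ :\ _| #|done_ s| => x y; lia.
Qed.

Lemma card_gain (U : finType) (A B : {set U}) e : A \subset B -> e \in B -> e \notin A -> (#|A| < #|B|)%N.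
Proof. by move=> AB eB eA; apply: proper_card; apply/properP; split => //; exists e. Qed.

(** The edges found inside [comp] include the $|comp| - 1$ edges of the search tree and, later, [pf]
    edges between waiting vertices. *)
Definition tracks (G : sgraph V) s : Prop :=
  [/\ active s \subset comp s, cur s \in comp s,
      (#|comp s| + pf s <= #|edges_in G (comp s) :&: seen s|.+1)%N &
      fin s = false -> [disjoint comp s & unseen s]].

Lemma tracks_step G s : valid s -> tracks G s -> tracks G (upd s (answer ask G s)).
Proof.
move=> vs [ac cc le dj]; have [[cd ca da dK pbs]] := vs.
case Ea : (ask s) => [e|].
  have [eP es _] := ask_valid vs Ea.
  rewrite /answer Ea; move: Ea; rewrite /ask /upd; case fs : (fin s) => E.
    have [_] := vs; rewrite fs => -[pp _ _ _]; rewrite E; have ep := pick_in_some E.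
    split => //=; case: (boolP (e \in edges G)) => eG; last first.
      by rewrite addn0 (leq_trans le) // ltnS subset_leq_card // setIS // subsetUr.
    have eC : e \in edges_in G (comp s).
      by rewrite inE eG; have := subsetP pp _ ep; rewrite inE => /andP[/subset_trans -> //].
    rewrite addnA addn1 ltnS (leq_trans le) //; apply: (@card_gain _ _ _ e).
    - by rewrite setIS // subsetUr.
    - by rewrite in_setI eC setU11.
    - by rewrite in_setI (negbTE es) andbF.
  case Et : (pick_in (todo s)) E => [v|] // -[eE]; have vt := pick_in_some Et.
  have [vu _] := todo_unasked vs fs vt; have vC : v \notin comp s by rewrite (disjointFl (dj fs) vu).
  have [_] := vs; rewrite fs => -[_ _ _ [_ pf0]].
  have unv b : forall a, a \in ~: (cur s |: (done_ s :|: (if b then v |: active s else active s))) ->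
      a \in unseen s by move=> a; case: b; rewrite !inE !negb_or // => /and3P[-> -> /andP[_ ->]].
  case: (boolP (e \in edges G)) => eG; split => //=.
  - by rewrite setUS.
  - by rewrite inE cc orbT.
  - rewrite addn0 cardsU1 vC add1n ltnS (leq_trans _ (_ : #|edges_in G (comp s) :&: seen s|.+1 <= _)%N) //.
      by move: le; rewrite pf0 addn0.
    apply: (@card_gain _ _ _ e).
    + apply/subsetP => a; rewrite !in_setI in_setU1 [_ \in edges_in _ _]inE [X in _ -> X && _]inE.
      by move=> /andP[/andP[-> aC] as_]; rewrite as_ orbT (subset_trans aC) ?subsetUr.
    + by rewrite in_setI in_setU1 -[in e == _]eE eqxx inE eG -eE subUset !sub1set !inE eqxx cc orbT.
    + by rewrite in_setI (negbTE es) andbF.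
  - move=> _; apply/pred0P => a; apply/negP => /andP[/= aC au].
    have := unv true a au; move: aC; rewrite in_setU1 => /orP[/eqP av|aC]; last first.
      by rewrite (disjointFr (dj fs) aC).
    by move: au; rewrite av !inE eqxx !orbT.
  - rewrite (leq_trans (_ : _ <= #|comp s| + pf s)%N) ?addn0 ?leq_addr // (leq_trans le) // ltnS.
    by rewrite subset_leq_card // setIS // subsetUr.
  - move=> _; apply/pred0P => a; apply/negP => /andP[/= aC au].
    by have := unv false a au; rewrite (disjointFr (dj fs) aC).
rewrite /answer Ea; move: Ea; rewrite /ask /upd; case fs : (fin s) => E; first by rewrite E.
have [_] := vs; rewrite fs => -[_ _ _ [_ pf0]]; rewrite pf0 in le.
case Et : (pick_in (todo s)) E => [v|] // _; case: ifP => _; first by split.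
case Eu : (pick_in (active s)) => [u|].
  have ua := pick_in_some Eu; split => //=.
  - by rewrite (subset_trans (subsetDl _ _)).
  - exact: (subsetP ac).
  move=> _; apply/pred0P => a; apply/negP => /andP[/= aC]; rewrite unseenP /= => /and3P[au].
  rewrite !inE !negb_or => /andP[ac' ad] /nandP[/negPn/eqP aE|aa]; first by rewrite aE eqxx in au.
  by have := disjointFr (dj fs) aC; rewrite unseenP ac' ad aa.
case Ev : (pick_in (unseen s)) => [u|]; last by split; rewrite ?pf0 // fs.
split => //=; rewrite ?sub0set ?inE ?cards1 ?addn0 // => _.
by rewrite disjoints1 unseenP /= eqxx.
Qed.

(** A potential that drops in every round until it is zero. Each vertex has [n.+1] units, for its
    questions and for the change to the next vertex; [n * n] is reserved for the pairs of waiting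
    vertices. *)
Definition remaining s : nat :=
  if fin s then #|pending s| else ((K - #|done_ s|) * n.+1 + #|todo s| + n * n)%N.

Lemma remaining_step s b : valid s -> (ask s = None -> b = false) ->
  (remaining (upd s b) <= (remaining s).-1)%N.
Proof.
move=> vs bE; have [[cd ca da dK pbs]] := vs; rewrite /upd; case fs : (fin s).
  case E : (pick_in (pending s)) => [e|] /=; last by rewrite /remaining fs (pick_in_none E) cards0.
  by rewrite /remaining /= fs (cardsD1 e (pending s)) (pick_in_some E).
have Kd : (K - #|done_ s| = (K - #|done_ s|.+1).+1)%N by move: dK; lia.
have un (A : {set V}) : (#|A| <= n)%N by rewrite -[leqRHS](card_ord n) max_card.
case E : (pick_in (todo s)) => [v|].
  rewrite /remaining /= fs.
  have -> : #|todo s| = #|todo s :\ v|.+1 by rewrite (cardsD1 v (todo s)) (pick_in_some E).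
  by move: (_ * _)%N (n * n)%N #|_ :\ _| => x y z; lia.
rewrite {2}/remaining fs.
case: ifPn => stop.
  have h1 := un (active s); rewrite /remaining /= (leq_trans (card_pairs_le _)) // (leq_trans (leq_mul h1 h1)) //.
  by rewrite Kd mulSn !addSn /=; exact: leq_addl.
rewrite negb_or -!ltnNge in stop; case/andP: stop => ah dK1.
have D1 : (#|cur s |: done_ s| = #|done_ s|.+1)%N by rewrite cardsU1 cd.
case Eu : (pick_in (active s)) => [u|].
  rewrite /remaining /= D1 Kd mulSn; have := un (unseen s).
  by move: #|unseen s| #|todo s| (_ * _)%N (n * n)%N => a b' c d; clear; lia.
case Ev : (pick_in (unseen s)) => [u|].
  rewrite /remaining /= D1 Kd mulSn; have := un (unseen s :\ u).
  by move: #|_ :\ _| #|todo s| (_ * _)%N (n * n)%N => a b' c d; clear; lia.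
have := unseen_card cd ca da; rewrite (pick_in_none Ev) (pick_in_none Eu) !cards0.
by move: dK1 Khn; lia.
Qed.

Lemma play_spec k s G : valid s -> tracks G s ->
  [/\ valid (play ask upd k s G), tracks G (play ask upd k s G) &
      (remaining (play ask upd k s G) <= remaining s - k)%N].
Proof.
elim: k s => [|k IH] s vs ts; first by split; rewrite ?subn0.
have vu : valid (upd s (answer ask G s)).
  rewrite /answer; case E : (ask s) => [e|]; first by have [_ _ /(_ (e \in edges G))[]] := ask_valid vs E.
  by have [] := wait_valid vs E.
have [v1 t1 r1] := IH _ vu (tracks_step vs ts); split => //.
have hb : ask s = None -> answer ask G s = false by rewrite /answer => ->.
apply: leq_trans r1 _; rewrite (leq_trans (leq_sub2r _ (remaining_step vs hb))) //.
by rewrite -subn1 -subnDA add1n.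
Qed.

Variables (R : realType) (p : R).
Hypothesis p01 : 0 <= p <= 1.
Local Notation mu := (random_gnp p (n := n)).

(** Apart from two large deviations of the martingales, the search cannot process [K] vertices with
    fewer than [h] waiting: it would have found fewer than $K + h$ edges in $K(n-K-h)$ questions. So
    at least [h] vertices wait at the end, and their pairs add about $p\binom h2$ edges to the
    search tree. *)
Lemma gnp_dense_part (lam : R) : 0 < lam ->
  (K + h)%:R - p * (K * (n - K - h))%:R < - lam ->
  graph_prob mu (fun G => ~~ [exists C : {set V}, (C != set0) &&
     (#|C|%:R - 1 + p * 'C(h, 2)%:R - lam <= #|edges_in G C|%:R)])
  <= 2 * ((3 * n ^ 2)%:R * p / lam ^+ 2).
Proof.
move=> l0 Kh; have n0 : (0 < n)%N by move: Khn; lia.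
pose x0 : V := Ordinal n0.
pose s0 := Search false set0 x0 (~: [set x0]) set0 [set x0] set0 set0 0 0 0 0.
have vs0 : valid s0.
  split => /=; first by split; rewrite ?inE ?cards0 // -setI_eq0 setI0.
  split => //.
  - by apply/subsetP => v; rewrite unseenP /= !inE => ->.
  - by move=> e; rewrite inE.
  - by rewrite cards0 mul1n add0n; rewrite cardsC1 card_ord; move: Khn K0; lia.
have ts0 G : tracks G s0.
  split => /=; rewrite ?sub0set ?inE ?cards1 // => _.
  by rewrite disjoints1 !inE eqxx.
pose N := (3 * n ^ 2)%N.
have rem0 : (remaining s0 <= N)%N.
  rewrite /remaining /= cards0 subn0 /N; have := max_card (mem (~: [set x0])); rewrite card_ord.
  have Kn : (K * n.+1 <= n * n)%N.
    have : (K.+1 <= n)%N by rewrite (leq_ltn_trans _ Khn) // leq_addr.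
    by move: n => y; clear; nia.
  move=> x1; have x2 : (#|[set~ x0]| <= n * n)%N by rewrite (leq_trans x1) // leq_pmulr.
  have -> : (3 * n ^ 2 = n * n + n * n + n * n)%N by rewrite expnS expn1; lia.
  by rewrite leq_add // leq_add.
pose phb s : R := (pb s)%:R - p * (qb s)%:R.
pose phf s : R := (pf s)%:R - p * (qf s)%:R.
have spec1 s e : valid s -> ask s = Some e ->
    [/\ e \in all_pairs n, e \notin seen s & forall b, valid (upd s b) /\ seen (upd s b) = e |: seen s].
  exact: ask_valid.
have wait f s : (f = phb \/ f = phf) -> valid s -> ask s = None ->
    [/\ valid (upd s false), seen s \subset seen (upd s false) & f (upd s false) = f s].
  move=> ff vs E; have [v1 s1] := wait_valid vs E; split; rewrite ?s1 //.
  move: E; rewrite /ask /upd; case fs : (fin s) => E; first by rewrite E.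
  have [_] := vs; rewrite fs => -[_ _ _ [q0 pf0]].
  case Et : (pick_in (todo s)) E => [v|] // _; case: ff => ->; rewrite /phb /phf; case: ifP => _ //=.
  - by case: (pick_in (active s)) => [u|] //=; case: (pick_in (unseen s)).
  - by rewrite q0 pf0.
  - by case: (pick_in (active s)) => [u|] /=; rewrite ?q0 ?pf0 //; case: (pick_in (unseen s)) => [u|] /=; rewrite ?q0 ?pf0.
have phi f s e : (f = phb \/ f = phf) -> valid s -> ask s = Some e ->
    exists w : bool, forall b : bool, f (upd s b) = f s + w%:R * (b%:R - p).
  move=> ff vs; rewrite /ask /upd; case fs : (fin s) => E.
    rewrite E; case: ff => ->; [exists false|exists true] => b; rewrite /phb /phf /= ?mul0r ?addr0 //.
    by rewrite natrD -[(qf s).+1]addn1 natrD; ring.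
  have [_] := vs; rewrite fs => -[_ _ _ [q0 pf0]].
  case Et : (pick_in (todo s)) E => [v|] // _; case: ff => ->; [exists true|exists false] => b; rewrite /phb /phf /=.
    by rewrite natrD -[(qb s).+1]addn1 natrD; ring.
  by rewrite q0 pf0 !mul0r addr0.
have large f : (f = phb \/ f = phf) -> f s0 = 0 ->
    graph_prob mu (fun G => lam <= `|f (play ask upd N s0 G)|) <= N%:R * p / lam ^+ 2.
  move=> ff f0; apply: (@prob_play_large R n p p01 search ask upd seen valid f) => //.
  - by move=> s vs E; exact: (wait f s ff vs E).
  - by move=> s e vs E; exact: (phi f s e ff vs E).
have f0 : phb s0 = 0 /\ phf s0 = 0 by rewrite /phb /phf /= mulr0 subrr.
have Lb := large phb (or_introl erefl) f0.1; have Lf := large phf (or_intror erefl) f0.2.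
rewrite mulr_natl mulr2n; apply: le_trans (lerD Lb Lf).
apply: graph_prob_union2 => [G|G]; first exact: gnp_ge0.
apply: contraNT; rewrite negb_or -!ltNge => /andP[lb lf].
have [vN [aC cC le _] rN] := play_spec N vs0 (ts0 G).
set s := play ask upd N s0 G in vN aC cC le rN lb lf.
have : remaining s = 0%N by apply/eqP; rewrite -leqn0 (leq_trans rN) // leqn0 subn_eq0.
rewrite /remaining; have [[_ _ _ dK pbs]] := vN; case fs : (fin s); last first.
  by move=> _ /eqP; rewrite !addn_eq0 muln_eq0 subn_eq0 leqNgt dK.
move=> [_ _ qp qq] p0; rewrite p0 addn0 in qp.
apply/existsP; exists (comp s); apply/andP; split; first by apply/set0Pn; exists (cur s).
have hact : (h <= #|active s|)%N.
  case: qq => // -[Kd qK]; rewrite leqNgt; apply/negP => ah.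
  have dE : #|done_ s|.+1 = K by apply/eqP; rewrite eqn_leq dK.
  move: lb; rewrite /phb; have : phb s <= (K + h)%:R - p * (K * (n - K - h))%:R.
    rewrite /phb lerB //; first by rewrite ler_nat (leq_trans pbs) // leq_add // ltnW.
    by have /andP[p0' _] := p01; rewrite ler_wpM2l // ler_nat -{1}dE.
  by rewrite /phb ltr_norml => h1 /andP[h2 _]; lra.
have qfh : ('C(h, 2) <= qf s)%N.
  rewrite qp (leq_trans (leq_bin2l 2 hact)) // -cards_draws subset_leq_card //.
have /andP[p0' _] := p01.
have h1 : p * 'C(h, 2)%:R <= p * (qf s)%:R by rewrite ler_wpM2l // ler_nat.
have h2 : (#|comp s| + pf s)%:R <= (#|edges_in G (comp s)|.+1)%:R :> R.
  by rewrite ler_nat (leq_trans le) // ltnS subset_leq_card // subsetIl.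
move: lf; rewrite /phf ltr_norml => /andP[h3 _].
move: h2; rewrite natrD -[(#|edges_in _ _|).+1]addn1 natrD; lra.
Qed.

End Exploration.

(** * Maximum average degree and growth estimates *)

Section MaximumAverageDegree.
Variables (R : realType) (T : finType) (G : sgraph T).
Local Notation density S := (2 * #|edges_in G S|%:R / #|S|%:R : R).

Lemma mad_ge (S : {set T}) : S != set0 -> density S <= mad R G.
Proof.
move=> S0; pose H := (S, edges_in G S).
apply: (@le_bigmax_cond _ _ _ 0 H _ (fun H => 2 * #|H.2|%:R / #|H.1|%:R)).
rewrite /= card_gt0 S0 andbT /subgraph; apply/andP; split; apply/subsetP => e; rewrite !inE => /andP[eG eS] //.
by rewrite eS; have := subsetP (edgesP G) _ eG; rewrite inE => /andP[].
Qed.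

Lemma mad_attained : (0 < #|T|)%N -> exists2 S : {set T}, S != set0 & mad R G = density S.
Proof.
move=> T0; have TT : [set: T] != set0 by rewrite -card_gt0 cardsT.
pose S := [arg max_(S > [set: T] | S != set0) (density S)]%O.
have [S0 Smax] : S != set0 /\ forall S', S' != set0 -> density S' <= density S.
  by rewrite /S; case: arg_maxP => // S1 S10 S1m; split.
exists S => //; apply/eqP; rewrite eq_le mad_ge // andbT; apply: bigmax_le => [|[A F] /andP[/andP[/= FG FA] A0]].
  by rewrite divr_ge0 ?mulr_ge0 ?ler0n.
rewrite card_gt0 in A0; apply: le_trans (Smax _ A0).
rewrite /= ler_wpM2r ?invr_ge0 ?ler0n // ler_wpM2l ?ler0n // ler_nat subset_leq_card //.
apply/subsetP => e eF; rewrite inE (subsetP FG) //=.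
by have := subsetP FA _ eF; rewrite inE => /andP[].
Qed.

Lemma mad_ge_edges : (0 < #|T|)%N -> 2 * #|edges G|%:R / #|T|%:R <= mad R G.
Proof.
move=> T0; have TT : [set: T] != set0 by rewrite -card_gt0 cardsT.
have := mad_ge TT; rewrite cardsT; suff -> : edges_in G [set: T] = edges G by [].
by apply/setP => e; rewrite inE finset.subsetT andbT.
Qed.

Lemma mad_le_degree D : (forall x, (degree G x <= D)%N) -> (0 < #|T|)%N -> mad R G <= D%:R.
Proof.
move=> dD T0; have [S S0 ->] := mad_attained T0.
rewrite ler_pdivrMr ?ltr0n ?card_gt0 // -!natrM ler_nat -sum_degree_in.
rewrite mulnC -sum_nat_const leq_sum // => v _; apply: leq_trans (dD v); rewrite -card_nbh.
by rewrite subset_leq_card // subsetIl.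
Qed.

End MaximumAverageDegree.

(** As $s! \ge (s/4)^s$, the right side is at least $(s2^m/4)^s \ge (2n)^s$, and $2^s > 2^m$. *)
Lemma factorial_dominates n m s : (0 < n)%N -> (8 * n <= s * 2 ^ m)%N -> (m < s)%N ->
  (2 ^ m * n ^ s < s`! * 2 ^ (m * s))%N.
Proof.
move=> n0 ns ms; rewrite -(ltn_pmul2l (_ : 0 < 4 ^ s)%N) ?expn_gt0 //.
apply: (@leq_trans ((8 * n) ^ s)%N); last first.
  rewrite -(leq_exp2r _ _ (leq_ltn_trans (leq0n m) ms)) in ns; apply: leq_trans ns _.
  by rewrite expnMn mulnA -expnM leq_mul2r expn_fact orbT.
have -> : (8 = 4 * 2)%N by [].
rewrite !expnMn -mulnA ltn_pmul2l ?expn_gt0 // ltn_pmul2r ?expn_gt0 ?n0 //.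
by rewrite ltn_exp2l.
Qed.

Section Growth.
Variable R : realType.
Implicit Types (A la : R).

Lemma exp_dominates A : exists2 M : R, 1 <= M & forall la, M <= la -> A * (1 + la) ^+ 2 <= expR (la / 4).
Proof.
have A0 : 0 <= `|A| by [].
(* The cubic term of the exponential series is $\lambda^3/384$, and $(1+\lambda)^2 \le 4\lambda^2$;
   $1536 = 4 \cdot 384$. *)
exists (1 + 1536 * `|A|) => [|la Ml]; first by lra.
have A1 : A <= `|A| by apply: ler_norm.
have la1 : 1 <= la by lra.
have z0 : 0 <= la / 4 by rewrite divr_ge0 //; lra.
apply: le_trans (expR_ge1Dxn 2 z0); rewrite (_ : (3`!)%:R = 6 :> R) //.
apply: (@le_trans _ _ (`|A| * (4 * la ^+ 2))).
  apply: (@le_trans _ _ (`|A| * (1 + la) ^+ 2)); first by rewrite ler_wpM2r // sqr_ge0.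
  rewrite ler_wpM2l //; have : 0 <= (la - 1) * (3 * la + 1) by rewrite mulr_ge0 //; lra.
  rewrite !expr2; lra.
have -> : (la / 4) ^+ 3 / 6 = la / 384 * la ^+ 2 by field.
rewrite mulrA -[leLHS]add0r; apply: lerD => //; rewrite ler_wpM2r ?sqr_ge0 //; lra.
Qed.

Lemma ln_nat_large A : exists2 n0 : nat, (0 < n0)%N & forall n, (n0 <= n)%N -> A <= ln n%:R.
Proof.
exists (Num.truncn (expR A)).+1 => // n nn.
have : expR A < n%:R by apply: lt_le_trans (truncnS_gt _) _; rewrite ler_nat.
move=> h; rewrite -[A]expRK ler_ln ?posrE ?expR_gt0 ?(ltW h) //.
exact: lt_trans (expR_gt0 _) h.
Qed.

Lemma nat_ceil (x : R) : 0 <= x -> exists k : nat,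
  [/\ x <= k%:R, k%:R < x + 1 & forall j : nat, x <= j%:R -> (k <= j)%N].
Proof.
move=> x0; have ex : exists k : nat, x <= k%:R by exists (Num.truncn x).+1; rewrite ltW // truncnS_gt.
case: (ex_minnP ex) => k xk kmin; exists k; split => //.
case: k kmin xk => [|k] kmin xk; first by rewrite mulr0n; lra.
have : ~~ (x <= k%:R) by apply/negP => /kmin; rewrite ltnn.
by rewrite -ltNge -natr1 => h; lra.
Qed.

Lemma two_le_expR1 : 2 <= expR 1 :> R.
Proof. by have := expR_ge1Dx (1 : R); lra. Qed.

Lemma ln2_le1 : ln 2 <= 1 :> R.
Proof. by rewrite -[leRHS]expRK ler_ln ?posrE ?expR_gt0 // two_le_expR1. Qed.

Lemma ln2_ge : 1 / 2 <= ln 2 :> R.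
Proof.
rewrite -[leLHS]expRK ler_ln ?posrE ?expR_gt0 //.
have h : 0 < expR (- (1 / 2) : R) by apply: expR_gt0.
have := expR_ge1Dx (- (1 / 2) : R); have : expR (1/2 : R) * expR (- (1/2)) = 1 by rewrite -expRD subrr expR0.
have := expR_gt0 (1/2 : R); nra.
Qed.

End Growth.

(** * The upper bound *)

Section Scales.
Variables (R : realType) (l d : R).
Hypotheses (la1 : 1 <= ln l) (d2 : 2 <= d).
Local Ltac slra := move: (la1) (d2); lra.
Local Ltac snra := move: (la1) (d2); nra.
Local Notation la := (ln l).
Local Notation y := (expR (la / 4)).

(** For $l = \log n$ this is the exponent of the error factor of the upper bound, up to the
    constant. Accordingly [la] is $\log\log n$ and [y] is $(\log n)^{1/4}$. *)
Definition excess : R := d^-1 * Num.sqrt l * ln l + ln d.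
Local Notation Phi := excess.

Lemma l_gt0 : 0 < l.
Proof. by rewrite ltNge; apply/negP => l0; move: la1; rewrite (ln0 l0) ler10. Qed.

Lemma l_expR : l = expR la. Proof. by rewrite lnK // posrE l_gt0. Qed.

Lemma sqrt_expR : Num.sqrt l = y ^+ 2.
Proof.
rewrite [in LHS]l_expR (_ : expR la = (y ^+ 2) ^+ 2) ?sqrtr_sqr ?ger0_norm ?exprn_ge0 ?expR_ge0 //.
by rewrite -!expRM_natl; congr expR; field.
Qed.

Lemma l_y4 : l = y ^+ 4.
Proof. by rewrite [LHS]l_expR -expRM_natl; congr expR; field. Qed.

Lemma lnd_ge0 : 0 <= ln d. Proof. by rewrite ln_ge0 //; slra. Qed.

Lemma main_term_ge0 : 0 <= d^-1 * Num.sqrt l * la.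
Proof. by rewrite mulr_ge0 ?mulr_ge0 ?invr_ge0 ?sqrtr_ge0 //; slra. Qed.

Lemma ratio_excess : Num.sqrt l / d <= Phi.
Proof.
rewrite /Phi (mulrC d^-1); have r0 : 0 <= Num.sqrt l / d by rewrite divr_ge0 ?sqrtr_ge0 //; slra.
have := lnd_ge0; have := ler_wpM2l r0 la1; slra.
Qed.

(** Below the threshold $l^{1/4}$ for [d] the first term of the excess exceeds every power of $\log
    l$; above it [ln d] is comparable to $\log l$. *)
Lemma excess_cases : (d <= y /\ y * la <= Phi) \/ (y < d /\ la / 4 <= ln d).
Proof.
have y0 := expR_gt0 (la / 4); have d0 : 0 < d by slra.
case: (lerP d y) => dy; [left|right]; split => //.
  apply: (@le_trans _ _ (d^-1 * Num.sqrt l * la)); last by rewrite lerDl lnd_ge0.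
  rewrite ler_wpM2r //; first slra.
  by rewrite sqrt_expR (mulrC d^-1) ler_pdivlMr // expr2 ler_wpM2l // ltW.
by rewrite -[leLHS]expRK ler_ln ?posrE // ltW.
Qed.

Lemma la_excess : la <= 4 * Phi.
Proof.
have : expR 0 <= y by rewrite ler_expR; slra.
rewrite expR0; have := main_term_ge0; have := lnd_ge0.
case: excess_cases => -[h1 h2]; last by rewrite /Phi; slra.
move=> _ _ y1; apply: (@le_trans _ _ (4 * (y * la))); last slra.
by have := ler_wpM2r (_ : 0 <= la) y1; rewrite mul1r => /(_ (le_trans ler01 la1)); slra.
Qed.

Lemma excess_ge : 1 / 4 <= Phi. Proof. by have := la_excess; slra. Qed.

Lemma exponent_le : d / (2 * d - 2) <= 1.
Proof. by rewrite ler_pdivrMr; slra. Qed.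

Lemma slots_exist : exists t h : nat, [/\ (0 < t)%N, t%:R * d / 2 <= h%:R,
  h%:R <= t%:R * d / 2 + 1, Num.sqrt l / d <= t%:R & t%:R <= Num.sqrt l / d + 1].
Proof.
have d0 : 0 < d by slra.
have r0 : 0 < Num.sqrt l / d by rewrite divr_gt0 // sqrtr_gt0 l_gt0.
have [t [t1 t2 _]] := nat_ceil (ltW r0).
have [|h [h1 h2 _]] := @nat_ceil R (t%:R * d / 2); first by rewrite mulr_ge0 ?mulr_ge0 //; slra.
exists t, h; split; rewrite ?(ltW t2) ?(ltW h2) //.
by rewrite -(ltr0n R) (lt_le_trans r0).
Qed.

Variables (t h : nat).
Hypotheses (t0 : (0 < t)%N) (h1 : t%:R * d / 2 <= h%:R) (h2 : h%:R <= t%:R * d / 2 + 1)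
  (t1 : Num.sqrt l / d <= t%:R) (t2 : t%:R <= Num.sqrt l / d + 1).

Lemma t_ge1 : 1 <= t%:R :> R. Proof. by rewrite ler1n. Qed.

Lemma slots_le : 2 * h%:R <= 2 * (t%:R * d).
Proof. by have d0 : 0 <= d by [slra]; have := ler_wpM2r d0 t_ge1; rewrite mul1r; move: (h2); slra. Qed.

Lemma h_gt0 : 0 < h%:R :> R.
Proof.
apply: lt_le_trans h1; rewrite divr_gt0 // mulr_gt0 //; last slra.
by rewrite ltr0n.
Qed.

Lemma t_le_h : t%:R <= h%:R :> R.
Proof. by apply: le_trans h1; have := t_ge1; snra. Qed.

(** For $t = 1$ there are at most $2d$ choices, paid by [ln d]. For $t \ge 2$ rounding up at most
    doubles, so $t \le 2\sqrt l/d$, and $2h \le l$: this is paid by the first term of the excess. *)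
Lemma patterns_bound : 64 <= y -> (2 * h%:R) ^+ t <= expR (2 * Phi + 1).
Proof.
move=> y64; have d0 : 0 < d by slra.
have h0 : 0 < 2 * h%:R :> R by rewrite mulr_gt0 // h_gt0.
rewrite -[2 * _](lnK (_ : _ \is Num.pos)) // -expRM_natl ler_expR.
have sl := slots_le; have m0 := main_term_ge0.
case: (ltnP 1 t) => [t3|t3]; last first.
  have tE : t = 1%N by apply/eqP; rewrite eqn_leq t3 t0.
  move: sl; rewrite tE !mul1r => sl.
  have : ln (2 * h%:R) <= ln 2 + ln d by rewrite -lnM ?posrE // ler_ln ?posrE // mulr_gt0.
  by have := @ln2_le1 R; rewrite /Phi; have := lnd_ge0; move: m0 => /=; slra.
have t3' : 2 <= t%:R :> R by rewrite (ler_nat R 2).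
have ht : t%:R * d <= 2 * Num.sqrt l.
  have : t%:R <= 2 * (Num.sqrt l / d) by move: t2; slra.
  by rewrite mulrA ler_pdivlMr.
have h3 : 2 * h%:R <= l.
  apply: le_trans sl _; rewrite sqrt_expR in ht; rewrite l_y4 (_ : y ^+ 4 = y ^+ 2 * y ^+ 2) -?exprD //.
  have y2 : 4 <= y ^+ 2 by rewrite expr2; snra.
  by snra.
have : ln (2 * h%:R) <= la by rewrite ler_ln ?posrE // l_gt0.
move=> h4; apply: (@le_trans _ _ (t%:R * la)); first by rewrite ler_wpM2l.
apply: (@le_trans _ _ (2 * (d^-1 * Num.sqrt l * la))); last by rewrite /Phi; have := lnd_ge0; slra.
rewrite mulrA ler_wpM2r //; first slra.
by rewrite -(ler_pM2r d0) (_ : 2 * (d^-1 * Num.sqrt l) * d = 2 * Num.sqrt l) //; field; slra.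
Qed.

(** Without rounding $t/h$ would be $2/d$; the last term is the price of an integral [h]. *)
Lemma ratio_bound : 1 - t%:R / h%:R <= 1 - 2 / d + 4 / (t%:R * d ^+ 2).
Proof.
have d0 : 0 < d by slra.
have tt : 0 < t%:R :> R by rewrite ltr0n.
have hh := h_gt0.
suff : 2 / d - 4 / (t%:R * d ^+ 2) <= t%:R / h%:R by slra.
rewrite ler_pdivlMr //.
have -> : 2 / d - 4 / (t%:R * d ^+ 2) = (2 * (t%:R * d) - 4) / (t%:R * d ^+ 2) by field; rewrite !gt_eqF.
rewrite mulrAC ler_pdivrMr ?mulr_gt0 ?exprn_gt0 //.
have td : 2 <= t%:R * d by have := t_ge1; snra.
have q0 : 0 <= 2 * (t%:R * d) - 4 by slra.
by have := ler_wpM2l q0 h2; snra.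
Qed.

(** The main exponents agree as $\frac{d}{2d-2}(1 - \frac2d) = \frac{d-2}{2d-2}$. The rounding error
    is at most $4l/(td^2) \le 4\sqrt l/d$ by the choice of [t]. *)
Lemma free_bits_bound (m E : nat) : m%:R * ln 2 <= d / (2 * d - 2) * l ->
  E%:R <= m%:R * (1 - t%:R / h%:R) + 2 * t%:R :> R ->
  (2 : R) ^+ E <= expR ((d - 2) / (2 * d - 2) * l) * expR (6 * Phi + 2).
Proof.
move=> mB EB; have d0 : 0 < d by slra.
have tt : 0 < t%:R :> R by rewrite ltr0n.
have l0 := l_gt0.
rewrite -expRD -[2 in X in X <= _](lnK (_ : (2 : R) \is Num.pos)) ?posrE // -expRM_natl ler_expR.
have ln2p : 0 <= ln 2 :> R by have := @ln2_ge R; slra.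
apply: (le_trans (ler_wpM2r ln2p EB)).
have u0 : 0 <= 1 - t%:R / h%:R :> R by rewrite subr_ge0 ler_pdivrMr ?h_gt0 // mul1r t_le_h.
have x0 : 0 <= d / (2 * d - 2) * l by rewrite mulr_ge0 ?divr_ge0 //; slra.
have b1 := ler_wpM2r u0 mB; have b2 := ler_wpM2l x0 ratio_bound.
have e1 : d / (2 * d - 2) * l * (1 - 2 / d + 4 / (t%:R * d ^+ 2)) =
   (d - 2) / (2 * d - 2) * l + d / (2 * d - 2) * (4 * (l / (t%:R * d ^+ 2))).
  by field; rewrite !gt_eqF //=; slra.
have b3 : l / (t%:R * d ^+ 2) <= Num.sqrt l / d.
  rewrite ler_pdivrMr ?mulr_gt0 ?exprn_gt0 //.
  have -> : Num.sqrt l / d * (t%:R * d ^+ 2) = Num.sqrt l * (t%:R * d) by field; slra.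
  rewrite -{1}(sqr_sqrtr (ltW l0)) expr2 ler_wpM2l ?sqrtr_ge0 //.
  by move: t1; rewrite ler_pdivrMr.
have z0 : 0 <= 4 * (l / (t%:R * d ^+ 2)).
  by rewrite mulr_ge0 // divr_ge0 ?(ltW l0) // mulr_ge0 ?sqr_ge0.
have b4 := ler_wpM2r z0 exponent_le.
have b5 := ratio_excess; have b6 : t%:R * ln 2 <= t%:R :> R by rewrite ler_piMr ?ln2_le1.
rewrite e1 in b2.
have -> : (m%:R * (1 - t%:R / h%:R) + 2 * t%:R) * ln 2 = m%:R * ln 2 * (1 - t%:R / h%:R) + 2 * (t%:R * ln 2) :> R by ring.
move: b1 b2 b3 b4 b5 b6 t2; slra.
Qed.

(** The first period and the incomplete last one are not counted as copied; each of them costs at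
    most [t]. *)
Lemma reuse_bound (k m : nat) : (k <= m)%N ->
  (k - t * (k %/ h).-1)%:R <= m%:R * (1 - t%:R / h%:R) + 2 * t%:R :> R.
Proof.
move=> km; have hh := h_gt0; have th := t_le_h.
have u0 : 0 <= 1 - t%:R / h%:R :> R by rewrite subr_ge0 ler_pdivrMr // mul1r.
have kmR : k%:R <= m%:R :> R by rewrite ler_nat.
have b := ler_wpM2r u0 kmR.
have hN : (0 < h)%N by rewrite -(ltr0n R).
have k1 : k%:R <= ((k %/ h).+1)%:R * h%:R :> R by rewrite -natrM ler_nat ltnW // ltn_ceil.
have tt : 0 <= t%:R / h%:R :> R by rewrite divr_ge0.
have k2 : k%:R * (t%:R / h%:R) <= (k %/ h).+1%:R * t%:R :> R.
  have := ler_wpM2r tt k1; rewrite -mulrA (mulrC h%:R) divfK ?gt_eqF //.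
have T0 : 0 <= t%:R :> R by [].
case: (leqP (t * (k %/ h).-1) k) => c; last first.
  by rewrite (eqP (_ : (k - _ == 0)%N)) ?subn_eq0 ?(ltnW c) // addr_ge0 ?mulr_ge0.
rewrite natrB // natrM.
have k3 : ((k %/ h).+1)%:R <= (k %/ h).-1%:R + 2 :> R.
  by rewrite -(natrD _ _ 2) ler_nat; case: (k %/ h)%N => // j; rewrite addn2.
have := ler_wpM2r T0 k3; slra.
Qed.

End Scales.

Section UpperBound.
Variables (R : realType) (dl C2 : R).
Hypotheses (dl0 : 0 < dl) (C21 : 1 <= C2).
Local Ltac slra := move: (dl0) (C21); lra.

(** The first summand makes $(1 + dl)^L$ exceed $2l$ for $L \approx K\log l$; the summand 5 leaves
    room in that inequality and for the fixed length 5 used when [d] is large. *)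
Definition walk_scale : R := 2 / ln (1 + dl) + 5.
Definition walk_bound (l : R) : nat := (Num.truncn (walk_scale * ln l)).+1.
Local Notation K := walk_scale.

Lemma ln_dl : 0 < ln (1 + dl). Proof. by rewrite ln_gt0 // ltrDl. Qed.

Lemma walk_scale_ge : 5 <= K.
Proof. by rewrite lerDr divr_ge0 // ltW // ln_dl. Qed.

Lemma walk_bound_le l : 1 <= ln l -> (walk_bound l)%:R <= K * ln l + 1.
Proof.
move=> la1; rewrite -natr1 lerD2r truncn_le mulr_ge0 //; last by lra.
exact: le_trans walk_scale_ge.
Qed.

(** For $d \le l^{1/4}$ a length $O(\log l)$ is enough, and the balls cost $\exp(O((\log l)^2))$,
    which $l^{1/4}\log l$ in the excess absorbs. For larger [d] five steps suffice, as
    $(l^{1/4}/2)^5 > 2l$, and the cost $\exp(O(\log l))$ is absorbed by [ln d]. *)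
Lemma walk_length : exists2 CM : R * R, 0 <= CM.1 & forall l d : R,
  CM.2 <= ln l -> 2 + 2 * dl <= d -> exists L : nat, [/\ (L <= walk_bound l)%N, 2 * l < (d / 2) ^+ L &
    (C2 * l) ^+ (L + L + 1) <= expR (CM.1 * excess l d)].
Proof.
have [M M1 ME] := @exp_dominates R 1.
have K5 := walk_scale_ge.
pose M' := Num.max M (Num.max (4 * ln 70) (ln C2)).
exists (4 * K + 94, M') => [/=|l d /=]; first by slra.
rewrite !ge_max => /and3P[Ml l64 lC] dd; set la := ln l in Ml l64 lC *.
have la1 : 1 <= la by lra.
have d2 : 2 <= d by slra.
have l0 := l_gt0 la1.
set y := expR (la / 4).
have lay : la <= y by apply: le_trans (ME _ Ml); rewrite mul1r expr2; nra.
have y70 : 70 <= y by rewrite -[leLHS]lnK ?posrE // ler_expR; lra.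
have C2l : C2 * l <= expR (2 * la).
  have -> : 2 * la = la + la by ring.
  have lE : l = expR la := l_expR la1.
  have Cp : C2 \is Num.pos by rewrite posrE; slra.
  by rewrite expRD -lE ler_wpM2r ?(ltW l0) // -[leLHS](lnK Cp) [leRHS]lE ler_expR.
have C2p k : (C2 * l) ^+ k <= expR (k%:R * (2 * la)).
  rewrite expRM_natl lerXn2r ?nnegrE ?expR_ge0 // mulr_ge0 ?(ltW l0) //; slra.
have Phi0 : 0 <= excess l d by have := excess_ge la1 d2; lra.
case: (excess_cases la1 d2) => -[dy yP].
  have [L LE] : exists L, L = walk_bound l by exists (walk_bound l).
  have L1 := walk_bound_le la1; exists L; rewrite -LE in L1 *; split => //.
    apply: (@lt_le_trans _ _ ((1 + dl) ^+ L)); last first.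
      by apply: lerXn2r; rewrite ?nnegrE; slra.
    rewrite -[1 + dl](lnK (_ : _ \is Num.pos)) ?posrE; last by slra.
    rewrite -expRM_natl -[2](lnK (_ : (2 : R) \is Num.pos)) ?posrE // [X in _ * X < _](l_expR la1) -expRD ltr_expR.
    have KL : K * la < L%:R by rewrite LE /walk_bound truncnS_gt.
    have e : K * la * ln (1 + dl) = 2 * la + 5 * la * ln (1 + dl).
      by rewrite /K; field; rewrite gt_eqF // ln_dl.
    have g0 := ln_dl; have := ler_wpM2r (ltW g0) (ltW KL); rewrite -/la e.
    have := @ln2_le1 R; have : 0 < 5 * la * ln (1 + dl) by rewrite !mulr_gt0 //; lra.
    by lra.
  apply: le_trans (C2p _) _; rewrite ler_expR !natrD.
  rewrite -/la in L1 yP.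
  apply: (@le_trans _ _ ((4 * K + 94) * (la * la))); first by nra.
  rewrite ler_wpM2l //; first by slra.
  by apply: le_trans yP; rewrite ler_wpM2r //; lra.
rewrite -/la -/y in dy; exists 5%N; split.
- by rewrite /walk_bound ltnS truncn_ge_nat; rewrite -/la; [nra|rewrite mulr_ge0 //; lra].
- apply: (@lt_le_trans _ _ ((y / 2) ^+ 5)); last by apply: lerXn2r; rewrite ?nnegrE; lra.
  rewrite [X in _ * X < _](l_y4 la1) -/la -/y.
  have -> : (y / 2) ^+ 5 = y / 32 * y ^+ 4 by field.
  have y4 : 0 < y ^+ 4 by rewrite exprn_gt0 //; lra.
  by rewrite ltr_pM2r //; lra.
apply: le_trans (C2p _) _; rewrite ler_expR.
have : la <= 4 * excess l d := la_excess la1 d2.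
by rewrite (_ : (5 + 5 + 1)%N = 11%N) //; nra.
Qed.

End UpperBound.

Lemma dense_sets_mono (T : finType) (G : sgraph T) l l' : (l <= l')%N ->
  (#|dense_sets G l| <= #|dense_sets G l'|)%N.
Proof.
move=> ll; apply: subset_leq_card; apply/subsetP => W; rewrite !inE => /and3P[-> Wl ->].
by rewrite (leq_trans Wl ll).
Qed.

Lemma mad_orientation (R : realType) (T : finType) (G : sgraph T) (t h : nat) :
  t%:R * mad R G / 2 <= h%:R -> forall S, (t * #|edges_in G S| <= h * #|S|)%N.
Proof.
move=> th S; case: (eqVneq S set0) => [->|S0].
  rewrite (_ : edges_in G set0 = set0) ?cards0 ?muln0 //; apply/setP => e; rewrite !inE finset.subset0.
  apply/negP => /andP[eG /eqP e0]; have := subsetP (edgesP G) _ eG.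
  by rewrite inE e0 cards0 andbF.
have := mad_ge R G S0; rewrite ler_pdivrMr ?ltr0n ?card_gt0 // => le.
rewrite -(ler_nat R) !natrM.
have t0 : 0 <= t%:R :> R by []. have S1 : 0 <= #|S|%:R :> R by [].
have := ler_wpM2l t0 le; have := ler_wpM2r S1 th; lra.
Qed.

Lemma binary_scale (R : realType) (X : R) : 1 <= X -> exists m : nat, 2 ^+ m <= X /\ X < 2 ^+ m.+1.
Proof.
move=> X1; have X0 : 0 <= X by lra.
have T0 : (0 < Num.truncn X)%N by rewrite truncn_ge_nat.
have /andP[m1 m2] := trunc_log_bounds (ltnSn 1) T0; exists (trunc_log 2 (Num.truncn X)); split.
  by rewrite -natrX -truncn_ge_nat.
by rewrite -natrX (lt_le_trans (truncnS_gt _)) // ler_nat.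
Qed.

Lemma excess_budget (R : realType) (CL Phi la : R) : 0 <= CL -> 1 <= la -> la <= 4 * Phi ->
  [/\ 0 <= Phi, 2 * la + CL * Phi <= (CL + 40) * Phi, 8 * Phi + 4 + 1 <= (CL + 40) * Phi & 0 <= 8 * Phi + 4].
Proof.
move=> CL0 la1 laP; have Phi0 : 0 <= Phi by lra.
have := mulr_ge0 CL0 Phi0; rewrite mulrDl => h; split; lra.
Qed.

Lemma add_le_mul (R : realType) (X b a f g : R) : X <= a -> b <= a * f -> 0 <= a -> 1 <= f -> 2 <= g ->
  X + b <= a * (f * g).
Proof.
move=> Xa ba a0 f1 g2; have h := ler_wpM2l a0 f1.
have h1 : 0 <= a * f by rewrite mulr_ge0 // (le_trans _ f1).
by have := ler_wpM2l h1 g2; rewrite mulrA; lra.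
Qed.

Lemma add_le_sqr (R : realType) (l : R) : 70 <= l -> 17 + 2 * l <= l * l.
Proof. by move=> l70; have : 70 * l <= l * l by [rewrite ler_wpM2r //; lra]; lra. Qed.

(** * Putting the upper bound together *)

Section UpperBound.
Variables (R : realType) (dl C2 : R).
Hypotheses (dl0 : 0 < dl) (C21 : 1 <= C2).
Local Notation gam := (dl / (1 + 2 * dl)).

(** [gam] is the value of the exponent, which increases with [d], at $d = 2 + 2\,dl$. *)
Lemma exponent_ge d : 2 + 2 * dl <= d -> gam <= (d - 2) / (2 * d - 2).
Proof.
move: dl0 => h0 dd; rewrite ler_pdivrMr; last lra.
by rewrite mulrAC ler_pdivlMr; nra.
Qed.

(** A small dense set contributes $\exp(O((\log l)^2))$ vertices, because walks have length $O(\log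
    l)$ and degrees are $O(l)$; half of the exponent [gam] absorbs this. *)
Lemma cyclic_part_small : exists M : R, forall n (G : sgraph 'I_n) D L,
  M <= ln (ln n%:R) -> (forall x, (degree G x <= D)%N) -> D.+1%:R <= C2 * ln n%:R ->
  (L <= walk_bound dl (ln n%:R))%N ->
  #|dense_sets G (2 * walk_bound dl (ln n%:R)).+2|%:R <= expR (gam / 2 * ln n%:R) ->
  #|cyclic_part G L|%:R <= expR (gam * ln n%:R).
Proof.
have g0 : 0 < gam by move: dl0 => h0; rewrite divr_gt0 //; lra.
have K5 := walk_scale_ge dl0; set K := walk_scale dl in K5.
have [M M1 ME] := @exp_dominates R ((2 * K + 4) / (gam / 2)).
exists (Num.max M (ln C2)) => n G D L; rewrite ge_max => /andP[Ml lC] degD DC LB dS.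
have la1 : 1 <= ln (ln n%:R) :> R by lra.
have wb := walk_bound_le dl0 la1; rewrite -/K in wb.
have l0 := l_gt0 la1; have l4 := l_y4 la1; have lE := l_expR la1.
move: Ml la1 wb lC DC dS LB l0 l4 lE ME; move: (walk_bound _ _) => Lb.
move: (ln n%:R) => l; move: (ln l) => la Ml la1 wb lC DC dS LB l0 l4 lE ME.
set y := expR (la / 4) in l4.
have y1 : 1 <= y by rewrite -(expR0 R) ler_expR; lra.
have yl : y <= l.
  have y3 : 1 <= y ^+ 3 by apply: exprn_ege1.
  by rewrite l4 -[leLHS]mulr1 (exprS y 3) ler_wpM2l //; lra.
have gl : (2 * K + 4) * (1 + la) ^+ 2 <= gam / 2 * l.
  have := le_trans (ME _ Ml) yl; rewrite mulrAC ler_pdivrMr; last by rewrite divr_gt0.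
  by rewrite (mulrC l).
have Dla : D.+1%:R <= expR (2 * la).
  apply: le_trans DC _; have -> : 2 * la = la + la by ring.
  have Cp : C2 \is Num.pos by rewrite posrE; apply: lt_le_trans C21.
  by rewrite expRD -lE ler_wpM2r ?(ltW l0) // -[leLHS](lnK Cp) [leRHS]lE ler_expR.
have gamE : gam = gam / 2 + gam / 2 by field; move: dl0 => h0; lra.
rewrite gamE mulrDl expRD.
apply: (@le_trans _ _ (#|dense_sets G (2 * Lb).+2|%:R * ((2 * Lb).+2%:R * D.+1%:R ^+ Lb))).
  rewrite -natrX -!natrM ler_nat (leq_trans (cyclic_part_card L degD)) //.
  rewrite leq_mul ?dense_sets_mono ?leq_mul ?leq_pexp2l // ?ltnS ?leq_mul //.
apply: ler_pM => //.
apply: (@le_trans _ _ (expR ((2 * Lb).+2%:R) * expR (Lb%:R * (2 * la)))).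
  apply: ler_pM => //.
    by apply: le_trans (expR_ge1Dx _); rewrite lerDr.
  by rewrite expRM_natl lerXn2r ?nnegrE ?expR_ge0.
rewrite -expRD ler_expR; apply: le_trans gl.
have -> : (2 * Lb).+2%:R = 2 * Lb%:R + 2 :> R by rewrite -addn2 natrD natrM.
have la0 : 0 <= la by lra.
have := ler_wpM2r la0 wb; rewrite expr2; have Kl : 0 <= K * la by rewrite mulr_ge0 //; lra.
have Kll : 0 <= K * la * la by rewrite mulr_ge0.
nra.
Qed.

(** With $a = n^{(d-2)/(2d-2)}$ and $X = n^{d/(2d-2)}$ one has $Xa = n$: about $X$ labels make label
    classes of size about $a$, which is also the number of compatible prefixes. All other factors go
    into the excess. *)
Lemma tww_le : exists2 CM : R * R, 0 < CM.1 & forall n (G : sgraph 'I_n) D,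
  CM.2 <= ln (ln n%:R) -> (forall x, (degree G x <= D)%N) -> D.+1%:R <= C2 * ln n%:R ->
  2 + 2 * dl <= mad R G ->
  #|dense_sets G (2 * walk_bound dl (ln n%:R)).+2|%:R <= expR (gam / 2 * ln n%:R) ->
  let d := mad R G in
  (tww G)%:R <= n%:R `^ ((d - 2) / (2 * d - 2)) * expR (CM.1 * excess (ln n%:R) d).
Proof.
have [[CL ML] /= CL0 walkL] := walk_length dl0 C21.
have [MX Xsmall] := cyclic_part_small.
pose C := CL + 40.
exists (C, Num.max ML (Num.max MX (4 * ln 70))) => [/=|n G D /=]; first by rewrite /C; lra.
rewrite !ge_max => /and3P[hL hX h70] degD DC dd dS; set d := mad R G in dd *.
have ln70 : 1 <= ln 70 :> R.
  have -> : 70 = 2 * 35 :> R by rewrite -natrM.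
  rewrite lnM ?posrE //; have := @ln2_ge R.
  have : ln 2 <= ln 35 :> R by rewrite ler_ln ?posrE // ler_nat.
  by lra.
have la1 : 1 <= ln (ln n%:R) :> R by lra.
have d2 : 2 <= d by move: dl0 dd => h0 h1; lra.
have l0 := l_gt0 la1.
have [L [LB Ll CLL]] := walkL _ _ hL dd.
have XS := Xsmall n G D L hX degD DC LB dS.
have n0 : (0 < n)%N by case: (n) l0 => // ; rewrite ln0 ?ltxx.
have nE : n%:R = expR (ln n%:R) :> R by rewrite lnK // posrE ltr0n.
have [t [h [t0 h1 h2 t1 t2]]] := slots_exist la1 d2.
have y70 : 70 <= expR (ln (ln n%:R) / 4) :> R.
  rewrite -[leLHS](lnK (_ : _ \is Num.pos)) ?posrE // ler_expR; lra.
have PB := patterns_bound la1 d2 t0 h1 h2 t2.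
have Phi1 := la_excess la1 d2.
have FB := free_bits_bound la1 d2 t0 h1 h2 t1 t2.
have RB := reuse_bound la1 d2 t0 h1.
have hh : 0 < h%:R :> R := h_gt0 la1 d2 t0 h1.
have th : t%:R <= h%:R :> R := t_le_h la1 d2 t0 h1.
have [sg [sgA sgC]] := orientation (mad_orientation h1).
set l : R := ln n%:R in nE LB Ll CLL XS DC dS l0 la1 t1 t2 y70 PB Phi1 FB hL *.
have /PB{}PB : 64 <= expR (ln l / 4) by lra.
set Phi := excess l d in PB FB Phi1 CLL *.
rewrite {1}/powR gt_eqF ?ltr0n // -/l.
set a := expR _.
have frac_ge0 (u v : R) : 0 <= u -> 0 < v -> 0 <= u / v * l.
  by move=> u0 v0; rewrite mulr_ge0 ?divr_ge0 ?(ltW v0) ?(ltW l0).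
have dm2 : 0 <= d - 2 by rewrite subr_ge0.
have d22 : 0 < 2 * d - 2 by clear -d2; lra.
have d0 : 0 < d by clear -d2; lra.
have a1 : 1 <= a by rewrite -(expR0 R) ler_expR frac_ge0.
pose X := expR (d / (2 * d - 2) * l).
have XaN : X * a = n%:R.
  by rewrite -expRD -mulrDl -mulrDl [RHS]nE; congr expR; rewrite -/l; field; lra.
have X1 : 1 <= X by rewrite -(expR0 R) ler_expR frac_ge0 // ltW.
have [Phi0 bud1 bud2 bud3] := excess_budget CL0 la1 Phi1.
have [m [mX Xm]] := binary_scale X1.
have mB : m%:R * ln 2 <= d / (2 * d - 2) * l.
  by rewrite -ler_expR expRM_natl lnK ?posrE.
have m2 : m%:R <= 2 * l.
  have e1 : d / (2 * d - 2) * l <= l by rewrite ler_piMl ?(ltW l0) // (exponent_le la1 d2).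
  have := ler_wpM2l (ler0n R m) (@ln2_ge R); lra.
(* As $2^{m+1} > X$ and $Xa = n$, the term $16a$ gives $8n \le s2^m$; the summand [m] gives $m < s$.
   Both are needed in [factorial_dominates]. *)
pose s := ((Num.truncn (16 * a)).+1 + m)%N.
have s16 : 16 * a <= s%:R by rewrite /s natrD ltW // (lt_le_trans (truncnS_gt _)) // lerDl.
have sup : s%:R <= 16 * a + 1 + 2 * l.
  rewrite /s natrD -natr1 lerD ?lerD2r ?truncn_le ?mulr_ge0 //; lra.
have fd : (2 ^ m * #|'I_n| ^ s < s`! * 2 ^ (m * s))%N.
  rewrite card_ord; apply: factorial_dominates => //; last by rewrite /s addSn ltnS leq_addl.
  rewrite -(ler_nat R) !natrM natrX -XaN.
  have p0 : 0 <= (2 : R) ^+ m by rewrite exprn_ge0.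
  have := ler_wpM2r p0 s16; have := ler_wpM2l (le_trans ler01 a1) (ltW Xm); rewrite exprS.
  by move: (2 ^+ m) (s%:R) => u v; clear; lra.
pose E := Num.truncn (m%:R * (1 - t%:R / h%:R) + 2 * t%:R : R).
have u0 : 0 <= 1 - t%:R / h%:R :> R by rewrite subr_ge0 ler_pdivrMr // mul1r.
have E0 : 0 <= m%:R * (1 - t%:R / h%:R) + 2 * t%:R :> R by rewrite addr_ge0 ?mulr_ge0.
have EB : 2 ^+ E <= a * expR (6 * Phi + 2) by apply: FB mB _; rewrite truncn_le.
pose W := a * expR (C * Phi); have W0 : 0 <= W by rewrite mulr_ge0 ?expR_ge0.
suff cs : has_contraction_sequence (Num.truncn W) (trigraph_of G).
  have [|_ tmin] := @tww_spec _ G; first by rewrite card_ord.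
  by rewrite -truncn_ge_nat ?tmin.
have hN : (0 < h)%N by rewrite -(ltr0n R).
have thN : (t <= h)%N by rewrite -(ler_nat R).
apply: (@contraction_of_labels _ G h t m L D hN thN sg sgA sgC _ degD (cyclic_part G L) _ s E) => //.
- rewrite -(ltr_nat R) natrM !natrX.
  have tR : 0 < t%:R :> R by rewrite ltr0n.
  apply: (@lt_le_trans _ _ ((d / 2) ^+ L * t%:R ^+ L)).
    by rewrite ltr_pM2r ?exprn_gt0 //; apply: le_lt_trans m2 Ll.
  rewrite -exprMn; apply: lerXn2r; rewrite ?nnegrE ?ler0n //; first by rewrite mulr_ge0 ?divr_ge0 // ltW.
  by apply: le_trans h1; rewrite mulrC mulrA.
- by move=> x; exact: unique_walksP.
- by rewrite card_ord.
- by move=> k km; rewrite truncn_ge_nat // RB.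
- rewrite truncn_ge_nat // !natrM natrX.
  have Dp : 0 <= D.+1%:R :> R by [].
  apply: (@le_trans _ _ (s%:R * (C2 * l) ^+ (L + L + 1))).
    rewrite -mulrA ler_wpM2l // addn1 exprSr; apply: ler_pM => //.
      by rewrite lerXn2r ?nnegrE // (le_trans Dp DC).
    by apply: le_trans DC; rewrite ler_nat.
  have sB : s%:R <= a * expR (2 * ln l).
    have lE : l = expR (ln l) := l_expR la1.
    have -> : expR (2 * ln l) = l * l by rewrite [in RHS]lE -expRD; congr expR; ring.
    have l70 : 70 <= l.
      rewrite (l_y4 la1) (le_trans y70) // -[leLHS]expr1 ler_weXn2l //; clear -y70; lra.
    have al : l <= a * l by rewrite ler_peMl // ltW.
    apply: (@le_trans _ _ (a * (17 + 2 * l))).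
      by rewrite mulrDr; move: sup a1 al; clear; lra.
    by rewrite ler_wpM2l ?expR_ge0 // add_le_sqr.
  rewrite /W; apply: le_trans (ler_pM _ _ sB CLL) _ => //; first by rewrite exprn_ge0 // (le_trans Dp DC).
  rewrite -mulrA -expRD ler_wpM2l ?expR_ge0 // ler_expR /C.
  exact: bud1.
- rewrite truncn_ge_nat // natrD !natrM !natrX natrM.
  have Xa : #|cyclic_part G L|%:R <= a.
    by apply: le_trans XS _; rewrite ler_expR ler_wpM2r ?(ltW l0) // exponent_ge.
  have e1 : 1 <= expR (8 * Phi + 4) by apply: le_trans (expR_ge1Dx _); rewrite lerDl.
  have b1 : (2 * h%:R) ^+ t * 2 ^+ E * 2 <= a * expR (8 * Phi + 4).
    have pe : 0 <= (2 * h%:R) ^+ t :> R by rewrite exprn_ge0 // mulr_ge0.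
    apply: le_trans (ler_pM _ _ (ler_pM _ _ PB EB) (@two_le_expR1 R)) _ => //.
    rewrite [leLHS]mulrAC [leLHS]mulrCA ler_wpM2l ?expR_ge0 // mulrAC -!expRD ler_expR.
    by rewrite le_eqVlt; apply/orP; left; apply/eqP; ring.
  apply: (@le_trans _ _ (a * (expR (8 * Phi + 4) * expR 1))).
    exact: add_le_mul Xa b1 (expR_ge0 _) e1 (@two_le_expR1 R).
  by rewrite /W -expRD ler_wpM2l ?expR_ge0 // ler_expR.
Qed.

End UpperBound.

(** * Typical sparse graphs *)

Section NumericBounds.
Variable R : realType.

Lemma bin_le_pow (n r : nat) : (0 < r)%N -> 'C(n, r)%:R <= (4 * n%:R / r%:R) ^+ r :> R.
Proof.
move=> r0; rewrite expr_div_n ler_pdivlMr ?exprn_gt0 ?ltr0n // -!natrM -!natrX -natrM ler_nat.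
apply: leq_trans (leq_mul (leqnn _) (expn_fact r)) _.
rewrite mulnCA bin_ffact expnMn leq_mul2l; apply/orP; right.
rewrite ffact_prod -[X in (_ <= n ^ X)%N](card_ord r) -prod_nat_const.
by apply: leq_prod => i _; exact: leq_subr.
Qed.

Lemma quarter_le : 1 / 4 <= expR (-1) :> R.
Proof.
have h : 0 < expR (- (1 / 2)) :> R by apply: expR_gt0.
have e : expR (-1) = expR (- (1 / 2)) * expR (- (1 / 2)) :> R by rewrite -expRD; congr expR; field.
have := expR_ge1Dx (- (1 / 2) : R); rewrite e; nra.
Qed.

Lemma sum_half_le (b : R) k : 0 <= b -> \sum_(i < k) b * (1 / 2) ^+ i <= 2 * b.
Proof.
move=> b0; suff -> : \sum_(i < k) b * (1 / 2) ^+ i = 2 * b - 2 * b * (1 / 2) ^+ k.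
  by rewrite gerBl mulr_ge0 ?exprn_ge0 ?mulr_ge0 //; lra.
elim: k => [|k IH]; first by rewrite big_ord0 expr0 mulr1 subrr.
by rewrite big_ord_recr IH /= exprS; field.
Qed.

End NumericBounds.

Section TypicalGraphs.
Variables (R : realType) (n : nat) (mu : sgraph 'I_n -> R) (B : R).
Hypotheses (mu_ge0 : forall G, 0 <= mu G) (n0 : (0 < n)%N) (B1 : 1 <= B).
Local Notation P := (graph_prob mu).
Hypothesis sparse : forall F : {set {set 'I_n}}, P (fun G => F \subset edges G) <= (B / n%:R) ^+ #|F|.

Let B0 : 0 < B. Proof. exact: lt_le_trans B1. Qed.
Let nR : 0 < n%:R :> R. Proof. by rewrite ltr0n. Qed.
Let q0 : 0 <= B / n%:R. Proof. by rewrite divr_ge0 ?(ltW B0). Qed.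

Lemma prob_degree_le r : (0 < r)%N -> 16 * B <= r%:R ->
  P (fun G => [exists x, (r <= degree G x)%N]) <= n%:R * expR (- r%:R).
Proof.
move=> r0 rB; have rR : 0 < r%:R :> R by rewrite ltr0n.
apply: le_trans (prob_degree mu_ge0 q0 sparse r) _; rewrite ler_wpM2l //.
apply: (@le_trans _ _ ((4 * n%:R / r%:R) ^+ r * (B / n%:R) ^+ r)).
  by rewrite ler_wpM2r ?exprn_ge0 // bin_le_pow.
rewrite -exprMn -[- r%:R]mulrN1 expRM_natl; apply: lerXn2r; rewrite ?nnegrE ?expR_ge0 //.
  by rewrite mulr_ge0 // divr_ge0 ?mulr_ge0.
apply: le_trans (quarter_le R).
have -> : 4 * n%:R / r%:R * (B / n%:R) = 4 * B / r%:R by field; rewrite !gt_eqF.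
by rewrite ler_pdivrMr //; lra.
Qed.

(** An [i]-set with [i] edges has $n^i$ choices and the factor $(B/n)^i$: the powers of $n$
    cancel. *)
Lemma expected_dense_count l : (0 < l)%N ->
  \sum_G mu G * #|dense_sets G l|%:R <= l%:R * (l%:R ^+ 2 * B) ^+ l.
Proof.
move=> l0; have lR : 1 <= l%:R :> R by rewrite ler1n.
have lB : 1 <= l%:R ^+ 2 * B by rewrite mulr_ege1 // exprn_ege1.
apply: (@le_trans _ _ (\sum_(i < l) \sum_(W : {set 'I_n} | #|W| == i.+1) P (fun G => (i.+1 <= #|edges_in G W|)%N))).
  have -> : \sum_G mu G * #|dense_sets G l|%:R = \sum_G \sum_(W in dense_sets G l) mu G.
    by apply: eq_bigr => G _; rewrite sumr_const mulr_natr.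
  rewrite (exchange_big_dep xpredT) //=.
  rewrite [leLHS](_ : _ = \sum_(W : {set 'I_n} | (0 < #|W| <= l)%N) P (fun G => (#|W| <= #|edges_in G W|)%N)); last first.
    rewrite [in RHS]big_mkcond; apply: eq_bigr => W _; case: ifPn => [/andP[W0 Wl]|Wn].
      by apply: eq_bigl => G; rewrite inE Wl -card_gt0 W0.
    by apply: big_pred0 => G; rewrite inE -card_gt0 andbA (negbTE Wn).
  rewrite (exchange_big_dep (fun W : {set 'I_n} => (0 < #|W| <= l)%N)) /=; last first.
    by move=> i W _ /eqP ->; rewrite ltn_ord.
  apply: ler_sum => W /andP[W0 Wl].
  have h : (#|W|.-1 < l)%N by rewrite (leq_trans _ Wl) // prednK.
  rewrite (bigD1 (Ordinal h)) /= ?prednK // ?eqxx // lerDl.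
  by apply: sumr_ge0 => i _; exact: graph_prob_ge0.
apply: (@le_trans _ _ (\sum_(i < l) (l%:R ^+ 2 * B) ^+ l)); last first.
  by rewrite sumr_const card_ord mulr_natl.
apply: ler_sum => i _; apply: le_trans (expected_dense_sets mu_ge0 q0 sparse _ _) _.
have il : i.+1%:R <= l%:R :> R by rewrite ler_nat ltn_ord.
apply: (@le_trans _ _ ((l%:R ^+ 2 * B) ^+ i.+1)); last by rewrite ler_weXn2l.
have bs (a k : nat) : ('C(a, k) <= a ^ k)%N.
  rewrite (leq_trans (leq_pmulr _ (fact_gt0 k))) // bin_ffact ffact_prod -[X in (_ <= a ^ X)%N](card_ord k) -prod_nat_const.
  by apply: leq_prod => j _; exact: leq_subr.
apply: (@le_trans _ _ ((n ^ i.+1 * (i.+1 * i.+1) ^ i.+1)%N%:R * (B / n%:R) ^+ i.+1)).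
  by rewrite ler_wpM2r ?exprn_ge0 // ler_nat leq_mul.
rewrite natrM !natrX natrM -!exprMn; apply: lerXn2r; rewrite ?nnegrE.
- by rewrite mulr_ge0 // !mulr_ge0.
- by rewrite mulr_ge0 ?exprn_ge0 // ltW.
have -> : n%:R * (i.+1%:R * i.+1%:R) * (B / n%:R) = i.+1%:R * i.+1%:R * B by field; rewrite gt_eqF.
by rewrite ler_wpM2r ?(ltW B0) // expr2 ler_pM.
Qed.

(** Put $x = 4sB/n$ for sets of size $s$. One edge per vertex pays for the choice of the set up to
    $(16B)^s$, and the further $dl \cdot s$ edges give $x^{dl\,s}$. The product is at most $b^s$,
    and these terms are summed as a geometric series. *)
Lemma prob_small_dense_set (dl b : R) (smax : nat) : 0 < dl -> 0 < b -> b <= 1 / 2 ->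
  4 * smax%:R * B / n%:R <= 1 -> 16 * B * (4 * smax%:R * B / n%:R) `^ dl <= b ->
  P (fun G => [exists S : {set 'I_n}, [&& S != set0, (#|S| <= smax)%N & (1 + dl) * #|S|%:R <= #|edges_in G S|%:R]])
  <= 2 * b.
Proof.
move=> dl0 b0 b2 x1 xb.
apply: le_trans (sum_half_le smax (ltW b0)).
have ceil s : exists e : nat, (1 + dl) * s%:R <= e%:R /\ forall j : nat, (1 + dl) * s%:R <= j%:R -> (e <= j)%N.
  have [|e [e1 _ e3]] := @nat_ceil R ((1 + dl) * s%:R); first by rewrite mulr_ge0 //; lra.
  by exists e.
pose E (i : 'I_smax) G := [exists S : {set 'I_n}, (#|S| == i.+1) && ((1 + dl) * i.+1%:R <= #|edges_in G S|%:R)].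
apply: le_trans (graph_prob_union mu_ge0 (D := xpredT) (E := E) _) _.
  move=> G /existsP[S /and3P[S0 Sm SE]]; rewrite -card_gt0 in S0.
  have h : (#|S|.-1 < smax)%N by rewrite (leq_trans _ Sm) // prednK.
  by exists (Ordinal h) => //; apply/existsP; exists S; rewrite /= prednK // eqxx.
apply: ler_sum => i _; set s := i.+1; have [e [e1 e2]] := ceil s.
have sR : 0 < s%:R :> R by rewrite ltr0n.
have se : (s <= e)%N.
  by rewrite -(ler_nat R); apply: le_trans e1; rewrite mulrDl mul1r lerDl mulr_ge0 // ltW.
have e0 : (0 < e)%N by rewrite (leq_trans _ se).
apply: (@le_trans _ _ (\sum_(W : {set 'I_n} | #|W| == s) P (fun G => (e <= #|edges_in G W|)%N))).
  apply: (graph_prob_union mu_ge0) => G /existsP[S /andP[Ss SE]].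
  by exists S => //; exact: e2.
apply: le_trans (expected_dense_sets mu_ge0 q0 sparse _ _) _.
set x := 4 * s%:R * B / n%:R.
have x0 : 0 < x by rewrite divr_gt0 ?mulr_gt0.
have xle : x <= 4 * smax%:R * B / n%:R.
  by rewrite ler_wpM2r ?invr_ge0 // ler_wpM2r ?(ltW B0) // ler_wpM2l // ler_nat /s ltn_ord.
have xx1 : x <= 1 := le_trans xle x1.
have step1 : 'C(s * s, e)%:R * (B / n%:R) ^+ e <= x ^+ e.
  apply: (@le_trans _ _ ((4 * (s * s)%N%:R / e%:R) ^+ e * (B / n%:R) ^+ e)).
    by rewrite ler_wpM2r ?exprn_ge0 // bin_le_pow.
  rewrite -exprMn; apply: lerXn2r; rewrite ?nnegrE ?(ltW x0) //.
    by rewrite mulr_ge0 // divr_ge0.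
  rewrite /x -mulrA -[leRHS]mulrA ler_wpM2r // natrM; last first.
    have ss : s%:R * s%:R / e%:R <= s%:R :> R by rewrite ler_pdivrMr ?ltr0n // ler_wpM2l // ler_nat.
    by move: ss; rewrite -[leLHS]mulrA; lra.
have step2 : x ^+ e <= x ^+ s * (x `^ dl) ^+ s.
  rewrite -powR_mulrn ?(ltW x0) // -[x ^+ s]powR_mulrn ?(ltW x0) // -powR_mulrn ?powR_ge0 // -powRrM.
  have <- : x `^ (s%:R + dl * s%:R) = x `^ s%:R * x `^ (dl * s%:R) by rewrite powRD // (gt_eqF x0) implybT.
  rewrite /powR gt_eqF // ler_expR; apply: ler_wnM2r; first by rewrite ln_le0.
  by move: e1; rewrite mulrDl mul1r.
have step3 : 'C(n, s)%:R * x ^+ s <= (16 * B) ^+ s.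
  apply: (@le_trans _ _ ((4 * n%:R / s%:R) ^+ s * x ^+ s)).
    by rewrite ler_wpM2r ?exprn_ge0 ?(ltW x0) // bin_le_pow.
  rewrite -exprMn; have -> : 4 * n%:R / s%:R * x = 16 * B by rewrite /x; field; rewrite !gt_eqF.
  exact: lexx.
apply: (@le_trans _ _ ('C(n, s)%:R * (x ^+ s * (x `^ dl) ^+ s))).
  by rewrite natrM -mulrA ler_wpM2l // (le_trans step1).
rewrite mulrA; apply: (@le_trans _ _ (b ^+ s)).
  apply: (@le_trans _ _ ((16 * B) ^+ s * (x `^ dl) ^+ s)); first by rewrite ler_wpM2r ?exprn_ge0 ?powR_ge0.
  rewrite -exprMn; apply: lerXn2r; rewrite ?nnegrE ?(ltW b0) //.
    by rewrite mulr_ge0 ?powR_ge0 // mulr_ge0 // ltW.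
  apply: le_trans xb; rewrite ler_wpM2l ?mulr_ge0 ?(ltW B0) //.
  by rewrite ge0_ler_powR ?nnegrE ?(ltW x0) ?(ltW dl0) // (le_trans (ltW x0)).
rewrite /s exprS ler_wpM2l ?(ltW b0) //; apply: lerXn2r; rewrite ?nnegrE ?(ltW b0) //.
Qed.

End TypicalGraphs.

(** * The lower bound *)

Lemma log_dominated (R : realType) (A : R) : exists2 M : R, 1 <= M & forall l, M <= ln l -> A * (1 + ln l) ^+ 2 <= l.
Proof.
have [M M1 ME] := exp_dominates A; exists M => // l Ml; have la1 : 1 <= ln l by lra.
by apply: le_trans (ME _ Ml) _; rewrite [leRHS](l_expR la1) ler_expR; lra.
Qed.

Lemma has_contraction_sequence_mono (T : finType) (G : trigraph T) w w' : (w <= w')%N ->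
  has_contraction_sequence w G -> has_contraction_sequence w' G.
Proof.
move=> ww [k [H [H0 Hs Hl Hr]]]; exists k, H; split => // i x ik xH.
exact: leq_trans (Hr i x ik xH) ww.
Qed.

Section LowerBound.
Variables (R : realType) (n : nat) (mu : sgraph 'I_n -> R) (B : R).
Hypotheses (mu_ge0 : forall G, 0 <= mu G) (n0 : (0 < n)%N) (B1 : 1 <= B).
Local Notation P := (graph_prob mu).
Hypothesis sparse : forall F : {set {set 'I_n}}, P (fun G => F \subset edges G) <= (B / n%:R) ^+ #|F|.
Variables (C0 C1 c l d u a : R) (s e w D : nat).
Local Notation kap := (8 * C1 + 10).
Local Notation x := (expR (- (l / (d - 1)))).
Hypotheses (C01 : 1 <= C0) (C11 : 1 <= C1) (c0 : 0 < c) (cE : c * (8 * 8 * 8 * C0) = expR (- kap)).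
Hypotheses (l1 : 1 <= l) (nE : n%:R = expR l) (s0 : (0 < s)%N) (dE : d * s%:R = 2 * e%:R)
  (d2 : 2 <= d) (BC : B <= C0 * d) (sn : (s <= n)%N).
(* [u = d / sqrt l] *)
Hypotheses (u0 : 0 < u) (ud : u <= d) (uE : u ^+ 2 * l = d ^+ 2) (u2 : u ^+ 2 <= C1 * d).
Hypotheses (aE : a = expR ((d - 2) / (2 * d - 2) * l)) (wD : (w + D + 1)%:R <= 2 * (c * u * a))
  (au : u < a) (as2 : 2 * (a / u) <= s%:R).

Let l0 : 0 < l. Proof. exact: lt_le_trans l1. Qed.
Let sR : 0 < s%:R :> R. Proof. by rewrite ltr0n. Qed.
Let nR : 0 < n%:R :> R. Proof. by rewrite ltr0n. Qed.
Let d0 : 0 < d. Proof. exact: lt_le_trans d2. Qed.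
Let C00 : 0 < C0. Proof. exact: lt_le_trans C01. Qed.
Let a0 : 0 < a. Proof. by rewrite aE expR_gt0. Qed.
Let d1 : 0 < d - 1. Proof. by move: (d2); lra. Qed.
Let d22 : 2 * d - 2 != 0. Proof. by rewrite gt_eqF //; move: (d2); lra. Qed.
Let B0 : 0 < B. Proof. exact: lt_le_trans B1. Qed.

Let a2 : a ^+ 2 = n%:R * x.
Proof.
rewrite nE aE -expRD -expRM_natl; congr expR; field.
by rewrite d22 gt_eqF.
Qed.

Let nau : n%:R / a = expR (d / (2 * d - 2) * l).
Proof. by rewrite nE aE -expRN -expRD; congr expR; field. Qed.

Lemma block_size : exists sz : nat, [/\ (2 <= sz)%N, a / u <= sz%:R & sz%:R <= 2 * (a / u)].
Proof.
have au1 : 1 < a / u by rewrite ltr_pdivlMr // mul1r.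
have [|sz [h1 h2 _]] := @nat_ceil R (a / u); first by rewrite divr_ge0 ?(ltW u0) // ltW.
exists sz; split => //; last by move: au1 h2; lra.
by rewrite -(ltr_nat R); apply: lt_le_trans au1 h1.
Qed.

Section Block.
Variable sz : nat.
Hypotheses (sz2 : (2 <= sz)%N) (szl : a / u <= sz%:R) (szu : sz%:R <= 2 * (a / u)).
Local Notation N := (s %/ sz)%N.
Local Notation r := (N.+1 * (w + D + 1))%N.

Let szR : 0 < sz%:R :> R. Proof. by rewrite ltr0n (leq_trans _ sz2). Qed.

Lemma blocks_le : N.+1%:R <= 2 * s%:R * u / a.
Proof.
have szs : (sz <= s)%N by rewrite -(ler_nat R); apply: le_trans szu as2.
apply: (@le_trans _ _ (2 * s%:R / sz%:R)).
  rewrite ler_pdivlMr // -natrM -natrM ler_nat mulSn mul2n -addnn leq_add //.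
  exact: leq_divM.
rewrite -[leRHS]mulrA ler_wpM2l ?mulr_ge0 // -[leRHS]invf_div lef_pV2 // posrE divr_gt0 //.
Qed.

Lemma arcs_le : r%:R <= 4 * c * s%:R * u ^+ 2.
Proof.
rewrite natrM; apply: le_trans (ler_pM _ _ blocks_le wD) _ => //.
by rewrite le_eqVlt; apply/orP; left; apply/eqP; field; rewrite gt_eqF.
Qed.

(** Choosing the set and its partition costs at most $(8u\,n/a)^s$: the size $s$ cancels, $n/a =
    n^{d/(2d-2)}$, and $8 \le e^3$, $u \le e^d$. *)
Lemma count_parts : 'C(n, s)%:R * N.+1%:R ^+ s <= expR (s%:R * (3 + d + d / (2 * d - 2) * l)).
Proof.
rewrite expRM_natl; apply: (@le_trans _ _ ((4 * n%:R / s%:R) ^+ s * (2 * s%:R * u / a) ^+ s)).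
  apply: ler_pM => //.
    exact: bin_le_pow.
  by rewrite lerXn2r ?nnegrE ?blocks_le // (le_trans _ blocks_le).
rewrite -exprMn; apply: lerXn2r; rewrite ?nnegrE ?expR_ge0 //.
  by rewrite mulr_ge0 ?divr_ge0 ?mulr_ge0 // ltW.
have -> : 4 * n%:R / s%:R * (2 * s%:R * u / a) = 8 * u * (n%:R / a).
  by field; rewrite !gt_eqF.
rewrite nau !expRD; apply: ler_pM => //; [by rewrite mulr_ge0 // ltW|].
apply: ler_pM => //; first exact: ltW.
  have h := @two_le_expR1 R; have h2 := ler_pM (ler0n R 2) (ler0n R 2) h h.
  by have := ler_pM (ler0n R 2) (mulr_ge0 (ler0n R 2) (ler0n R 2)) h h2; lra.
by apply: le_trans ud _; apply: le_trans (expR_ge1Dx _); rewrite lerDr.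
Qed.

(** [card_small_subsets] with $x = e^{-l/(d-1)} = a^2/n$. The number of blocks is at most $2su/a$,
    so $N^2x \le 4su^2 \cdot s/n$; and $x^{-r}$ costs $4csu^2\,l/(d-1)$, which is $O(csd)$ as $u^2l
    = d^2$. *)
Lemma count_arcs : #|[set Q : {set 'I_N.+1 * 'I_N.+1} | (#|Q| <= r)%N]|%:R <=
  expR (s%:R * (4 * C1 * d)) * expR (s%:R * d).
Proof.
have x1 : x <= 1 by rewrite expR_le1 oppr_le0 divr_ge0 // ltW.
apply: le_trans (card_small_subsets _ _ (expR_gt0 _) x1) _.
apply: ler_pM; rewrite ?invr_ge0 ?exprn_ge0 ?addr_ge0 ?expR_ge0 //.
  apply: (@le_trans _ _ (expR x ^+ #|{: 'I_N.+1 * 'I_N.+1}|)).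
    by apply: lerXn2r; rewrite ?nnegrE ?expR_ge0 ?expR_ge1Dx // addr_ge0 ?expR_ge0.
  rewrite -expRM_natl ler_expR card_prod card_ord natrM.
  have N2 : N.+1%:R * N.+1%:R <= (2 * s%:R * u / a) * (2 * s%:R * u / a) by rewrite ler_pM ?blocks_le.
  apply: (le_trans (ler_wpM2r (expR_ge0 _) N2)).
  have -> : 2 * s%:R * u / a * (2 * s%:R * u / a) * x = 4 * s%:R * u ^+ 2 * (s%:R * (x / a ^+ 2)).
    by field; rewrite gt_eqF.
  have -> : x / a ^+ 2 = n%:R^-1 by rewrite a2; field; rewrite !gt_eqF ?expR_gt0.
  have sn1 : s%:R / n%:R <= 1 :> R by rewrite ler_pdivrMr // mul1r ler_nat.
  have -> : s%:R * (4 * C1 * d) = 4 * s%:R * (C1 * d) by ring.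
  apply: (@le_trans _ _ (4 * s%:R * u ^+ 2)); first by rewrite ler_piMr // mulr_ge0 ?sqr_ge0 // mulr_ge0.
  by rewrite ler_wpM2l // mulr_ge0.
rewrite -exprVn -expRN opprK -expRM_natl ler_expR.
have ld : 0 <= l / (d - 1) by rewrite divr_ge0 // ltW.
apply: (le_trans (ler_wpM2r ld arcs_le)).
have -> : 4 * c * s%:R * u ^+ 2 * (l / (d - 1)) = s%:R * d * (4 * c * (d / (d - 1))).
  have -> : 4 * c * s%:R * u ^+ 2 * (l / (d - 1)) = 4 * c * s%:R / (d - 1) * (u ^+ 2 * l) by field; rewrite gt_eqF.
  by rewrite uE; field; rewrite gt_eqF.
rewrite ler_piMr ?mulr_ge0 ?(ltW d0) //.
have c8 : c <= 1 / 8.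
  have e1 : expR (- kap) <= 1 by rewrite expR_le1; move: (C11); lra.
  have cC : c <= c * C0 by rewrite ler_peMr // ltW.
  by move: cE (c0) e1 cC; lra.
have dd : d / (d - 1) <= 2 by rewrite ler_pdivrMr // ; move: (d2); lra.
have dd0 : 0 <= d / (d - 1) by rewrite divr_ge0 // ltW.
have := ler_pM (ltW c0) dd0 c8 dd; lra.
Qed.

(** The recorded pairs of blocks contain at most $64csa^2$ pairs of vertices. By $ds = 2e$ and $a^2
    = nx$ each edge contributes at most $512\,c\,C_0\,x$; hypothesis [cE] is made for this. *)
Lemma count_edges : 'C(r * (2 * sz * (2 * sz)), e)%:R * (B / n%:R) ^+ e <=
  expR (e%:R * (- kap - l / (d - 1))).
Proof.
have eR : 0 < e%:R :> R by rewrite -(pmulr_rgt0 _ (ltr0n R 2)) -dE mulr_gt0.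
have e0 : (0 < e)%N by rewrite -(ltr0n R).
apply: (@le_trans _ _ ((4 * (r * (2 * sz * (2 * sz)))%N%:R / e%:R) ^+ e * (B / n%:R) ^+ e)).
  by rewrite ler_wpM2r ?exprn_ge0 ?divr_ge0 ?(ltW B0) // bin_le_pow.
rewrite -exprMn expRM_natl; apply: lerXn2r; rewrite ?nnegrE ?expR_ge0 //.
  by rewrite mulr_ge0 ?divr_ge0 ?mulr_ge0 // ltW.
have sz4 : sz%:R * sz%:R <= 4 * (a / u) ^+ 2.
  have -> : 4 * (a / u) ^+ 2 = 2 * (a / u) * (2 * (a / u)) by ring.
  by rewrite ler_pM.
have rz : (r * (2 * sz * (2 * sz)))%N%:R <= 64 * c * s%:R * a ^+ 2.
  have -> : (r * (2 * sz * (2 * sz)) = 4 * (r * (sz * sz)))%N by rewrite [(2 * sz * _)%N]mulnACA mulnCA.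
  rewrite natrM [X in 4 * X]natrM [(sz * sz)%:R]natrM.
  have := ler_pM (ler0n _ _) (mulr_ge0 (ltW szR) (ltW szR)) arcs_le sz4.
  have -> : 4 * c * s%:R * u ^+ 2 * (4 * (a / u) ^+ 2) = 16 * c * s%:R * a ^+ 2.
    by field; rewrite gt_eqF.
  by move=> h; have := ler_wpM2l (ler0n R 4) h; lra.
have q : B / n%:R <= C0 * d / n%:R by rewrite ler_wpM2r // invr_ge0.
apply: (@le_trans _ _ (4 * (64 * c * s%:R * a ^+ 2) / e%:R * (C0 * d / n%:R))).
  apply: ler_pM => //; first by rewrite divr_ge0 // ltW.
  by rewrite ler_wpM2r ?invr_ge0 // ler_wpM2l.
rewrite expRD a2.
have -> : 4 * (64 * c * s%:R * (n%:R * x)) / e%:R * (C0 * d / n%:R) =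
    1 / 2 * (c * (8 * 8 * 8 * C0)) * ((d * s%:R) / e%:R) * x by field; rewrite !gt_eqF.
rewrite dE cE; have -> : 2 * e%:R / e%:R = 2 :> R by field; rewrite gt_eqF.
by rewrite le_eqVlt; apply/orP; left; apply/eqP; field.
Qed.

End Block.

(** The terms with $l$ cancel, since $e/(d-1) = sd/(2d-2)$. The constant $8C_1 + 10$, multiplied by
    $e = ds/2$, beats the remaining $s(3 + 2d + 4C_1d)$ and leaves $s(3 - 3d)$. *)
Lemma prob_small_tww :
  P (fun G => [exists W : {set 'I_n}, (#|W| == s) && (e <= #|edges_in G W|)%N] &&
     [forall y, (degree G y <= D)%N] && `[< has_contraction_sequence w (trigraph_of G) >])
  <= expR (- (2 * s%:R)).
Proof.
have [sz [sz2 szl szu]] := block_size.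
have q0 : 0 <= B / n%:R by rewrite divr_ge0 // ltW.
pose r := ((s %/ sz).+1 * (w + D + 1))%N.
apply: le_trans (le_trans (graph_prob_le mu_ge0 _) (prob_covered mu_ge0 q0 sparse (s %/ sz) r (2 * sz) s e)) _.
  move=> G /andP[/andP[/existsP[W /andP[/eqP Ws We]] /forallP degD] /asboolP hG].
  apply/existsP; exists W; rewrite We Ws eqxx /=.
  have [bk [Q cov]] := covers_of_contraction W sz2 degD hG.
  rewrite Ws in bk Q cov; apply/existsP; exists bk; apply/existsP; exists Q; exact: cov.
rewrite !natrM natrX.
have c1 := count_parts sz2 szl szu; have c2 := count_arcs sz2 szl szu; have c3 := count_edges sz2 szl szu.
rewrite -mulrA.
apply: le_trans (ler_pM _ _ (ler_pM _ _ c1 c2) c3) _; rewrite ?mulr_ge0 ?exprn_ge0 //.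
rewrite -!expRD ler_expR.
have -> : e%:R * (- kap - l / (d - 1)) = s%:R * (- (d / 2 * kap) - d / (2 * d - 2) * l).
  have -> : e%:R = d * s%:R / 2 by rewrite dE; field.
  by field; rewrite d22 gt_eqF.
have -> : s%:R * (3 + d + d / (2 * d - 2) * l) + (s%:R * (4 * C1 * d) + s%:R * d) +
    s%:R * (- (d / 2 * kap) - d / (2 * d - 2) * l) = s%:R * (3 - 3 * d) by field.
have h : 0 <= s%:R * (3 * d - 5) by rewrite mulr_ge0 //; move: (d2); lra.
by move: h; lra.
Qed.

End LowerBound.

(** * Estimates for large orders *)

Section LargeOrder.
Variable R : realType.
Implicit Types (dl C c l d B eta : R).

Lemma threshold (A M0 : R) : exists2 M : R, 1 <= M & forall l, M <= ln l ->
  [/\ A * (1 + ln l) ^+ 2 <= l, M0 <= ln l, 1 <= ln l & ln l <= l].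
Proof.
have [M M1 ME] := @log_dominated R A; have [M' M1' ME'] := @log_dominated R 1.
exists (Num.max M (Num.max M' M0)) => [|l]; first by rewrite le_max M1.
rewrite !ge_max => /and3P[h1 h2 h3]; have := ME' _ h2; rewrite mul1r expr2 => h4.
by split; [exact: ME|by []|lra|nra].
Qed.

Lemma many_dense_sets_bound dl C0 eta : 0 < dl -> 1 <= C0 -> 0 < eta -> exists M : R, forall l B k,
  M <= ln l -> 1 <= B -> B <= C0 * l -> k = (2 * walk_bound dl l).+2 ->
  k%:R * (k%:R ^+ 2 * B) ^+ k <= eta * expR (dl / (1 + 2 * dl) / 2 * l).
Proof.
move=> dl0 C01 e0; set g := dl / (1 + 2 * dl).
have g0 : 0 < g by rewrite divr_gt0 //; lra.
have K5 := walk_scale_ge dl0; set K := walk_scale dl in K5.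
pose A0 := 2 * K + 4; pose A1 := A0 * (2 * A0 + 3).
have [M M1 ME] := threshold (A1 / (g / 4)) (Num.max (ln C0) (- ln eta / (g / 4))).
exists M => l B k Ml B1 BC kE; have [h1 h2 la1 lal] := ME _ Ml.
move: h2; rewrite ge_max => /andP[hC he].
have wb := walk_bound_le dl0 la1; rewrite -/K in wb.
have lE := l_expR la1; have l0 := l_gt0 la1.
have kA : k%:R <= A0 * (1 + ln l).
  rewrite kE -addn2 natrD natrM /A0; have : 0 <= K by lra.
  by nra.
have k0 : 0 <= k%:R :> R by [].
have ke : k%:R <= expR k%:R :> R by apply: le_trans (expR_ge1Dx _); rewrite lerDr.
have Bla : B <= expR (2 * ln l).
  apply: le_trans BC _; have -> : 2 * ln l = ln l + ln l by ring.
  by rewrite expRD -lE ler_wpM2r ?(ltW l0) // -[leLHS]lnK ?[leRHS]lE ?ler_expR // posrE; lra.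
apply: (@le_trans _ _ (expR (A1 * (1 + ln l) ^+ 2))).
  have kB : (k%:R ^+ 2 * B) ^+ k <= expR (k%:R * (2 * k%:R + 2 * ln l)).
    rewrite expRM_natl; apply: lerXn2r; rewrite ?nnegrE ?expR_ge0 //.
      by rewrite mulr_ge0 ?exprn_ge0 //; lra.
    rewrite expRD; apply: ler_pM => //; [lra|].
    by rewrite expRM_natl; apply: lerXn2r; rewrite ?nnegrE ?expR_ge0.
  apply: le_trans (ler_pM _ _ ke kB) _ => //; first by rewrite !exprn_ge0 ?mulr_ge0 ?exprn_ge0 //; lra.
  rewrite -expRD ler_expR.
  have -> : k%:R + k%:R * (2 * k%:R + 2 * ln l) = k%:R * (2 * k%:R + 2 * ln l + 1) by ring.
  have -> : A1 * (1 + ln l) ^+ 2 = (A0 * (1 + ln l)) * ((2 * A0 + 3) * (1 + ln l)) by rewrite /A1; ring.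
  apply: ler_pM => //; first by lra.
  have -> : (2 * A0 + 3) * (1 + ln l) = 2 * (A0 * (1 + ln l)) + 3 * (1 + ln l) by ring.
  lra.
apply: (@le_trans _ _ (expR (g / 4 * l))).
  rewrite ler_expR; have g4 : 0 <= g / 4 by rewrite divr_ge0 // ltW.
  have := ler_wpM2r g4 h1; have -> : A1 / (g / 4) * (1 + ln l) ^+ 2 * (g / 4) = A1 * (1 + ln l) ^+ 2.
    by field; rewrite gt_eqF.
  by rewrite (mulrC l).
have -> : g / 2 * l = g / 4 * l + g / 4 * l by field.
rewrite expRD mulrA ler_peMl ?expR_ge0 //.
rewrite -[eta](lnK (_ : _ \is Num.pos)) ?posrE // -expRD.
apply: le_trans (expR_ge1Dx _); rewrite lerDl.
have g4 : 0 < g / 4 by rewrite divr_gt0.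
by move: he; rewrite ler_pdivrMr // (mulrC (ln l)) => he; have := ler_wpM2l (ltW g4) lal; lra.
Qed.

(** The exponent $3/5$ lies below 1, so that sets up to this size are sparse, and above $1/2$, so
    that larger sets exceed the block size in [scale_bound]. *)
Lemma small_sets_bound dl C0 eta : 0 < dl -> 1 <= C0 -> 0 < eta -> exists M : R, forall n l B,
  M <= ln l -> n%:R = expR l -> 1 <= B -> B <= C0 * l ->
  let x := 4 * (Num.truncn (expR (3 / 5 * l)))%:R * B / n%:R in x <= 1 /\ 16 * B * x `^ dl <= eta.
Proof.
move=> dl0 C01 e0.
have [M M1 ME] := threshold (10 + 20 / dl) (Num.max (ln (16 * C0)) (- ln eta / (dl / 10))).
exists M => n l B Ml nE B1 BC x; have [h1 h2 la1 lal] := ME _ Ml.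
move: h2; rewrite ge_max => /andP[hC he].
have lE := l_expR la1; have l0 := l_gt0 la1.
have d20 : 0 < 20 / dl by rewrite divr_gt0.
have la10 : 10 * ln l <= l by apply: le_trans h1; rewrite expr2; nra.
have la20 : 20 * ln l <= dl * l.
  have : 20 / dl * ln l <= l by apply: le_trans h1; rewrite expr2; nra.
  by rewrite mulrAC ler_pdivrMr // mulrC (mulrC l).
have C160 : 0 < 16 * C0 by rewrite mulr_gt0 //; lra.
have CB : 16 * B <= expR (2 * ln l).
  apply: (@le_trans _ _ (16 * C0 * l)); first by lra.
  have -> : 2 * ln l = ln l + ln l by ring.
  by rewrite expRD -lE ler_wpM2r ?(ltW l0) // -[leLHS](lnK (_ : _ \is Num.pos)) ?[leRHS]lE ?ler_expR ?posrE.
have B0 : 0 <= B by lra.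
have x0 : 0 <= x by rewrite divr_ge0 // !mulr_ge0.
have xe : x <= expR (- (1 / 5 * l)).
  rewrite /x nE ler_pdivrMr ?expR_gt0 // -expRD.
  have -> : - (1 / 5 * l) + l = 1 / 5 * l + 3 / 5 * l by field.
  rewrite mulrAC expRD; apply: ler_pM => //; first by rewrite mulr_ge0.
    apply: (@le_trans _ _ (expR (2 * ln l))); first by lra.
    by rewrite ler_expR; lra.
  by rewrite truncn_le expR_ge0.
split; first by apply: le_trans xe _; rewrite expR_le1; lra.
have xd : x `^ dl <= expR (- (dl / 5 * l)).
  apply: (@le_trans _ _ (expR (- (1 / 5 * l)) `^ dl)); first by rewrite ge0_ler_powR ?nnegrE ?expR_ge0 // ltW.
  rewrite -expRM ler_expR; lra.
apply: le_trans (ler_pM _ _ CB xd) _; rewrite ?powR_ge0 //; first by rewrite mulr_ge0.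
rewrite -expRD -[leRHS](lnK (_ : _ \is Num.pos)) ?posrE // ler_expR.
have d10 : 0 < dl / 10 by rewrite divr_gt0.
move: he; rewrite ler_pdivrMr // (mulrC (ln l)) => he; have := ler_wpM2l (ltW d10) lal; lra.
Qed.

(** The factor in front counts the pairs of a size and a number of edges of the densest set. *)
Lemma union_bound eta : 0 < eta -> exists M : R, forall n l (s : R),
  M <= ln l -> n%:R = expR l -> expR (3 / 5 * l) <= s ->
  n.+1%:R * (n * n).+1%:R * expR (- (2 * s)) <= eta.
Proof.
move=> e0; have [M M1 ME] := threshold 1 (Num.max 40 (- ln eta)).
exists M => n l s Ml nE ls; have [h1 h2 la1 lal] := ME _ Ml.
move: h2; rewrite ge_max => /andP[h40 he].
have l40 : 40 <= l by lra.
have s0 : 2 * l + 4 <= s.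
  apply: le_trans ls; have z0 : 0 <= 3 / 5 * l by lra.
  apply: le_trans (expR_ge1Dxn 1 z0); rewrite (_ : (2`!)%:R = 2 :> R) // expr2; nra.
have e2 := @two_le_expR1 R.
have n1 : n.+1%:R <= expR (1 + l).
  rewrite -natr1 nE expRD; have : 1 <= expR l by apply: le_trans (expR_ge1Dx _); lra.
  by nra.
have n2 : (n * n).+1%:R <= expR (1 + (l + l)).
  rewrite -natr1 natrM nE -expRD [leRHS]expRD; have : 1 <= expR (l + l) by apply: le_trans (expR_ge1Dx _); lra.
  by nra.
apply: le_trans (ler_wpM2r (expR_ge0 _) (ler_pM _ _ n1 n2)) _ => //.
rewrite -!expRD -[leRHS](lnK (_ : _ \is Num.pos)) ?posrE // ler_expR; lra.
Qed.

(** Side conditions of [prob_small_tww], true because $a \ge n^{gam}$ beats all powers of $\log n$.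
    The first makes the maximum degree negligible against the width. *)
Lemma scale_bound dl C1 c : 0 < dl -> 1 <= C1 -> 0 < c -> c <= 1 / 8 -> exists M : R, forall l d,
  M <= ln l -> 2 + 2 * dl <= d -> d <= C1 * l ->
  let u := d / Num.sqrt l in let a := expR ((d - 2) / (2 * d - 2) * l) in
  [/\ C1 * l <= c * u * a, u < a & 2 * (a / u) <= expR (3 / 5 * l)].
Proof.
move=> dl0 C11 c0 c8; set g := dl / (1 + 2 * dl).
have g0 : 0 < g by rewrite divr_gt0 //; lra.
have [M M1 ME] := threshold (10 + 3 / g) (ln (C1 / (2 * c))).
exists M => l d Ml dd dC u a; have [h1 h2 la1 lal] := ME _ Ml.
have lE := l_expR la1; have l0 := l_gt0 la1.
have l1 : 1 <= l by lra.
have d2 : 2 <= d by lra.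
have d0 : 0 < d by lra.
have sl1 : 1 <= Num.sqrt l by rewrite -(sqrtr1 R) ler_wsqrtr.
have sl0 : 0 < Num.sqrt l by lra.
have sll : Num.sqrt l <= l.
  by rewrite -[leRHS](sqr_sqrtr (ltW l0)) expr2 ler_peMl // ltW.
have g3 : 0 < 3 / g by rewrite divr_gt0.
have la10 : 10 * ln l <= l by apply: le_trans h1; rewrite expr2; nra.
have la3 : 3 * ln l <= g * l.
  have : 3 / g * ln l <= l by apply: le_trans h1; rewrite expr2; nra.
  by rewrite mulrAC ler_pdivrMr // mulrC (mulrC l).
have ga : expR (g * l) <= a.
  by rewrite ler_expR ler_wpM2r ?(ltW l0) // exponent_ge.
have u0 : 0 < u by rewrite divr_gt0.
have ul : 2 / l <= u.
  rewrite /u ler_pdivlMr // mulrAC ler_pdivrMr //.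
  by apply: ler_pM => //; rewrite ltW.
have key : C1 * l * l <= 2 * c * expR (g * l).
  have c20 : 0 < 2 * c by rewrite mulr_gt0.
  have p0 : 0 < C1 / (2 * c) by rewrite divr_gt0 //; lra.
  have h : C1 / (2 * c) * expR (ln l + ln l) <= expR (g * l).
    rewrite -[C1 / _](lnK (_ : _ \is Num.pos)) ?posrE // -expRD ler_expR; lra.
  have -> : C1 * l * l = 2 * c * (C1 / (2 * c) * expR (ln l + ln l)).
    by rewrite expRD -lE; field; rewrite gt_eqF.
  by rewrite ler_wpM2l // ltW.
have cl : C1 * l <= c * (2 / l) * expR (g * l).
  have -> : c * (2 / l) * expR (g * l) = 2 * c * expR (g * l) / l by ring.
  by rewrite ler_pdivlMr.
split.
- apply: le_trans cl _; rewrite -!mulrA ler_wpM2l ?(ltW c0) // !mulrA.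
  by apply: ler_pM; rewrite ?expR_ge0 ?divr_ge0 ?(ltW l0).
- have ud : u <= d by rewrite /u ler_pdivrMr // ler_peMr // ltW.
  apply: le_lt_trans ud _; apply: le_lt_trans dC _; apply: lt_le_trans ga.
  apply: le_lt_trans cl _; rewrite gtr_pMl ?expR_gt0 //.
  have : 2 / l <= 2 by rewrite ler_pdivrMr //; lra.
  have : 0 < 2 / l by rewrite divr_gt0.
  nra.
have al : a <= expR (l / 2).
  rewrite ler_expR [leRHS]mulrC ler_wpM2r ?(ltW l0) // ler_pdivrMr; lra.
have iu : u^-1 <= l / 2.
  by rewrite -[leRHS]invf_div lef_pV2 ?posrE // divr_gt0.
apply: (@le_trans _ _ (expR (ln l) * expR (l / 2))).
  rewrite -lE; have := ler_pM (expR_ge0 _) (_ : 0 <= u^-1) al iu.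
  by rewrite invr_ge0 (ltW u0) => /(_ isT); rewrite -/a; lra.
by rewrite -expRD ler_expR; lra.
Qed.

End LargeOrder.

Lemma whp_tww_bounds (R : realType) (dl C0 : R) : 0 < dl -> 1 <= C0 ->
  exists c C : R, [/\ 0 < c, 0 < C & forall eta : R, 0 < eta -> exists n1 : nat,
  forall n (mu : sgraph 'I_n -> R) (B : R), (n1 <= n)%N ->
  (forall G, 0 <= mu G) -> \sum_G mu G = 1 ->
  (forall F : {set {set 'I_n}}, graph_prob mu (fun G => F \subset edges G) <= (B / n%:R) ^+ #|F|) ->
  1 <= B -> B <= C0 * ln n%:R ->
  graph_prob mu (fun G => ~~ ((2 + 2 * dl <= mad R G) && (B <= C0 * mad R G))) <= eta ->
  1 - 6 * eta <= graph_prob mu (fun G => tww_bounds c C G)].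
Proof.
(* The degree bound [D] is $16C_0l$ rounded up, so $D + 1 \le 16C_0l + 2 \le 18C_0l$; the 16 is that
   of [prob_degree_le]. *)
move=> dl0 C01; pose C1 : R := 18 * C0; have C11 : 1 <= C1 by rewrite /C1; lra.
have dl2 : 2 <= 2 + 2 * dl by lra.
have dlE : 2 + 2 * dl = 2 * (1 + dl) by ring.
pose c : R := expR (- (8 * C1 + 10)) / (8 * 8 * 8 * C0).
have C8 : 0 < 8 * 8 * 8 * C0 by lra.
have c0 : 0 < c by rewrite divr_gt0 ?expR_gt0.
have cE : c * (8 * 8 * 8 * C0) = expR (- (8 * C1 + 10)) by rewrite divfK // gt_eqF.
have c8 : c <= 1 / 8.
  have e1 : expR (- (8 * C1 + 10)) <= 1 by rewrite expR_le1; lra.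
  have cC : c <= c * C0 by rewrite ler_peMr // ltW.
  by move: cE c0 e1 cC; lra.
have [[C MU] /= C_gt0 upper] := tww_le dl0 C11.
exists c, C; split => // eta e0.
have m0 : 0 < Num.min eta (1 / 2) by rewrite lt_min e0 /=; lra.
have [M2 H2] := many_dense_sets_bound dl0 C01 e0.
have [M3 H3] := small_sets_bound dl0 C01 m0.
have [M4 H4] := union_bound e0.
have [M5 H5] := scale_bound dl0 C11 c0 c8.
have [M6 M61 H6] := threshold (1 : R) (- ln eta).
have [n1 n10 Hn] := ln_nat_large (expR (Num.max MU (Num.max M2 (Num.max M3 (Num.max M4 (Num.max M5 M6)))))).
exists n1 => n mu B n1n mu_ge0 mu1 sparse B1 BC E0.
have n0 : (0 < n)%N by apply: leq_trans n1n.
have nR : 0 < n%:R :> R by rewrite ltr0n.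
have lM := Hn _ n1n; set l := ln n%:R in lM BC.
have l0 : 0 < l by apply: lt_le_trans lM; apply: expR_gt0.
have nE : n%:R = expR l by rewrite /l lnK // posrE.
move: lM; rewrite -[l in X in X -> _](lnK (_ : _ \is Num.pos)) ?posrE // ler_expR.
rewrite !ge_max => /and5P[hU h2 h3 h4 /andP[h5 h6]].
have [_ el la1 lal] := H6 _ h6.
have l1 : 1 <= l by lra.
have D0 : 0 <= 16 * C0 * l by rewrite mulr_ge0 ?(ltW l0) //; lra.
have [D [D1 D2 _]] := nat_ceil D0.
have C0l : l <= C0 * l by rewrite ler_peMl // ltW.
have DC : D.+1%:R <= C1 * l by rewrite -natr1 /C1; lra.
have DN : (0 < D)%N by rewrite -(ltr0n R); apply: lt_le_trans D1; lra.
have E1 : graph_prob mu (fun G => [exists x, (D <= degree G x)%N]) <= eta.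
  apply: le_trans (prob_degree_le mu_ge0 n0 B1 sparse DN _) _; first by apply: le_trans D1; lra.
  rewrite nE -expRD -[leRHS](lnK (_ : _ \is Num.pos)) ?posrE // ler_expR; lra.
set k := (2 * walk_bound dl l).+2.
set X := expR (dl / (1 + 2 * dl) / 2 * l).
have E2 : graph_prob mu (fun G => ((Num.truncn X).+1 <= #|dense_sets G k|)%N) <= eta.
  have K0 : 0 < (Num.truncn X).+1%:R :> R by rewrite ltr0n.
  rewrite -(ler_pM2l K0); apply: le_trans (graph_prob_markov mu_ge0 (fun G => #|dense_sets G k|) _) _.
  apply: le_trans (expected_dense_count mu_ge0 n0 B1 sparse (ltn0Sn _)) _.
  apply: le_trans (H2 l B k h2 B1 BC erefl) _.
  by rewrite [leRHS]mulrC ler_wpM2l ?(ltW e0) // ltW // truncnS_gt.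
set smax := Num.truncn (expR (3 / 5 * l)).
have E3 : graph_prob mu (fun G => [exists S : {set 'I_n}, [&& S != set0, (#|S| <= smax)%N &
    (1 + dl) * #|S|%:R <= #|edges_in G S|%:R]]) <= 2 * eta.
  have [x1 xb] := H3 n l B h3 nE B1 BC.
  apply: le_trans (prob_small_dense_set mu_ge0 n0 B1 sparse dl0 m0 _ x1 xb) _.
    by rewrite ge_min lexx orbT.
  by rewrite ler_wpM2l // ge_min lexx.
(* [mad] is random. It is determined by the size and the number of edges of a densest set, so the
   union is taken over these pairs, and density and width are fixed for each pair. *)
pose I := ('I_n.+1 * 'I_(n * n).+1)%type.
pose d_ (i : I) : R := 2 * (i.2 : nat)%:R / (i.1 : nat)%:R.
pose u_ i := d_ i / Num.sqrt l.
pose a_ i := expR ((d_ i - 2) / (2 * d_ i - 2) * l).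
pose w_ i := Num.truncn (c * u_ i * a_ i).
pose ok (i : I) := [&& expR (3 / 5 * l) <= (i.1 : nat)%:R, 2 + 2 * dl <= d_ i, d_ i <= C1 * l & B <= C0 * d_ i].
pose ev (i : I) (G : sgraph 'I_n) := [exists W : {set 'I_n}, (#|W| == i.1) && (i.2 <= #|edges_in G W|)%N] &&
     [forall y, (degree G y <= D)%N] && `[< has_contraction_sequence (w_ i) (trigraph_of G) >].
have E4 : graph_prob mu (fun G => [exists i, ok i && ev i G]) <= eta.
  apply: le_trans (graph_prob_union mu_ge0 (D := ok) (E := ev) _) _.
    by move=> G /existsP[i /andP[oi ei]]; exists i.
  have N0 : 0 < n.+1%:R * (n * n).+1%:R :> R by rewrite mulr_gt0.
  apply: (@le_trans _ _ (\sum_(i : I) eta / (n.+1%:R * (n * n).+1%:R))); last first.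
    by rewrite sumr_const card_prod !card_ord -[leLHS]mulr_natr natrM divfK // gt_eqF.
  rewrite [leLHS]big_mkcond; apply: ler_sum => i _; case: ifP => [|_]; last by rewrite divr_ge0 ?ltW.
  case/and4P => ls dd dC Bd; rewrite ler_pdivlMr // mulrC.
  apply: le_trans _ (H4 n l _ h4 nE ls).
  rewrite ler_wpM2l ?(ltW N0) //.
  have sR : 0 < (i.1 : nat)%:R :> R by apply: lt_le_trans ls; apply: expR_gt0.
  have sl1 : 1 <= Num.sqrt l by rewrite -(sqrtr1 R) ler_wsqrtr.
  have sl0 : 0 < Num.sqrt l := lt_le_trans ltr01 sl1.
  have dd2 : 2 <= d_ i := le_trans dl2 dd.
  have dd0 : 0 < d_ i by apply: lt_le_trans dd2.
  have [v1 v2 v3] := H5 l (d_ i) h5 dd dC.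
  have uE : u_ i ^+ 2 * l = d_ i ^+ 2 by rewrite expr_div_n sqr_sqrtr ?(ltW l0) // divfK // gt_eqF.
  have cua : 0 <= c * u_ i * a_ i by apply: le_trans v1; rewrite mulr_ge0 ?(ltW l0) // (le_trans _ C11).
  apply: (@prob_small_tww R n mu B mu_ge0 n0 B1 sparse C0 C1 c l (d_ i) (u_ i) (a_ i)) => //.
  - by rewrite -(ltr0n R).
  - by rewrite /d_ divfK // gt_eqF.
  - by rewrite -ltnS ltn_ord.
  - by rewrite divr_gt0.
  - by rewrite ler_pdivrMr // ler_peMr // ltW.
  - rewrite -(ler_pM2r l0) uE expr2 [leRHS]mulrAC ler_wpM2r ?(ltW dd0) //.
  - have h := truncn_le (c * u_ i * a_ i); rewrite cua in h.
    rewrite -addnA addn1 natrD mulr_natl mulr2n lerD //.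
    by apply: le_trans DC _.
  - by apply: le_trans v3 ls.
have := graph_probC (fun G => tww_bounds c C G) mu1; set bad := graph_prob mu (predC _) => ->.
suff h : bad <= 6 * eta by rewrite lerD2l lerN2.
have -> : 6 * eta = eta + (eta + (eta + (2 * eta + eta))) by ring.
apply: le_trans _ (lerD E0 (lerD E1 (lerD E2 (lerD E3 E4)))).
apply: le_trans (graph_prob_union2 mu_ge0 (B := fun G => ~~ ((2 + 2 * dl <= mad R G) && (B <= C0 * mad R G)))
  (C := fun G => [|| [exists x, (D <= degree G x)%N], ((Num.truncn X).+1 <= #|dense_sets G k|)%N,
     [exists S : {set 'I_n}, [&& S != set0, (#|S| <= smax)%N & (1 + dl) * #|S|%:R <= #|edges_in G S|%:R]] |
     [exists i, ok i && ev i G]]) _) _; last first.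
  rewrite lerD2l; apply: le_trans (graph_prob_union2 mu_ge0 (fun G h => h)) _.
  rewrite lerD2l; apply: le_trans (graph_prob_union2 mu_ge0 (fun G h => h)) _.
  rewrite lerD2l; exact: (graph_prob_union2 mu_ge0 (fun G h => h)).
move=> G; apply: contraNT; rewrite negb_or negbK => /andP[/andP[dd Bd]].
rewrite !negb_or => /and4P[/existsPn degD dS small noev].
have degD' x : (degree G x <= D)%N by have := degD x; rewrite -ltnNge => /ltnW.
have dS' : #|dense_sets G k|%:R <= X by rewrite -truncn_ge_nat ?expR_ge0 // leqNgt.
have T0 : (0 < #|'I_n|)%N by rewrite card_ord.
apply/andP; split; last first.
  have := upper n G D hU degD' DC dd dS'; rewrite /excess; exact.
rewrite leNgt; apply/negP => lt.
have mad0 : 0 <= mad R G by apply: le_trans (le_trans dl2 dd).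
have [S S0 SE] := mad_attained R G T0.
have dmax := mad_le_degree R degD' T0.
have sS : (0 < #|S|)%N by rewrite card_gt0.
have sR : 0 < #|S|%:R :> R by rewrite ltr0n.
have nS : (#|S| < n.+1)%N by rewrite ltnS -[leqRHS]card_ord max_card.
have nS' : (#|S| <= n)%N := nS.
have eS : (#|edges_in G S| < (n * n).+1)%N.
  by rewrite ltnS edges_in_pairs (leq_trans (subset_leq_card (subsetIr _ _))) // (leq_trans (card_pairs_le _)) // leq_mul.
pose i : I := (Ordinal nS, Ordinal eS).
have di : d_ i = mad R G by rewrite SE.
(* Smaller sets have fewer than $1 + dl$ edges per vertex, hence a density below [mad]. *)
have big : expR (3 / 5 * l) <= #|S|%:R.
  rewrite ltW // ltNge; apply/negP => Ss; move/existsPn/(_ S): small; rewrite S0 /=.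
  rewrite truncn_ge_nat ?expR_ge0 // Ss /= => /negP; apply.
  by move: dd; rewrite SE ler_pdivlMr // dlE -mulrA ler_pM2l.
move/existsPn/(_ i): noev => /negP; apply; apply/andP; split.
  apply/and4P; split => //; rewrite ?di //.
  by apply: le_trans dmax _; apply: le_trans DC; rewrite ler_nat.
apply/andP; split; last first.
  apply/asboolP; have [hT _] := tww_spec G T0; apply: has_contraction_sequence_mono hT.
  rewrite /w_ /u_ /a_ di truncn_ge_nat.
    by move: lt; rewrite /powR gt_eqF // => /ltW.
  by rewrite mulr_ge0 ?expR_ge0 // mulr_ge0 ?(ltW c0) // divr_ge0 ?sqrtr_ge0.
apply/andP; split; first by apply/existsP; exists S; rewrite eqxx /=.
by apply/forallP.
Qed.

(** * The three models *)

Section Models.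
Variable R : realType.
Implicit Types (dl C eta B : R).

(** The interface between the models and [whp_tww_bounds]: only the sparsity parameter [B] varies
    with the model. *)
Definition sparse_dense n (mu : sgraph 'I_n -> R) dl C0 B eta : Prop :=
  [/\ forall G, 0 <= mu G, \sum_G mu G = 1,
      forall F : {set {set 'I_n}}, graph_prob mu (fun G => F \subset edges G) <= (B / n%:R) ^+ #|F|,
      1 <= B /\ B <= C0 * ln n%:R &
      graph_prob mu (fun G => ~~ ((2 + 2 * dl <= mad R G) && (B <= C0 * mad R G))) <= eta].

Lemma with_high_probability_of (D : set nat) (mu : forall n, sgraph 'I_n -> R) (A : forall n, pred (sgraph 'I_n)) :
  (forall eta, 0 < eta -> exists n1 : nat, forall n, (n1 <= n)%N -> D n ->
     1 - eta <= graph_prob (mu n) (A n) /\ graph_prob (mu n) (A n) <= 1) ->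
  with_high_probability D mu A.
Proof.
move=> h; apply/cvgrPdist_le => e e0; have [n1 hn] := h e e0.
exists n1 => // n /= nn Dn; have [h1 h2] := hn n nn Dn.
by rewrite ger0_norm; lra.
Qed.

Lemma graph_prob_le1 n (mu : sgraph 'I_n -> R) A : (forall G, 0 <= mu G) -> \sum_G mu G = 1 ->
  graph_prob mu A <= 1.
Proof. by move=> m0 m1; rewrite (graph_probC A m1) gerBl graph_prob_ge0. Qed.

Lemma uniform_graph_prob0 n (A E : pred (sgraph 'I_n)) : (forall G, A G -> ~~ E G) ->
  graph_prob (uniform_graph R A) E = 0.
Proof.
move=> AE; apply: big1 => G EG; rewrite /uniform_graph; case: ifP => // /AE.
by rewrite EG.
Qed.

Lemma ln_le_nat n : (0 < n)%N -> ln n%:R <= n%:R - 1 :> R.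
Proof.
move=> n0; have -> : n%:R = 1 + (n%:R - 1) :> R by ring.
have nR : 0 < n%:R :> R by rewrite ltr0n.
by rewrite [leRHS](_ : _ = n%:R - 1) ?le_ln1Dx //; [lra|ring].
Qed.

Lemma ln_sqr_le_nat n : (0 < n)%N -> 100 <= ln n%:R :> R -> 16 * ln n%:R ^+ 2 <= n%:R :> R.
Proof.
move=> n0 l100; have nE : n%:R = expR (ln n%:R) :> R by rewrite lnK // posrE ltr0n.
have l0 : 0 <= ln n%:R :> R by lra.
rewrite [leRHS]nE; apply: le_trans (expR_ge1Dxn 2 l0); rewrite (_ : (3`!)%:R = 6 :> R) //.
rewrite exprSr; have := ler_wpM2l (sqr_ge0 (ln n%:R : R)) l100; have := sqr_ge0 (ln n%:R : R); lra.
Qed.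

Lemma bin2_natr n : (0 < n)%N -> 'C(n, 2)%:R * 2 = n%:R * (n%:R - 1) :> R.
Proof.
move=> n0; have -> : n%:R - 1 = n.-1%:R :> R by rewrite -subn1 natrB.
rewrite -!natrM; congr _%:R; rewrite bin2 muln2 -[RHS](odd_double_half) oddM.
by case: (n) n0 => //= k _; rewrite andNb add0n.
Qed.

(** The condition on [mad] is deterministic here: the average degree is $2m/n \ge 2 + 2\,eps$, and
    [B] is twice that. *)
Lemma gnm_model eps dl C0 : 0 < eps -> dl <= eps -> 2 <= C0 ->
  forall eta, 0 < eta -> exists n1 : nat, forall n m, (n1 <= n)%N ->
  (1 + eps) * n%:R <= m%:R -> m%:R <= 11^-1 * n%:R * ln (n%:R : R) ->
  sparse_dense (random_gnm R m (n := n)) dl C0 (4 * m%:R / n%:R) eta.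
Proof.
move=> e0 de C2 eta eta0; exists 2%N => n m n2 mn mln.
have n0 : (0 < n)%N by apply: leq_trans n2.
have nR : 2 <= n%:R :> R by rewrite (ler_nat R 2).
have nR0 : 0 < n%:R :> R by lra.
have m0 : 0 < m%:R :> R by apply: lt_le_trans mn; rewrite mulr_gt0 //; lra.
have M2 := bin2_natr n0.
have mM : (m <= 'C(n, 2))%N.
  rewrite -(ler_nat R); apply: le_trans mln _.
  have := ler_wpM2l (ltW nR0) (ln_le_nat n0); nra.
have mN : (0 < m)%N by rewrite -(ltr0n R).
have mn1 : 1 + eps <= m%:R / n%:R by rewrite ler_pdivlMr.
split.
- exact: gnm_ge0.
- exact: gnm_sum.
- move=> F; apply: le_trans (gnm_sparse _ F mN mM) _; apply: lerXn2r; rewrite ?nnegrE ?divr_ge0 //.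
  have M0 : 0 < 'C(n, 2)%:R :> R by rewrite ltr0n (leq_trans mN).
  rewrite ler_pdivrMr // mulrAC ler_pdivlMr // mulrAC ler_pdivlMr //.
  have -> : 4 * m%:R * 'C(n, 2)%:R = 2 * m%:R * ('C(n, 2)%:R * 2) :> R by ring.
  have h : n%:R * n%:R <= n%:R * (2 * (n%:R - 1)) :> R by rewrite ler_wpM2l //; lra.
  by rewrite M2; have := ler_wpM2l (ltW m0) h; lra.
- split; first by rewrite -mulrA; lra.
  rewrite -mulrA; have : m%:R / n%:R <= 11^-1 * ln n%:R :> R by rewrite ler_pdivrMr // mulrAC.
  have : 0 <= ln n%:R :> R by rewrite ln_ge0 //; lra.
  nra.
rewrite uniform_graph_prob0 ?ltW // => G /eqP EG; rewrite negbK.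
have := mad_ge_edges R G; rewrite card_ord EG => /(_ n0); rewrite -mulrA => h.
by apply/andP; split; rewrite -?mulrA; nra.
Qed.

Lemma regular_model dl C0 : dl <= 1 / 2 -> 32 <= C0 ->
  forall eta, 0 < eta -> exists n1 : nat, forall n k, (n1 <= n)%N ->
  (2 < k)%N -> k%:R < 5^-1 * ln (n%:R : R) -> ~~ odd (k * n)%N ->
  sparse_dense (random_regular R k (n := n)) dl C0 (32 * k%:R) eta.
Proof.
move=> d1 C32 eta eta0; have [n1 n10 Hn] := @ln_nat_large R 100.
exists n1 => n k nn k2 kl ev.
have l100 := Hn _ nn; set l : R := ln n%:R in kl l100.
have n0 : (0 < n)%N by apply: leq_trans nn.
have k3 : 3 <= k%:R :> R by rewrite (ler_nat R 3).
have k0 : (0 < k)%N by apply: leq_trans k2.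
have ln1 := ln_le_nat n0; rewrite -/l in ln1.
have ln2 : 16 * l ^+ 2 <= n%:R by apply: ln_sqr_le_nat.
have k5 : 5 * k%:R <= l by lra.
have l0 : 0 <= l by lra.
have kk : 25 * (k%:R * k%:R) <= l ^+ 2.
  have k50 : 0 <= 5 * k%:R :> R by lra.
  have := ler_pM k50 k50 k5 k5; rewrite expr2; lra.
have kl1 : k%:R * l * 5 <= l ^+ 2 by rewrite expr2; have := ler_wpM2r l0 k5; lra.
have ll : 100 * l <= l ^+ 2 by rewrite expr2 ler_wpM2r.
have kk0 : 0 <= k%:R * k%:R :> R by rewrite mulr_ge0.
have kn : k%:R * (8 * k%:R + 20) <= n%:R * k%:R :> R.
  rewrite mulrC ler_wpM2r //; lra.
(* [M] is the largest number allowed by the first condition of [regular_sparse]. It is at least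
   $kn/4$, so $4k^2/M$ is $O(k/n)$. *)
pose X := (k * n - (2 + 4 * k + 2 * (k * k)))%N.
have XN : (2 + 4 * k + 2 * (k * k) <= k * n)%N.
  rewrite -(ler_nat R) natrM !natrD !natrM; lra.
pose M := X./2.
have XM : (X = odd X + M * 2)%N by rewrite /M muln2 odd_double_half.
have MX : (2 * M + 2 + 4 * k + 2 * (k * k) <= k * n)%N.
  have : (2 * M <= X)%N by rewrite [leqRHS]XM mulnC leq_addl.
  move=> h; have -> : (2 * M + 2 + 4 * k + 2 * (k * k) = (2 + 4 * k + 2 * (k * k)) + 2 * M)%N.
    by rewrite [RHS]addnC !addnA.
  by rewrite -leq_subRL.
have XMX : (k * n <= 2 * M + 3 + 4 * k + 2 * (k * k))%N.
  rewrite -(subnK XN) -/X [X in (X + _ <= _)%N]XM (leq_trans (leq_add (leq_add (leq_b1 _) (leqnn _)) (leqnn _))) //.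
  by rewrite (mulnC M); move: (2 * M)%N (4 * k)%N (2 * (k * k))%N => a b e; clear; lia.
have XMR : k%:R * n%:R <= 2 * M%:R + 3 + 4 * k%:R + 2 * (k%:R * k%:R) :> R.
  by move: XMX; rewrite -(ler_nat R) !(natrM, natrD).
have M4 : k%:R * n%:R <= 4 * M%:R :> R by lra.
have M0 : (0 < M)%N by rewrite -(ltr0n R); lra.
have ex : (0 < #|[set G : sgraph 'I_n | regular k G]|)%N.
  case: n n0 {nn M MX XM XMX XMR M4 M0 XN X} ev @l kl l100 ln1 ln2 k5 l0 kk kl1 ll kn => // n _ ev l kl l100 ln1 ln2 k5 l0 kk kl1 ll kn.
  have kn' : (k <= n)%N by rewrite -ltnS -(ltr_nat R); lra.
  by have [G regG] := regular_exists kn' ev; apply/card_gt0P; exists G; rewrite inE.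
split.
- exact: regular_ge0.
- exact: regular_sum.
- move=> F; apply: le_trans (@regular_sparse R n k M F k0 ex M0 MX _ _) _.
  + apply: leq_trans XMX _; rewrite -!addnA leq_add2l.
    have : (3 * k <= k * k)%N by rewrite leq_mul2r k2 orbT.
    by move: k2; move: (k * k)%N => a; clear; lia.
  + rewrite -(ler_nat R) !natrX; have nE : n%:R = expR l :> R by rewrite /l lnK // posrE ltr0n.
    rewrite nE -expRM_natl -[2](lnK (_ : (2 : R) \is Num.pos)) ?posrE // -expRM_natl ler_expR.
    have := ler_wpM2l (ler0n R M) (@ln2_ge R); rewrite natrM natrM.
    have kM : k%:R * n%:R <= M%:R * 4 :> R by lra.
    have h : k%:R * (32 * k%:R * l) <= k%:R * n%:R :> R.
      rewrite ler_wpM2l //; lra.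
    lra.
  apply: lerXn2r; rewrite ?nnegrE ?divr_ge0 ?mulr_ge0 //.
  have MR : 0 < M%:R :> R by rewrite ltr0n.
  have nR : 0 < n%:R :> R by rewrite ltr0n.
  rewrite ler_pdivrMr // mulrAC ler_pdivlMr // natrM.
  have := ler_wpM2l (ler0n R k) M4; have : 0 <= k%:R * M%:R :> R by rewrite mulr_ge0.
  lra.
- split; first by lra.
  have := ler_wpM2r l0 C32; rewrite -/l; lra.
rewrite uniform_graph_prob0 ?ltW // => G regG; rewrite negbK.
have := mad_ge_edges R G; rewrite card_ord => /(_ n0); rewrite -natrM (regular_edges regG) natrM mulfK ?pnatr_eq0 -?lt0n // => h.
apply/andP; split; first by lra.
by have := ler_wpM2r (ler0n R k) C32; nra.
Qed.

Lemma exploration_drift (e1 th N K h p : R) : 0 < e1 -> e1 <= 1 -> e1 * e1 = 64 * th ->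
  1 <= th * N -> th * 64 * N <= e1 * N -> 1 + e1 <= p * N -> 0 <= K ->
  K <= e1 / 8 * N -> e1 / 8 * N < K + 1 -> h <= th * N ->
  K + h - p * (K * (N - (K + h))) < - (th * N).
Proof.
move=> e0 e1le thE tn ten pN K0 K1 K2 h1.
have q1 : 1 + e1 / 2 <= p * (N - (K + h)).
  apply: (@le_trans _ _ ((p * N) * (1 - e1 / 4))).
    have a1 : 0 <= 1 - e1 / 4 by lra.
    have a3 : e1 * e1 <= e1 by rewrite ler_piMr // ltW.
    have := ler_wpM2r a1 pN; lra.
  have p0 : 0 <= p.
    have N0 : 0 < N by move: pN; nra.
    by rewrite -(pmulr_lge0 _ N0); lra.
  rewrite -mulrA ler_wpM2l //; lra.
have := ler_wpM2l K0 q1.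
have := ler_wpM2r (ltW e0) (ltW K2).
have -> : e1 / 8 * N * e1 = 8 * (th * N).
  have -> : e1 / 8 * N * e1 = e1 * e1 / 8 * N by ring.
  by rewrite thE; field.
lra.
Qed.

Lemma dense_part_mad n (G : sgraph 'I_n) (S : {set 'I_n}) (t B x : R) :
  S != set0 -> 0 < t -> 16 <= t * n%:R -> 1 <= B -> B * (t * n%:R / 4) <= x ->
  #|S|%:R - 1 + x - t / 16 * n%:R <= #|edges_in G S|%:R -> 2 + B * t / 4 <= mad R G.
Proof.
move=> S0 t0 tn B1 xB SE; apply: le_trans (mad_ge R G S0).
have cR : 0 < #|S|%:R :> R by rewrite ltr0n card_gt0.
have cn : #|S|%:R <= n%:R :> R by rewrite ler_nat -[leqRHS]card_ord max_card.
have t1 : 0 <= t * n%:R by rewrite mulr_ge0 // ltW.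
have Bn : t * n%:R <= B * (t * n%:R) by rewrite ler_peMl.
have Bc : B * t * #|S|%:R <= B * t * n%:R.
  by rewrite ler_wpM2l // mulr_ge0 ?(ltW t0) // (le_trans _ B1).
rewrite ler_pdivlMr //; lra.
Qed.

(** [dense_part_mad] gives $d \ge 2 + pn\,th^2/4$. As $pn \ge 1$ this is at least $2 + 2\,dl$ for
    $dl = th^2/8$, and it also yields $pn \le (4/th^2)\,d$; both constants originate here. *)
Lemma gnp_model eps (e1 := Num.min eps 1) (th := e1 ^+ 2 / 64) : 0 < eps ->
  forall eta, 0 < eta -> exists n1 : nat, forall n (p : R), (n1 <= n)%N ->
  (1 + eps) / n%:R <= p -> p <= 12^-1 * (ln n%:R / n%:R) ->
  sparse_dense (random_gnp p (n := n)) (th ^+ 2 / 8) (4 / th ^+ 2) (p * n%:R) eta.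
Proof.
move=> eps0 eta eta0.
have e10 : 0 < e1 by rewrite lt_min eps0 ltr01.
have e11 : e1 <= 1 by rewrite ge_min lexx orbT.
have e1e : e1 <= eps by rewrite ge_min lexx.
have e2 : e1 ^+ 2 <= e1 by rewrite expr2 ler_piMr // ltW.
have th0 : 0 < th by rewrite divr_gt0 // exprn_gt0.
have the : th * 64 <= e1 by rewrite /th divfK // pnatr_eq0.
have thE : e1 * e1 = 64 * th by rewrite /th expr2; field.
move: th th0 the thE => th th0 the thE.
have t20 : 0 < th ^+ 2 by rewrite exprn_gt0.
have t40 : 0 < th ^+ 4 by rewrite exprn_gt0.
have [n1 n10 Hn] := ln_nat_large (Num.max 100 (Num.max (8 / (eta * th ^+ 4)) (16 / th ^+ 2))).
exists n1 => n p nn pl pu.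
have := Hn _ nn; rewrite !ge_max; set l : R := ln n%:R => /and3P[l100 leta lth].
have n0 : (0 < n)%N by apply: leq_trans nn.
have nR : 0 < n%:R :> R by rewrite ltr0n.
have ln1 := ln_le_nat n0; rewrite -/l in ln1.
have ln2 : 16 * l ^+ 2 <= n%:R by apply: ln_sqr_le_nat.
have pn : 1 + eps <= p * n%:R by rewrite -ler_pdivrMr.
have pnl : p * n%:R <= 12^-1 * l by move: pu; rewrite mulrA ler_pdivlMr.
have p0 : 0 <= p by apply: le_trans pl; rewrite divr_ge0 ?ltW //; lra.
have p1 : p <= 1 by rewrite -(ler_pM2r nR) mul1r; lra.
have p01 : 0 <= p <= 1 by rewrite p0.
have tn : 16 <= th ^+ 2 * n%:R.
  have : 16 / th ^+ 2 <= n%:R by lra.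
  by rewrite ler_pdivrMr // mulrC.
have t64 : th <= 1 / 64 by lra.
have tn8 : 16 * 64 <= th * n%:R.
  have h : 0 <= th * n%:R by rewrite mulr_ge0 // ltW.
  have := ler_wpM2l h t64; move: tn; rewrite expr2; lra.
pose K := Num.truncn (e1 / 8 * n%:R); pose h := Num.truncn (th * n%:R).
have x0 : 0 <= e1 / 8 * n%:R by rewrite mulr_ge0 ?divr_ge0 // ltW.
have y0 : 0 <= th * n%:R by lra.
have K1 : K%:R <= e1 / 8 * n%:R by rewrite truncn_le.
have K2 : e1 / 8 * n%:R < K%:R + 1 by rewrite natr1 truncnS_gt.
have h1 : h%:R <= th * n%:R by rewrite truncn_le.
have h2 : th * n%:R < h%:R + 1 by rewrite natr1 truncnS_gt.
have en : e1 * n%:R <= n%:R by rewrite ler_piMl // ltW.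
have ten : th * 64 * n%:R <= e1 * n%:R by rewrite ler_wpM2r // ltW.
have Khn : (K + h < n)%N by rewrite -(ltr_nat R) natrD; clear -K1 h1 en ten nR; lra.
have K0 : (0 < K)%N by rewrite -(ltr_nat R); clear -K2 ten tn8; lra.
pose lam := th ^+ 2 / 16 * n%:R.
have lam0 : 0 < lam by rewrite mulr_gt0 // divr_gt0.
have tth : th ^+ 2 * n%:R <= th * n%:R.
  by rewrite ler_wpM2r ?(ltW nR) // expr2 ler_piMl // ?ltW //; clear -t64; lra.
have drift : (K + h)%:R - p * (K * (n - K - h))%:R < - lam.
  rewrite natrD natrM -subnDA natrB ?(ltnW Khn) // natrD.
  apply: (@lt_le_trans _ _ (- (th * n%:R))); last by rewrite lerN2 /lam; clear -tth y0; lra.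
  by apply: exploration_drift K1 K2 h1 => //; clear -tn8 ten pn e1e; lra.
have hN : (0 < h)%N by rewrite -(ltr_nat R); clear -h2 tn8; lra.
have hb : th ^+ 2 * n%:R / 4 * n%:R <= 'C(h, 2)%:R.
  have b2 := bin2_natr hN.
  have g1 : 3 / 4 * (th * n%:R) <= h%:R - 1 by clear -h2 tn8; lra.
  have g0 : 0 <= 3 / 4 * (th * n%:R) by clear -y0; lra.
  have := ler_pM g0 g0 (le_trans g1 (_ : h%:R - 1 <= h%:R)) g1.
  rewrite gerBl ler01 => /(_ isT); rewrite -b2.
  have : 0 <= th * n%:R * (th * n%:R) by rewrite mulr_ge0.
  rewrite expr2; clear; lra.
split.
- by move=> G; exact: gnp_ge0.
- exact: mean1.
- by move=> F; rewrite mulfK ?gt_eqF //; exact: gnp_sparse.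
- split; first by clear -pn eps0; lra.
  apply: le_trans pnl _; rewrite ler_wpM2r //; first by clear -l100; lra.
  by rewrite ler_pdivlMr //; have := ler_pM (ltW th0) (ltW th0) t64 t64; rewrite -expr2; clear; lra.
apply: le_trans (graph_prob_le (B := fun G => ~~ [exists C : {set 'I_n}, (C != set0) &&
     (#|C|%:R - 1 + p * 'C(h, 2)%:R - lam <= #|edges_in G C|%:R)]) _ _) _.
- by move=> G; exact: gnp_ge0.
- move=> G; apply: contraNN => /existsP[C /andP[C0 CE]].
  have Bt1 : 1 <= p * n%:R by clear -pn eps0; lra.
  have ph : p * n%:R * (th ^+ 2 * n%:R / 4) <= p * 'C(h, 2)%:R.
    by apply: le_trans _ (ler_wpM2l p0 hb); rewrite le_eqVlt; apply/orP; left; apply/eqP; ring.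
  have key := dense_part_mad C0 t20 tn Bt1 ph CE.
  move: key Bt1; move: (p * n%:R) (mad R G) => Bt d; clear -t20 => key Bt1.
  have B2 : th ^+ 2 <= Bt * th ^+ 2 by rewrite ler_peMl // ltW.
  apply/andP; split; first by lra.
  rewrite mulrAC ler_pdivlMr //; lra.
apply: le_trans (@gnp_dense_part n K h Khn K0 R p p01 lam lam0 drift) _.
rewrite natrM natrX.
have -> : 2 * (3 * n%:R ^+ 2 * p / lam ^+ 2) = 6 * (16 * 16) * p / th ^+ 4.
  by rewrite /lam; field; rewrite !gt_eqF.
rewrite ler_pdivrMr //.
have et0 : 0 < eta * th ^+ 4 by rewrite mulr_gt0.
have l0 : 0 <= l by clear -l100; lra.
rewrite -(ler_pM2r nR); apply: (@le_trans _ _ (8 * 16 * l)); first by clear -pnl; lra.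
rewrite ler_pdivrMr // in leta.
by have := ler_wpM2l l0 leta; have := ler_wpM2l (ltW et0) ln2; clear; lra.
Qed.

End Models.

Theorem theorem1p3 (R : realType) (eps : R) (eps_gt0 : 0 < eps) :
  exists c C : R, 0 < c /\ 0 < C /\
    (forall (D : set nat) (k : nat -> nat),
       (forall n, D n -> (2 < k n)%N /\ (k n)%:R < 5^-1 * ln (n%:R : R) /\
                         ~~ odd (k n * n)%N) ->
       with_high_probability D (fun n => random_regular R (k n) (n:=n))
         (fun n => tww_bounds c C (n:=n))) /\
    (forall (D : set nat) (m : nat -> nat),
       (forall n, D n -> (1 + eps) * n%:R <= (m n)%:R /\
                         (m n)%:R <= 11^-1 * n%:R * ln (n%:R : R)) ->
       with_high_probability D (fun n => random_gnm R (m n) (n:=n))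
         (fun n => tww_bounds c C (n:=n))) /\
    (forall (D : set nat) (p : nat -> R),
       (forall n, D n -> (1 + eps) / n%:R <= p n /\
                         p n <= 12^-1 * (ln n%:R / n%:R)) ->
       with_high_probability D (fun n => random_gnp (p n) (n:=n))
         (fun n => tww_bounds c C (n:=n))).

Proof.
(* The constants of the binomial model serve all three models: they satisfy $dl \le \min(eps, 1/2)$
   and $C_0 \ge 32$. *)
pose e1 : R := Num.min eps 1; pose th : R := e1 ^+ 2 / 64.
have e10 : 0 < e1 by rewrite lt_min eps_gt0 ltr01.
have e11 : e1 <= 1 by rewrite ge_min lexx orbT.
have e1e : e1 <= eps by rewrite ge_min lexx.
have e2 : e1 ^+ 2 <= e1 by rewrite expr2 ler_piMr // ltW.
have th0 : 0 < th by rewrite divr_gt0 // exprn_gt0.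
have the : th * 64 <= e1 by rewrite /th divfK // pnatr_eq0.
have t20 : 0 < th ^+ 2 by rewrite exprn_gt0.
have t2 : th ^+ 2 <= 1 / 64.
  have t1 : th <= 1 / 64 by lra.
  by have := ler_pM (ltW th0) (ltW th0) t1 t1; rewrite -expr2; lra.
have dl0 : 0 < th ^+ 2 / 8 by rewrite divr_gt0.
have dle : th ^+ 2 / 8 <= eps.
  by have : th ^+ 2 <= th by [rewrite expr2 ler_piMr // ltW //; lra]; lra.
have C32 : 32 <= 4 / th ^+ 2 by rewrite ler_pdivlMr //; lra.
have C01 : 1 <= 4 / th ^+ 2 by lra.
have [c [C [c0 C0 core]]] := whp_tww_bounds dl0 C01.
exists c, C; split => //; split => //.
have whp (D : set nat) (mu : forall n, sgraph 'I_n -> R) (B : nat -> R) :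
    (forall eta, 0 < eta -> exists n1 : nat, forall n, (n1 <= n)%N -> D n ->
       sparse_dense (mu n) (th ^+ 2 / 8) (4 / th ^+ 2) (B n) eta) ->
    with_high_probability D mu (fun n => tww_bounds c C (n := n)).
  move=> model; apply: with_high_probability_of => eta eta0.
  have eta6 : 0 < eta / 6 by rewrite divr_gt0.
  have [n1 H1] := core _ eta6; have [n2 H2] := model _ eta6.
  exists (maxn n1 n2) => n; rewrite geq_max => /andP[nn1 nn2] Dn.
  have [m0 m1 ms [b1 b2] bad] := H2 n nn2 Dn; split; last exact: graph_prob_le1.
  have := H1 n (mu n) (B n) nn1 m0 m1 ms b1 b2 bad.
  by rewrite mulrCA divff ?mulr1 // pnatr_eq0.
split; [|split].
- move=> D k Dk; apply: (whp _ _ (fun n => 32 * (k n)%:R)) => eta eta0.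
  have d2 : th ^+ 2 / 8 <= 1 / 2 by lra.
  have [n1 H] := regular_model d2 C32 eta0; exists n1 => n nn Dn.
  by have [h1 [h2 h3]] := Dk n Dn; apply: H.
- move=> D m Dm; apply: (whp _ _ (fun n => 4 * (m n)%:R / n%:R)) => eta eta0.
  have C2 : 2 <= 4 / th ^+ 2 by lra.
  have [n1 H] := gnm_model eps_gt0 dle C2 eta0; exists n1 => n nn Dn.
  by have [h1 h2] := Dm n Dn; apply: H.
move=> D p Dp; apply: (whp _ _ (fun n => p n * n%:R)) => eta eta0.
have [n1 H] := gnp_model eps_gt0 eta0; exists n1 => n nn Dn.
by have [h1 h2] := Dp n Dn; apply: H.
Qed.
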